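(* Let $1 < p < \infty$ and let $1/p + 1/q = 1$. Suppose that $\phi \in (A^p)^*$ is given by $\phi(f) = \int_{\mathbb{D}} f\, \overline{g}\, d\sigma$ for some $g \in H^q$ with $g \neq 0$. Let $f^{\star} \in A^p$ be the unique function with $\|f^{\star}\|_{A^p} = 1$ and $\operatorname{Re}\phi(f^{\star}) = \sup_{\|f\|_{A^p} = 1} \operatorname{Re}\phi(f) = \|\phi\|$. Then $f^{\star}$ belongs to $H^p$ and satisfies $$\|f^{\star}\|_{H^p} \le \left\{ \max(p-1,1)\, \frac{C_p \|g\|_{H^q}}{\|g\|_{A^q}} \right\}^{q/p},$$ where $C_p$ is the constant, depending only on $p$, in the inequality $\|h\|_{A^q} \le C_p \|\psi_h\|$ ($h \in A^q$) described in the context.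
   Context: $\mathbb{D}$ is the open unit disc in $\mathbb{C}$ and $\sigma$ is Lebesgue area measure on $\mathbb{D}$ divided by $\pi$. For $0<s<\infty$, the Bergman space $A^s$ consists of all functions $f$ analytic in $\mathbb{D}$ with $\|f\|_{A^s}^s = \int_{\mathbb{D}} |f(z)|^s\, d\sigma(z) < \infty$. The Hardy space $H^s$ consists of all functions $f$ analytic in $\mathbb{D}$ with $\|f\|_{H^s} = \sup_{0<r<1} \left\{\frac{1}{2\pi}\int_0^{2\pi} |f(re^{i\theta})|^s\, d\theta\right\}^{1/s} < \infty$. One has $H^s \subset A^s$. For $1 < p < \infty$ with $1/p + 1/q = 1$, each $h \in A^q$ defines a functional $\psi_h \in (A^p)^*$ by $\psi_h(f) = \int_{\mathbb{D}} f\, \overline{h}\, d\sigma$. The map $h \mapsto \psi_h$ is a bijection of $A^q$ onto $(A^p)^*$, and there is a constant $C_p$ depending only on $p$ such that $\|\psi_h\| \le \|h\|_{A^q} \le C_p \|\psi_h\|$ for all $h \in A^q$; $C_p$ denotes such a constant. Here $\|\psi_h\|$ is the norm of $\psi_h$ in $(A^p)^*$. The space $A^p$ is uniformly convex for $1<p<\infty$, so the extremal function $f^\star$ for a nonzero functional exists and is unique. *)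

(* Defs.v *)
From HB Require Import structures.
From mathcomp Require Import all_boot all_order all_algebra.
From mathcomp Require Import complex.
From mathcomp Require Import all_classical all_reals all_analysis.

Set Implicit Arguments.
Unset Strict Implicit.
Unset Printing Implicit Defensive.

Import Order.TTheory GRing.Theory Num.Theory.
Import numFieldNormedType.Exports.

Local Open Scope classical_set_scope.
Local Open Scope complex_scope.
Local Open Scope ring_scope.

(* Functions on the unit disc are total functions R[i] -> R[i]; every notion
   below only looks at their values on the disc.  [ComplexField.Normc.normc]
   is the R-valued modulus, while [`|z|] lies in R[i].  Norms are \bar R-valued
   and may be +oo; the spaces are cut out by finiteness of the norm. *)

Definition unit_disc {R : realType} : set R[i] :=
  [set z | ComplexField.Normc.normc z < 1].

(* Local power series expansion at every point of D.  [R[i]^o] carries the topology given by the modulus. *)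
Definition analytic_on {R : realType} (D : set R[i]) (f : R[i] -> R[i]) : Prop :=
  forall c, D c -> exists (a : nat -> R[i]) (r : R), 0 < r /\
    forall z, ComplexField.Normc.normc (z - c) < r ->
      series (fun n => a n * (z - c) ^+ n : R[i]^o) @ \oo --> (f z : R[i]^o).

Definition to_complex {R : realType} (u : R * R) : R[i] := u.1 +i* u.2.

Fact inv_pi_ge0 (R : realType) : 0 <= (pi : R)^-1.
Proof. by rewrite invr_ge0 pi_ge0. Qed.

(* Area measure divided by pi, in the coordinates (x, y) of z = x + iy. *)
Definition sigma {R : realType} : {measure set (measurableTypeR R * measurableTypeR R) -> \bar R} :=
  mscale (NngNum (inv_pi_ge0 R)) (lebesgue_measure \x lebesgue_measure)%E.

Definition disc_coord {R : realType} : set (R * R) :=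
  to_complex @^-1` unit_disc.

Definition bergman_norm {R : realType} (s : R) (f : R[i] -> R[i]) : \bar R :=
  ((\int[sigma]_(u in disc_coord)
      ((ComplexField.Normc.normc (f (to_complex u))) `^ s)%:E) `^ s^-1)%E.

Definition bergman {R : realType} (s : R) : set (R[i] -> R[i]) :=
  [set f | analytic_on unit_disc f /\ (bergman_norm s f < +oo)%E].

Definition polar {R : realType} (r t : R) : R[i] := (r * cos t) +i* (r * sin t).

Definition circle_mean {R : realType} (s r : R) (f : R[i] -> R[i]) : \bar R :=
  (((2 * pi)^-1)%:E * \int[lebesgue_measure]_(t in `[0%R, (2 * pi)%R])
      ((ComplexField.Normc.normc (f (polar r t))) `^ s)%:E)%E.

Definition hardy_norm {R : realType} (s : R) (f : R[i] -> R[i]) : \bar R :=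
  ereal_sup [set (circle_mean s r f `^ s^-1)%E | r in `]0, 1[].

Definition hardy {R : realType} (s : R) : set (R[i] -> R[i]) :=
  [set f | analytic_on unit_disc f /\ (hardy_norm s f < +oo)%E].

(* [Rintegral] is total; the value is meaningful when F is integrable, as is
   f * conj h for f in A^p and h in A^q with conjugate exponents. *)
Definition complex_integral {R : realType} (F : R[i] -> R[i]) : R[i] :=
  (\int[sigma]_(u in disc_coord) complex.Re (F (to_complex u)))
  +i* (\int[sigma]_(u in disc_coord) complex.Im (F (to_complex u))).

Definition psi {R : realType} (h f : R[i] -> R[i]) : R[i] :=
  complex_integral (fun z => f z * conjc (h z)).

Definition dual_norm {R : realType} (p : R) (phi : (R[i] -> R[i]) -> R[i])
    : \bar R :=
  ereal_sup [set (ComplexField.Normc.normc (phi f))%:E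
    | f in [set f | bergman p f /\ (bergman_norm p f <= 1)%E]].

Definition extremal {R : realType} (p : R) (phi : (R[i] -> R[i]) -> R[i])
    (F : R[i] -> R[i]) : Prop :=
  [/\ bergman p F,
      bergman_norm p F = 1%E,
      (complex.Re (phi F))%:E =
        ereal_sup [set (complex.Re (phi f))%:E
          | f in [set f | bergman p f /\ bergman_norm p f = 1%E]]
    & (complex.Re (phi F))%:E = dual_norm p phi].

(* Main.v *)
Require Import Defs.
From HB Require Import structures.
From mathcomp Require Import all_boot all_order all_algebra.
From mathcomp Require Import complex.
From mathcomp Require Import all_classical all_reals all_analysis.
From mathcomp Require Import measurable_realfun ring lra.
Import Order.TTheory GRing.Theory Num.Theory.
Import numFieldNormedType.Exports.
Local Open Scope classical_set_scope.
Local Open Scope complex_scope.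
Local Open Scope ring_scope.
Set Implicit Arguments.
Unset Strict Implicit.
Unset Printing Implicit Defensive.

(* Let m(r) be the integral of |f*|^p over the circle of radius r, b(r) that of
   Re(f* conj g), Phi = ||phi|| and G = ||g||_{H^q}.  The dilations mu f*(rho z),
   scaled to norm at most 1, compete with f* in the extremal problem.  The
   integral over a circle of f(s e^it) conj(g(r e^it)) depends only on s r, so
   the pairing of the dilation with g is a radial integral of b over
   ]0, sqrt rho[, and extremality of f* yields
     Phi/p * int_rho^1 r m
       <= int_0^1 r b - rho^(2/p-1) * int_0^(sqrt rho) r b.
   By Holder on circles |b| / 2 pi <= G (m / 2 pi)^(1/p).  Since m is
   nondecreasing, dividing by 1 - rho and letting rho -> 1 gives
   M <= max(p-1,1) (G/Phi) M^(1/p) for M = sup m / 2 pi; an a priori bound on M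
   comes from the same inequality, and Phi >= ||g||_{A^q} / C_p concludes. *)

(** * The modulus and power series *)

(** The weight [rho^(2/p-1)] has two sources. The dilation scales area by [rho^(-2)], so its
    normalising factor contains [rho^(2/p)]; and moving both functions of the pairing to the common
    radius [sqrt rho * r] costs [1/rho]. The constant is max(p-1,1) = p/2 (1 + |2/p-1|). In the
    bracket, 1 is the part of the pairing lost on the annulus beyond [sqrt rho], and |2/p-1| is the
    drift of the weight away from 1. The factor p undoes the 1/p that concavity of the p-th root
    produces. The factor 1/2 compares the radial masses (1-rho)/2 of ]sqrt rho,
    1[ and (1-rho^2)/2 of ]rho, 1[. An inequality M <= K M^(1/p) says nothing when M is infinite, so
    finiteness of M has to be proved separately. Once M is finite, M^(1/p) <= K^(1/(p-1)), and
    1/(p-1) = q/p. One mechanism replaces Cauchy's theorem: if the radial derivative of an integrand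
    is an angular derivative of a periodic function, its circle integral does not depend on the
    radius. This yields both the mean value property and the invariance of the pairing. *)

Section NormC.
Context {R : realType}.
Implicit Types (z w : R[i]) (a b : R).
Local Notation N := (@ComplexField.Normc.normc R).

Lemma normc_sqrt z : N z = Num.sqrt (complex.Re z ^+ 2 + complex.Im z ^+ 2).
Proof. by case: z. Qed.

Lemma normc_ge0 z : 0 <= N z.
Proof. by rewrite normc_sqrt sqrtr_ge0. Qed.

Lemma sqr_normc_ReIm z : N z ^+ 2 = complex.Re z ^+ 2 + complex.Im z ^+ 2.
Proof. by rewrite normc_sqrt sqr_sqrtr// addr_ge0 ?sqr_ge0. Qed.

Lemma normcX z n : N (z ^+ n) = N z ^+ n.
Proof.
elim: n => [|n ih]; first by rewrite !expr0 ComplexField.Normc.normc1.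
by rewrite !exprS ComplexField.Normc.normcM ih.
Qed.

Lemma normc_real a : N a%:C%C = `|a|.
Proof. by rewrite normc_sqrt /= expr0n addr0 sqrtr_sqr. Qed.

Lemma norm_normc z : `|z| = (N z)%:C%C.
Proof. by []. Qed.

Lemma normc_addr z w : N (z + w) <= N z + N w.
Proof.
have := ler_normD z w.
by rewrite !norm_normc -rmorphD/= lecR.
Qed.

Lemma normcB z w : N (z - w) = N (w - z).
Proof.
apply: complexI.
by rewrite -!norm_normc distrC.
Qed.

Lemma normcNE z : N (- z) = N z.
Proof. by apply: complexI; rewrite -!norm_normc normrN. Qed.

Lemma ler_Re_normc z : `|complex.Re z| <= N z.
Proof. by have := normc_ge_Re z; rewrite norm_normc lecR. Qed.

Lemma ler_Im_normc z : `|complex.Im z| <= N z.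
Proof.
rewrite -sqrtr_sqr normc_sqrt ler_wsqrtr// lerDr sqr_ge0//.
Qed.

End NormC.

(** * Quadratic Taylor remainders of power series *)

Section LocalExpansion.
Context {R : realType}.
Implicit Types (z w h c : R[i]) (m : R) (f : R[i] -> R[i]).
Local Notation N := (@ComplexField.Normc.normc R).

Lemma normc_expr_taylor2 (m : R) z h n : 0 < m -> N z <= m -> N h <= m ->
  N ((z + h) ^+ n - z ^+ n - n%:R * h * z ^+ n.-1) <=
    N h ^+ 2 / m ^+ 2 * (2 * m) ^+ n.
Proof.
move=> m0 zm hm.
(* The factor 2^n - 1 - n is the sum of the binomial coefficients of order at least 2. It satisfies
   2(2^n - 1 - n) + n = 2^(n+1) - 1 - (n+1), so the induction closes with equality. *)
suff : N ((z + h) ^+ n - z ^+ n - n%:R * h * z ^+ n.-1) <=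
    N h ^+ 2 / m ^+ 2 * ((2 ^+ n - 1 - n%:R) * m ^+ n).
  move=> /le_trans; apply; apply: ler_wpM2l.
    by rewrite divr_ge0 ?exprn_ge0 ?normc_ge0 ?ltW.
  rewrite exprMn; apply: ler_wpM2r; first by rewrite exprn_ge0 ?ltW.
  by have : 0 <= n%:R :> R by []; lra.
elim: n => [|n ih].
  rewrite !expr0 subrr mul0r mul0r subrr ComplexField.Normc.normc0.
  by rewrite subrr subr0 mul0r mulr0.
have -> : (z + h) ^+ n.+1 - z ^+ n.+1 - n.+1%:R * h * z ^+ n.+1.-1 =
  (z + h) * ((z + h) ^+ n - z ^+ n - n%:R * h * z ^+ n.-1)
  + n%:R * (h ^+ 2 * z ^+ n.-1).
  case: n {ih} => [|n] /=; first by rewrite !expr1 !expr0; ring.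
  by rewrite !exprS -natr1; ring.
apply: (le_trans (normc_addr _ _)).
rewrite !ComplexField.Normc.normcM !normcX.
have -> : N n%:R = n%:R :> R.
  have -> : n%:R = n%:R%:C%C :> R[i] by rewrite rmorph_nat.
  by rewrite normc_real normr_nat.
have zh : N (z + h) <= 2 * m.
  by apply: (le_trans (normc_addr _ _)); rewrite (mulr_natl _ 2) mulr2n lerD.
have H1 := ler_pM (normc_ge0 _) (normc_ge0 _) zh ih.
have H2 : n%:R * (N h ^+ 2 * N z ^+ n.-1) <= N h ^+ 2 / m ^+ 2 * (n%:R * m ^+ n.+1).
  case: n {ih H1} => [|n] /=; first by rewrite !mul0r mulr0.
  have -> : N h ^+ 2 / m ^+ 2 * (n.+1%:R * m ^+ n.+2) = n.+1%:R * (N h ^+ 2 * m ^+ n).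
    by rewrite (exprD m 2 n); field; rewrite gt_eqF.
  rewrite ler_wpM2l// ler_wpM2l ?sqr_ge0//.
  by rewrite lerXn2r// nnegrE ?normc_ge0// ltW.
apply: (le_trans (lerD H1 H2)).
rewrite le_eqVlt; apply/orP; left; apply/eqP.
by rewrite !exprS -natr1; field; rewrite gt_eqF.
Qed.

Definition psum (a : nat -> R[i]) z n : R[i] := \sum_(0 <= k < n) a k * z ^+ k.

Definition dpsum (a : nat -> R[i]) z n : R[i] :=
  \sum_(0 <= k < n) a k * (k%:R * z ^+ k.-1).

(** The bound is uniform in n, so it survives the passage to the limit and no termwise
    differentiation of the series is required. *)
Lemma psum_taylor2 (a : nat -> R[i]) (m K : R) z h n : 0 < m ->
  (forall k, N (a k) * (4 * m) ^+ k <= K) -> N z <= m -> N h <= m ->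
  N (psum a (z + h) n - psum a z n - h * dpsum a z n) <= 2 * K / m ^+ 2 * N h ^+ 2.
Proof.
move=> m0 aK zm hm.
have K0 : 0 <= K by apply: le_trans (aK 0%N); rewrite mulr_ge0 ?normc_ge0.
rewrite /psum /dpsum mulr_sumr -!sumrB.
(* Coefficients are controlled at radius 4m while z + h stays within 2m; the ratio of the radii
   gives the geometric factor. *)
have H (k : nat) : N (a k * (z + h) ^+ k - a k * z ^+ k - h * (a k * (k%:R * z ^+ k.-1)))
    <= K * N h ^+ 2 / m ^+ 2 * (1/2) ^+ k.
  have -> : a k * (z + h) ^+ k - a k * z ^+ k - h * (a k * (k%:R * z ^+ k.-1)) =
     a k * ((z + h) ^+ k - z ^+ k - k%:R * h * z ^+ k.-1) by ring.
  rewrite ComplexField.Normc.normcM.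
  apply: (le_trans (ler_wpM2l (normc_ge0 _) (normc_expr_taylor2 k m0 zm hm))).
  have -> : N (a k) * (N h ^+ 2 / m ^+ 2 * (2 * m) ^+ k) =
     (N (a k) * (4 * m) ^+ k) * (N h ^+ 2 / m ^+ 2 * (1/2) ^+ k).
    have -> : (4 * m) ^+ k = 2 ^+ k * (2 * m) ^+ k by rewrite -exprMn; congr (_ ^+ _); ring.
    by rewrite expr_div_n expr1n; field; rewrite expf_neq0// gt_eqF.
  have -> : K * N h ^+ 2 / m ^+ 2 * (1 / 2) ^+ k = K * (N h ^+ 2 / m ^+ 2 * (1 / 2) ^+ k).
    by rewrite !mulrA.
  apply: ler_wpM2r (aK k).
  by rewrite mulr_ge0 ?divr_ge0 ?exprn_ge0 ?normc_ge0 ?ltW// divr_ge0.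
suff : N (\sum_(0 <= k < n)
    (a k * (z + h) ^+ k - a k * z ^+ k - h * (a k * (k%:R * z ^+ k.-1)))) <=
    K * N h ^+ 2 / m ^+ 2 * (2 - 2 * (1/2) ^+ n).
  move=> /le_trans; apply.
  have -> : 2 * K / m ^+ 2 * N h ^+ 2 = K * N h ^+ 2 / m ^+ 2 * 2 by ring.
  apply: ler_wpM2l; first by rewrite divr_ge0 ?mulr_ge0 ?exprn_ge0 ?normc_ge0 ?(ltW m0).
  by rewrite gerBl mulr_ge0// exprn_ge0// divr_ge0.
elim: n => [|n ih].
  by rewrite big_geq// ComplexField.Normc.normc0 expr0 mulr1 subrr mulr0.
rewrite big_nat_recr//=.
apply: (le_trans (normc_addr _ _)).
apply: (le_trans (lerD ih (H n))).
rewrite le_eqVlt; apply/orP; left; apply/eqP.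
by rewrite (exprS _ n); field; rewrite gt_eqF.
Qed.

Lemma dpsum0 a n : (1 < n)%N -> dpsum a 0 n = a 1%N.
Proof.
case: n => [//|[//|n]] _; rewrite /dpsum big_nat_recl// big_nat_recl//=.
rewrite mul0r mulr0 add0r expr0 mulr1 mulr1 big1 ?addr0// => i _.
by rewrite expr0n/= mulr0 mulr0.
Qed.

Lemma cvg_series_normc (u : nat -> R[i]) (l : R[i]) (e : R) :
  series (u : nat -> R[i]^o) @ \oo --> (l : R[i]^o) -> 0 < e ->
  \forall n \near \oo, N (l - \sum_(0 <= k < n) u k) < e.
Proof.
move=> /cvgrPdist_lt ul e0.
have /ul : 0 < e%:C%C :> R[i] by rewrite ltcR.
by apply: filterS => n; rewrite norm_normc ltcR.
Qed.

(** Convergence at the point c + 4m, half way to the radius r, bounds the terms there. From [n0] on,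
    consecutive partial sums are both within 1 of the limit, so a term is at most 2; the finitely
    many earlier terms are absorbed into their sum. *)
Lemma analytic_local_coef f c : analytic_on unit_disc f -> unit_disc c ->
  exists (a : nat -> R[i]) (m K : R), [/\ 0 < m, 0 <= K,
    (forall k, N (a k) * (4 * m) ^+ k <= K) &
    forall z (e : R), N z <= 4 * m -> 0 < e ->
      \forall n \near \oo, N (f (c + z) - psum a z n) < e].
Proof.
move=> fa Dc; have [a [r [r0 ar]]] := fa _ Dc.
pose m := r / 8.
have m0 : 0 < m by rewrite divr_gt0.
have m8 : r = 8 * m by rewrite /m; field.
have cvgz z (e : R) : N z <= 4 * m -> 0 < e ->
      \forall n \near \oo, N (f (c + z) - psum a z n) < e.
  move=> zm e0.
  have zr : N z < r by rewrite (le_lt_trans zm)// m8 ltr_pM2r// ltr_nat.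
  have := ar (c + z); rewrite addrAC subrr add0r => /(_ zr) cz.
  exact: cvg_series_normc cz e0.
have zN : N (4 * m)%:C%C <= 4 * m by rewrite normc_real ger0_norm// mulr_ge0// ltW.
have [n0 _ Hn0] := cvgz _ 1 zN ltr01.
pose t k := N (a k) * (4 * m) ^+ k.
have t0 k : 0 <= t k by rewrite mulr_ge0 ?normc_ge0// exprn_ge0// mulr_ge0// ltW.
exists a, m, (2 + \sum_(0 <= k < n0) t k); split => //.
  by rewrite addr_ge0// sumr_ge0.
move=> k; rewrite -/(t k).
case: (ltnP k n0) => kn0.
  rewrite big_mkord (bigD1 (Ordinal kn0))//= addrCA lerDl addr_ge0// sumr_ge0//.
apply: (@le_trans _ _ 2); last by rewrite lerDl sumr_ge0.
have -> : t k = N (psum a (4 * m)%:C%C k.+1 - psum a (4 * m)%:C%C k).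
  rewrite /psum big_nat_recr//= addrAC subrr add0r ComplexField.Normc.normcM normcX.
  by rewrite normc_real ger0_norm// mulr_ge0// ltW.
have -> : psum a (4 * m)%:C%C k.+1 - psum a (4 * m)%:C%C k =
   (f (c + (4 * m)%:C%C) - psum a (4 * m)%:C%C k) +
   - (f (c + (4 * m)%:C%C) - psum a (4 * m)%:C%C k.+1) by ring.
apply: (le_trans (normc_addr _ _)); rewrite normcNE.
by rewrite -(natr1 1) lerD// ltW// Hn0//= (leq_trans kn0).
Qed.

(** The first estimate identifies the derivative at the centre only. The second compares two
    difference quotients at a nearby z, cross-multiplied to avoid division and with no derivative in
    it; it carries the uniformity in z. *)
Lemma analytic_local_quotient f c : analytic_on unit_disc f -> unit_disc c ->
  exists (d : R[i]) (m C : R), [/\ 0 < m, 0 <= C,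
    (forall h, N h <= m -> N (f (c + h) - f c - h * d) <= C * N h ^+ 2) &
    forall z h1 h2, N z <= m -> N h1 <= m -> N h2 <= m ->
      N (h2 * (f (c + (z + h1)) - f (c + z)) - h1 * (f (c + (z + h2)) - f (c + z)))
      <= C * (N h1 * N h2 * (N h1 + N h2))].
Proof.
move=> fa Dc; have [a [m [K [m0 K0 aK cv]]]] := analytic_local_coef fa Dc.
pose C := 2 * K / m ^+ 2.
have C0 : 0 <= C by rewrite divr_ge0 ?mulr_ge0 ?exprn_ge0 ?(ltW m0).
have m4 z : N z <= m -> N z <= 4 * m.
  move=> zm; apply: (le_trans zm); rewrite ler_peMl ?(ltW m0)// -[1]/(1%:R); first by rewrite ler_nat.
have m4' z h : N z <= m -> N h <= m -> N (z + h) <= 4 * m.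
  move=> zm hm; apply: (le_trans (normc_addr _ _)); apply: (le_trans (lerD zm hm)).
  by rewrite -mulr2n -(mulr_natl m 2) ler_wpM2r ?(ltW m0)// ler_nat.
exists (a 1%N), m, C; split => // [h hm|z h1 h2 zm h1m h2m].
  apply/ler_addgt0Pr => e e0.
  have e2 : 0 < e / 2 by rewrite divr_gt0.
  have N0 : N (0 : R[i]) <= m by rewrite ComplexField.Normc.normc0 ltW.
  have [n /= [n1 n2 n3]] : exists n, [/\ N (f (c + h) - psum a h n) < e / 2,
     N (f (c + 0) - psum a 0 n) < e / 2 & (1 < n)%N].
    have := cv _ _ (m4 _ hm) e2; have := cv _ _ (m4 _ N0) e2.
    move=> [i _ Hi] [j _ Hj]; exists (maxn 2 (maxn i j)); split.
    - by apply: Hj => /=; rewrite !leq_max leqnn !orbT.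
    - by apply: Hi => /=; rewrite !leq_max leqnn !orbT.
    - by rewrite leq_max.
  have := psum_taylor2 n m0 aK N0 hm; rewrite add0r dpsum0// -/C => H.
  rewrite addr0 in n2.
  have -> : f (c + h) - f c - h * a 1%N = (f (c + h) - psum a h n)
     + (- (f c - psum a 0 n) + (psum a h n - psum a 0 n - h * a 1%N)) by ring.
  apply: (le_trans (normc_addr _ _)).
  have := normc_addr (- (f c - psum a 0 n)) (psum a h n - psum a 0 n - h * a 1%N).
  rewrite normcNE; lra.
apply/ler_addgt0Pr => e e0.
(* The truncation errors add up to at most 2e'(|h1| + |h2|) <= 4 m e' <= e. *)
pose e' := e / (4 * (1 + m)).
have e'0 : 0 < e' by rewrite divr_gt0// mulr_gt0// addr_gt0.
have [n /= [n1 n2 n3]] : exists n, [/\ N (f (c + (z + h1)) - psum a (z + h1) n) < e',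
     N (f (c + (z + h2)) - psum a (z + h2) n) < e' & N (f (c + z) - psum a z n) < e'].
  have := cv _ _ (m4' _ _ zm h1m) e'0; have := cv _ _ (m4' _ _ zm h2m) e'0.
  have := cv _ _ (m4 _ zm) e'0.
  move=> [i _ Hi] [j _ Hj] [k _ Hk]; exists (maxn i (maxn j k)); split.
  - by apply: Hk => /=; rewrite !leq_max leqnn !orbT.
  - by apply: Hj => /=; rewrite !leq_max leqnn !orbT.
  - by apply: Hi => /=; rewrite !leq_max leqnn.
have := psum_taylor2 n m0 aK zm h1m; have := psum_taylor2 n m0 aK zm h2m.
rewrite -/C.
set E2 := psum a (z + h2) n - _ - _; set E1 := psum a (z + h1) n - _ - _ => H2 H1.
set F1 := f (c + (z + h1)) - _ in n1; set F2 := f (c + (z + h2)) - _ in n2.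
set F0 := f (c + z) - _ in n3.
have -> : h2 * (f (c + (z + h1)) - f (c + z)) - h1 * (f (c + (z + h2)) - f (c + z)) =
   h2 * (E1 + (F1 - F0)) + - (h1 * (E2 + (F2 - F0))).
  by rewrite /E1 /E2 /F1 /F2 /F0; ring.
apply: (le_trans (normc_addr _ _)); rewrite normcNE !ComplexField.Normc.normcM.
have h1p := normc_ge0 h1; have h2p := normc_ge0 h2.
have A1 : N (E1 + (F1 - F0)) <= C * N h1 ^+ 2 + 2 * e'.
  have := normc_addr E1 (F1 - F0); have := normc_addr F1 (- F0); rewrite normcNE; lra.
have A2 : N (E2 + (F2 - F0)) <= C * N h2 ^+ 2 + 2 * e'.
  have := normc_addr E2 (F2 - F0); have := normc_addr F2 (- F0); rewrite normcNE; lra.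
have B1 := ler_wpM2l h2p A1; have B2 := ler_wpM2l h1p A2.
have ee : e = e' * (4 * (1 + m)) by rewrite /e' divfK// gt_eqF// mulr_gt0// addr_gt0.
have := ler_wpM2r (ltW e'0) h1m; have := ler_wpM2r (ltW e'0) h2m.
rewrite ee; move: B1 B2; nra.
Qed.

(* Locally uniform complex differentiability with derivative D, which is
   therefore continuous: no Cauchy theory is needed to get C^1 regularity. *)
Definition holo f (D : R[i] -> R[i]) := forall c, unit_disc c -> exists (m C : R), [/\ 0 < m, 0 <= C &
    forall z w, N (z - c) < m -> N (w - c) < m ->
      N (f w - f z - (w - z) * D z) <= C * N (w - z) ^+ 2].

Lemma analytic_C11 f : analytic_on unit_disc f -> exists D, holo f D.
Proof.
move=> fa.
have /choice[D HD] : forall c, exists d, unit_disc c -> exists (m C : R), [/\ 0 < m, 0 <= C &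
    (forall h, N h <= m -> N (f (c + h) - f c - h * d) <= C * N h ^+ 2)].
  move=> c; case: (pselect (unit_disc c)) => Dc; last by exists 0.
  by have [d [m [C [? ? ? _]]]] := analytic_local_quotient fa Dc; exists d => _; exists m, C.
exists D => c Dc.
have [_ [m [C [m0 C0 _ H]]]] := analytic_local_quotient fa Dc.
(* Half of m keeps the increment w - z within m; the other bound keeps z in the disc, where [D z] is
   defined by the expansion at z. *)
pose m' := Num.min (m / 2) (1 - N c).
have m'0 : 0 < m' by rewrite lt_min divr_gt0//= subr_gt0.
exists m', C; split => // z w zc wc.
have [m'm m'c] : m' <= m / 2 /\ m' <= 1 - N c by split; rewrite ge_min lexx ?orbT.
have Dz : unit_disc z.
  rewrite /unit_disc/= -(subrK c z); apply: (le_lt_trans (normc_addr _ _)).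
  by rewrite -ltrBrDr (lt_le_trans zc).
have [mz [Cz [mz0 Cz0 Hz]]] := HD _ Dz.
have [->|zw] := eqVneq w z.
  by rewrite !subrr mul0r subrr ComplexField.Normc.normc0 expr0n mulr0.
set h1 := w - z.
have h1m : N h1 <= m.
  have -> : h1 = (w - c) + - (z - c) by rewrite /h1; ring.
  apply: (le_trans (normc_addr _ _)); rewrite normcNE; lra.
have h10 : 0 <= N h1 by exact: normc_ge0.
(* The expansion at c compares the quotient for w - z with that for a small real t; the expansion at
   z compares the latter with [D z]. The radius [mz] depends on z, but it disappears as t tends to
   0. *)
have key (t : R) : 0 < t -> t <= m -> t <= mz ->
   N (f w - f z - h1 * D z) <= C * N h1 ^+ 2 + t * (N h1 * (C + Cz)).
  move=> t0 tm tmz.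
  have Nt : N t%:C%C = t by rewrite normc_real gtr0_norm.
  have zm : N (z - c) <= m by lra.
  have := H (z - c) h1 t%:C%C zm h1m; rewrite Nt => /(_ tm).
  have -> : c + (z - c + h1) = w by rewrite /h1; ring.
  have -> : c + (z - c + t%:C%C) = z + t%:C%C by ring.
  rewrite (subrKC c z).
  have := Hz t%:C%C; rewrite Nt => /(_ tmz) K1 K2.
  have := normc_addr (t%:C%C * (f w - f z) - h1 * (f (z + t%:C%C) - f z))
      (h1 * (f (z + t%:C%C) - f z - t%:C%C * D z)).
  have -> : (t%:C%C * (f w - f z) - h1 * (f (z + t%:C%C) - f z)) +
      (h1 * (f (z + t%:C%C) - f z - t%:C%C * D z)) = t%:C%C * (f w - f z - h1 * D z) by ring.
  rewrite !ComplexField.Normc.normcM Nt => K3.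
  have K4 := ler_wpM2l h10 K1.
  rewrite -(ler_pM2l t0); nra.
apply/ler_addgt0Pr => e e0.
pose t := Num.min (Num.min m mz) (e / (1 + N h1 * (C + Cz))).
have M0 : 0 < 1 + N h1 * (C + Cz).
  by rewrite (lt_le_trans ltr01)// lerDl mulr_ge0// addr_ge0.
have t0 : 0 < t by rewrite !lt_min m0 mz0 divr_gt0.
apply: (le_trans (key t t0 _ _)).
- by rewrite !ge_min lexx.
- by rewrite !ge_min lexx orbT.
rewrite lerD2l.
have : t <= e / (1 + N h1 * (C + Cz)) by rewrite !ge_min lexx orbT.
rewrite ler_pdivlMr//; apply: le_trans.
by rewrite ler_wpM2l ?(ltW t0)// lerDr.
Qed.

End LocalExpansion.

(** * Continuity and the chain rule along real curves *)

Section Holomorphic.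
Context {R : realType}.
Implicit Types (z w c : R[i]) (f g D : R[i] -> R[i]).
Local Notation N := (@ComplexField.Normc.normc R).

(** Stated with the real-valued modulus so that it composes directly with real parametrisations x +
    iy over any topological space. *)
Definition ncont g c := forall e : R, 0 < e -> exists2 d : R, 0 < d &
  forall z, N (z - c) < d -> N (g z - g c) < e.

Lemma lipschitz_ncont g c (m C : R) : 0 < m -> 0 <= C ->
  (forall z, N (z - c) < m -> N (g z - g c) <= C * N (z - c)) -> ncont g c.
Proof.
move=> m0 C0 H e e0.
have C1 : 0 < C + 1 by rewrite ltr_wpDl.
exists (Num.min m (e / (C + 1))); first by rewrite lt_min m0 divr_gt0.
move=> z; rewrite lt_min => /andP[zm ze].
apply: (le_lt_trans (H _ zm)).
move: ze; rewrite ltr_pdivlMr// => ze.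
have := normc_ge0 (z - c); nra.
Qed.

(** Adding the expansions from z to c and from c to z cancels the values of f and leaves (z - c)(D z
    - D c), so D is Lipschitz near c with constant 2C. *)
Lemma holo_ncont_deriv f D c : holo f D -> unit_disc c -> ncont D c.
Proof.
move=> fD Dc; have [m [C [m0 C0 H]]] := fD _ Dc.
apply: (@lipschitz_ncont D c m (2 * C)) => //; first by rewrite mulr_ge0.
move=> z zm.
have [->|zc] := eqVneq z c; first by rewrite !subrr ComplexField.Normc.normc0 mulr0.
have cc : N (c - c) < m by rewrite subrr ComplexField.Normc.normc0.
have H1 := H _ _ zm cc; have H2 := H _ _ cc zm.
have Nzc : 0 < N (z - c).
  rewrite lt_neqAle normc_ge0 andbT eq_sym; apply/eqP => /ComplexField.Normc.eq0_normc/eqP.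
  by rewrite subr_eq0 (negbTE zc).
rewrite -(ler_pM2l Nzc) -ComplexField.Normc.normcM.
have -> : (z - c) * (D z - D c) = (f c - f z - (c - z) * D z) + (f z - f c - (z - c) * D c).
  by ring.
apply: (le_trans (normc_addr _ _)); rewrite (normcB c z) in H1; nra.
Qed.

Lemma holo_ncont f D c : holo f D -> unit_disc c -> ncont f c.
Proof.
move=> fD Dc; have [m [C [m0 C0 H]]] := fD _ Dc.
apply: (@lipschitz_ncont f c m (C * m + N (D c))) => //.
  by rewrite addr_ge0 ?mulr_ge0 ?normc_ge0 ?(ltW m0).
move=> z zm.
have cc : N (c - c) < m by rewrite subrr ComplexField.Normc.normc0.
have H2 := H _ _ cc zm.
have -> : f z - f c = (f z - f c - (z - c) * D c) + (z - c) * D c by ring.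
apply: (le_trans (normc_addr _ _)); rewrite ComplexField.Normc.normcM.
have n0 := normc_ge0 (z - c).
have : C * N (z - c) ^+ 2 <= C * m * N (z - c).
  by rewrite expr2 -mulrA ler_wpM2l// ler_wpM2r// ltW.
nra.
Qed.

Lemma normc_le_ReIm (a b : R) : N (a +i* b) <= `|a| + `|b|.
Proof.
rewrite normc_sqrt/= -[leRHS]ger0_norm ?addr_ge0// -sqrtr_sqr ler_wsqrtr//.
by rewrite sqrrD !real_normK ?num_real//; have := mulr_ge0 (normr_ge0 a) (normr_ge0 b); lra.
Qed.

Lemma ncont_near (T : topologicalType) (x y : T -> R) t0 g (e : R) :
  {for t0, continuous x} -> {for t0, continuous y} ->
  ncont g (x t0 +i* y t0) -> 0 < e ->
  \forall t \near t0, N (g (x t +i* y t) - g (x t0 +i* y t0)) < e.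
Proof.
move=> cx cy gc e0; have [d d0 H] := gc _ e0.
have d2 : 0 < d / 2 by rewrite divr_gt0.
move/cvgrPdist_lt : cx => /(_ _ d2) cx; move/cvgrPdist_lt : cy => /(_ _ d2).
move: cx; apply: filterS2 => t xt yt; apply: H.
have -> : x t +i* y t - (x t0 +i* y t0) = (x t - x t0) +i* (y t - y t0) by [].
apply: (le_lt_trans (normc_le_ReIm _ _)).
rewrite distrC (distrC (y t)); lra.
Qed.

Lemma ncont_Re (T : topologicalType) (x y : T -> R) t0 g :
  {for t0, continuous x} -> {for t0, continuous y} ->
  ncont g (x t0 +i* y t0) ->
  {for t0, continuous (fun t => complex.Re (g (x t +i* y t)))}.
Proof.
move=> cx cy gc; apply/cvgrPdist_lt => e e0.
apply: filterS (ncont_near cx cy gc e0) => t; apply: le_lt_trans.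
rewrite distrC -raddfB; exact: ler_Re_normc.
Qed.

Lemma ncont_Im (T : topologicalType) (x y : T -> R) t0 g :
  {for t0, continuous x} -> {for t0, continuous y} ->
  ncont g (x t0 +i* y t0) ->
  {for t0, continuous (fun t => complex.Im (g (x t +i* y t)))}.
Proof.
move=> cx cy gc; apply/cvgrPdist_lt => e e0.
apply: filterS (ncont_near cx cy gc e0) => t; apply: le_lt_trans.
rewrite distrC -raddfB; exact: ler_Im_normc.
Qed.

Lemma ler_dist_normc z w : `|N z - N w| <= N (z - w).
Proof.
rewrite ler_norml; apply/andP; split.
  have := normc_addr (w - z) z; rewrite subrK normcB; lra.
by have := normc_addr (z - w) w; rewrite subrK; lra.
Qed.

Lemma ncont_normc (T : topologicalType) (x y : T -> R) t0 g :
  {for t0, continuous x} -> {for t0, continuous y} ->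
  ncont g (x t0 +i* y t0) ->
  {for t0, continuous (fun t => N (g (x t +i* y t)))}.
Proof.
move=> cx cy gc; apply/cvgrPdist_lt => e e0.
apply: filterS (ncont_near cx cy gc e0) => t; apply: le_lt_trans.
rewrite distrC; exact: ler_dist_normc.
Qed.

Lemma is_derive_cvg (u : R -> R) (t du : R) : is_derive t (1 : R) u du <->
  h^-1 * (u (t + h) - u t) @[h --> 0^'] --> du.
Proof.
have E : (fun h : R => h^-1 *: (u (h *: (1:R) + t) - u t)) = (fun h => h^-1 * (u (t + h) - u t)).
  by apply/funext => h; rewrite scaler1 (addrC h).
split=> [[du1 <-]|H].
  by rewrite -E; exact: du1.
apply: DeriveDef; rewrite /derivable /derive E; last exact/cvg_lim.
by apply/cvg_ex; exists du.
Qed.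

(** The chain rule, expressed by a real quantity tending to 0, so that the real and imaginary parts
    of the derivative can both be read off from it. *)
Lemma holo_taylor_curve (x y : R -> R) (t x' y' : R) f D :
  is_derive t (1:R) x x' -> is_derive t (1:R) y y' ->
  holo f D -> unit_disc (x t +i* y t) ->
  N ((h^-1)%:C%C * (f (x (t + h) +i* y (t + h)) - f (x t +i* y t)) -
     (h^-1 * (x (t + h) - x t) +i* (h^-1 * (y (t + h) - y t))) * D (x t +i* y t))
    @[h --> (0:R)^'] --> (0:R).
Proof.
move=> dx dy fD Dt; have [m [C [m0 C0 H]]] := fD _ Dt.
have cx : {for t, continuous x}.
  by apply/differentiable_continuous/derivable1_diffP; exact: ex_derive.
have cy : {for t, continuous y}.
  by apply/differentiable_continuous/derivable1_diffP; exact: ex_derive.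
have ch : (fun h : R => t + h) h @[h --> (0:R)^'] --> t.
  have : (fun h : R => t + h) h @[h --> (0:R)] --> t + 0.
    by apply: cvgD; [exact: cvg_cst|exact: cvg_id].
  rewrite addr0; apply: cvg_trans; apply: cvg_app; exact: nbhs_dnbhs.
have xh : x (t + h) - x t @[h --> (0:R)^'] --> (0:R).
  by rewrite -[X in _ --> X](subrr (x t)); apply: cvgB; [exact: (cvg_comp _ _ ch cx)|exact: cvg_cst].
have yh : y (t + h) - y t @[h --> (0:R)^'] --> (0:R).
  by rewrite -[X in _ --> X](subrr (y t)); apply: cvgB; [exact: (cvg_comp _ _ ch cy)|exact: cvg_cst].
have /is_derive_cvg dxh := dx; have /is_derive_cvg dyh := dy.
(* The remainder |h|^-1 |w - z|^2 is a sum of products of a convergent difference quotient and a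
   vanishing increment, up to the sign of h, which the second squeeze removes. *)
apply: (@squeeze_cvgr _ _ _ _ (cst 0) (fun h => C *
   ((h^-1 * (x (t + h) - x t)) * (x (t + h) - x t) + (h^-1 * (y (t + h) - y t)) * (y (t + h) - y t))
   * Num.sg h)).
- have m2 : 0 < m / 2 by rewrite divr_gt0.
  have /cvgr0Pnorm_lt/(_ _ m2) xm := xh; have /cvgr0Pnorm_lt/(_ _ m2) := yh; move: xm.
  have nz : \forall h \near (0:R)^', h != 0 by exact: nbhs_dnbhs_neq.
  move=> xm ym; move: nz xm ym; apply: filterS3.
  move=> h h0 xhm yhm; rewrite normc_ge0/=.
  set w := x (t + h) +i* y (t + h); set z := x t +i* y t.
  have wz : w - z = (x (t + h) - x t) +i* (y (t + h) - y t) by [].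
  have zz : N (z - z) < m by rewrite subrr ComplexField.Normc.normc0.
  have wzm : N (w - z) < m.
    rewrite wz; apply: (le_lt_trans (normc_le_ReIm _ _)); lra.
  have -> : (h^-1)%:C%C * (f w - f z) - (h^-1 * (x (t + h) - x t) +i* (h^-1 * (y (t + h) - y t))) * D z
     = (h^-1)%:C%C * (f w - f z - (w - z) * D z).
    rewrite [RHS]mulrBr [in RHS]mulrA; congr (_ - _ * _).
    by rewrite wz /real_complex_def; apply/eqP; rewrite eq_complex/= !mul0r subr0 addr0 !eqxx.
  rewrite ComplexField.Normc.normcM normc_real.
  have := ler_wpM2l (normr_ge0 h^-1) (H _ _ zz wzm).
  move=> /le_trans; apply.
  rewrite sqr_normc_ReIm wz/= normfV.
  have -> : `|h|^-1 = h^-1 * Num.sg h.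
    move: h0; case: (ltrgtP h 0) => // hs _; last by rewrite gtr0_norm// gtr0_sg// mulr1.
    by rewrite ltr0_norm// ltr0_sg// mulrN1 invrN.
  rewrite le_eqVlt; apply/orP; left; apply/eqP; ring.
- exact: cvg_cst.
- apply/norm_cvg0P.
  apply: (@squeeze_cvgr _ _ _ _ (cst 0) (fun h => `|C *
   ((h^-1 * (x (t + h) - x t)) * (x (t + h) - x t) + (h^-1 * (y (t + h) - y t)) * (y (t + h) - y t))|)).
  + apply: nearW => h; rewrite normr_ge0/= normrM.
    rewrite -[leRHS]mulr1 ler_wpM2l//.
    by rewrite normr_sg; case: (h == 0).
  + exact: cvg_cst.
  + apply/norm_cvg0P; rewrite -[X in _ --> X](mulr0 C); apply: cvgMr.
    rewrite [X in _ --> X](_ : 0 = x' * 0 + y' * 0); last by rewrite !mulr0 addr0.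
    by apply: cvgD; apply: cvgM.
Qed.

Lemma holo_derive_Re (x y : R -> R) (t x' y' : R) f D :
  is_derive t (1:R) x x' -> is_derive t (1:R) y y' ->
  holo f D -> unit_disc (x t +i* y t) ->
  is_derive t (1:R) (fun t => complex.Re (f (x t +i* y t)))
   (complex.Re (D (x t +i* y t)) * x' - complex.Im (D (x t +i* y t)) * y').
Proof.
move=> dx dy fD Dt; apply/is_derive_cvg.
have /is_derive_cvg dxh := dx; have /is_derive_cvg dyh := dy.
have H := holo_taylor_curve dx dy fD Dt.
rewrite -[X in _ --> X]add0r.
rewrite (_ : (fun h => _) = (fun h => complex.Re ((h^-1)%:C * (f (x (t + h) +i* y (t + h)) - f (x t +i* y t)) -
     (h^-1 * (x (t + h) - x t) +i* (h^-1 * (y (t + h) - y t))) * D (x t +i* y t)) +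
     (complex.Re (D (x t +i* y t)) * (h^-1 * (x (t + h) - x t)) -
      complex.Im (D (x t +i* y t)) * (h^-1 * (y (t + h) - y t))))); last first.
  apply/funext => h.
  case: (f (x (t + h) +i* y (t + h))) => a b; case: (f (x t +i* y t)) => a' b'.
  by case: (D _) => d1 d2 /=; ring.
apply: cvgD; last by apply: cvgB; apply: cvgMr.
apply/norm_cvg0P; apply: (@squeeze_cvgr _ _ _ _ (cst 0) _ _ _ _ _ H); last exact: cvg_cst.
by apply: nearW => h; rewrite normr_ge0/= ler_Re_normc.
Qed.

Lemma holo_derive_Im (x y : R -> R) (t x' y' : R) f D :
  is_derive t (1:R) x x' -> is_derive t (1:R) y y' ->
  holo f D -> unit_disc (x t +i* y t) ->
  is_derive t (1:R) (fun t => complex.Im (f (x t +i* y t)))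
   (complex.Re (D (x t +i* y t)) * y' + complex.Im (D (x t +i* y t)) * x').
Proof.
move=> dx dy fD Dt; apply/is_derive_cvg.
have /is_derive_cvg dxh := dx; have /is_derive_cvg dyh := dy.
have H := holo_taylor_curve dx dy fD Dt.
rewrite -[X in _ --> X]add0r.
rewrite (_ : (fun h => _) = (fun h => complex.Im ((h^-1)%:C * (f (x (t + h) +i* y (t + h)) - f (x t +i* y t)) -
     (h^-1 * (x (t + h) - x t) +i* (h^-1 * (y (t + h) - y t))) * D (x t +i* y t)) +
     (complex.Re (D (x t +i* y t)) * (h^-1 * (y (t + h) - y t)) +
      complex.Im (D (x t +i* y t)) * (h^-1 * (x (t + h) - x t))))); last first.
  apply/funext => h.
  case: (f (x (t + h) +i* y (t + h))) => a b; case: (f (x t +i* y t)) => a' b'.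
  by case: (D _) => d1 d2 /=; ring.
apply: cvgD; last by apply: cvgD; apply: cvgMr.
apply/norm_cvg0P; apply: (@squeeze_cvgr _ _ _ _ (cst 0) _ _ _ _ _ H); last exact: cvg_cst.
by apply: nearW => h; rewrite normr_ge0/= ler_Im_normc.
Qed.

End Holomorphic.

(** * Polar coordinates *)

Section AffineChange.
Context {R : realType}.
Local Notation mu := (@lebesgue_measure R).

(** The product carries the product sigma-algebra, so an open set is written as the countable union
    of the open rational rectangles that it contains. *)
Lemma open_measurable_prod (U : set (R * R)) : open U ->
  measurable (U : set (measurableTypeR R * measurableTypeR R)).
Proof.
move=> oU.
pose rect (q : rat * rat * rat * rat) : set (R * R) :=
  `]ratr q.1.1.1, ratr q.1.1.2[%classic `*` `]ratr q.1.2, ratr q.2[%classic.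
have -> : U = \bigcup_q (if `[< rect q `<=` U >] then rect q else set0).
  apply/seteqP; split => [[x y] Uxy|u [q _]]; last by case: ifPn => // /asboolP; apply.
  have := oU; rewrite openE => /(_ _ Uxy)[[A B]/= [[e1 e10 Ae] [e2 e20 Be]] AB].
  have [a1] : exists q, ratr q \in `]x - e1, x[ by apply: rat_in_itvoo; rewrite ltrBlDr ltrDl.
  have [a2] : exists q, ratr q \in `]x, x + e1[ by apply: rat_in_itvoo; rewrite ltrDl.
  have [b1] : exists q, ratr q \in `]y - e2, y[ by apply: rat_in_itvoo; rewrite ltrBlDr ltrDl.
  have [b2] : exists q, ratr q \in `]y, y + e2[ by apply: rat_in_itvoo; rewrite ltrDl.
  rewrite !in_itv/= => /andP[b21 b22] /andP[b11 b12] /andP[a21 a22] /andP[a11 a12].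
  exists (a1, a2, b1, b2) => //; rewrite ifT.
    by split; rewrite /= in_itv/= ?a12 ?a21 ?b12 ?b21.
  apply/asboolP => -[s t] [/=]; rewrite !in_itv/= => /andP[s1 s2] /andP[t1 t2].
  apply: AB; split => /=.
    by apply: Ae; rewrite /ball/= ltr_norml; apply/andP; split; lra.
  by apply: Be; rewrite /ball/= ltr_norml; apply/andP; split; lra.
apply: countable_bigcupT_measurable => // q.
by case: ifP => // _; apply: measurableX.
Qed.

Lemma open_continuous_measurable_prod (D : set (R * R)) (k : R * R -> R) : open D ->
  (forall u, D u -> {for u, continuous k}) ->
  measurable_fun (D : set (measurableTypeR R * measurableTypeR R)) k.
Proof.
move=> oD kc; apply: (measurability _ (RGenOInfty.measurableE R)) => //.
move=> _ [_ [a ->] <-]; apply: open_measurable_prod.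
rewrite openE => u [Du /= ku].
have := kc _ Du; move=> /(_ `]a, +oo[%classic) H.
apply: filterI; first by have := oD; rewrite openE; apply.
by apply: H; apply: open_nbhs_nbhs; split; [exact: interval_open|].
Qed.

Definition affine_fun (a b : R) : measurableTypeR R -> measurableTypeR R := fun t => a * t + b.

Lemma measurable_affine a b : measurable_fun setT (affine_fun a b).
Proof. by apply: measurable_funD => //; apply: measurable_funM. Qed.

Lemma lebesgue_measure_affine a b (a0 : 0 <= a) A : 0 < a -> measurable A ->
  pushforward (mscale (NngNum a0) mu) (affine_fun a b) A = mu A.
Proof.
move=> a_gt0 mA; apply/esym/(lebesgue_measure_unique (mu := measure_function_pushforward__canonical__measure_function_Measure (mscale (NngNum a0) mu) (@measurable_affine a b))) => //= _ [[c d]] _ <-.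
rewrite /pushforward/= /mscale/=.
have -> : affine_fun a b @^-1` `]c, d]%classic = `](c - b) / a, (d - b) / a]%classic.
  apply/seteqP; split => t /=; rewrite !in_itv/= /affine_fun.
    by rewrite ltr_pdivrMr// ler_pdivlMr// ltrBlDr lerBrDr (mulrC a).
  by rewrite ltr_pdivrMr// ler_pdivlMr// ltrBlDr lerBrDr (mulrC a).
rewrite !lebesgue_measure_itv/= !lte_fin ltr_pM2r ?invr_gt0// ltrD2r.
case: ifPn => // cd; last by rewrite mule0.
by rewrite -!EFinB -EFinM -mulrBl mulrC divfK ?gt_eqF//; congr EFin; ring.
Qed.

(** Proved at the level of measures because it will be applied to functions cut off at the disc,
    which are measurable but not continuous. *)
Lemma ge0_integral_affine (a b : R) (f : R -> \bar R) : 0 < a ->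
  measurable_fun setT f -> (forall x, 0 <= f x)%E ->
  (\int[mu]_x f x = a%:E * \int[mu]_t f (a * t + b)%R)%E.
Proof.
move=> a0 mf f0.
transitivity (\int[pushforward (mscale (NngNum (ltW a0)) mu) (affine_fun a b)]_x f x)%E.
  apply: (@eq_measure_integral _ _ _ _ (measure_function_pushforward__canonical__measure_function_Measure (mscale (NngNum (ltW a0)) mu) (@measurable_affine a b))) => A mA _.
  exact/esym/lebesgue_measure_affine.
rewrite ge0_integral_pushforward//; last exact: measurable_affine.
rewrite preimage_setT ge0_integral_mscale//.
by apply: measurableT_comp => //; exact: measurable_affine.
by move=> x _; exact: f0.
Qed.

End AffineChange.

Section HalfPlane.
Context {R : realType}.
Local Notation mu := (@lebesgue_measure R).

(** The substitution rule on [-n, n] passes to the whole line by monotone convergence, as the images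
    of these intervals under [atan] exhaust ]-pi/2, pi/2[. *)
Lemma ge0_integral_atan (k : R -> R) : continuous k -> (forall x, 0 <= k x) ->
  (\int[mu]_x (k (atan x) * (1 + x ^+ 2)^-1)%:E =
   \int[mu]_(x in `](- (pi / 2))%R, (pi / 2)%R[) (k x)%:E)%E.
Proof.
move=> kc k0.
have catan : continuous (@atan R) by move=> x; exact: continuous_atan.
have ckD : continuous (fun x => k (atan x) * (1 + x ^+ 2)^-1).
  move=> x; apply: cvgM; last exact: continuous_oneDsqrV.
  by apply: continuous_comp; [exact: catan|exact: kc].
pose F n : set R := `[(- n%:R), n%:R]%classic.
pose G n : set R := `[(atan (- n%:R)), (atan n%:R)]%classic.
have FG n : (\int[mu]_(x in F n) (k (atan x) * (1 + x ^+ 2)^-1)%:E = \int[mu]_(x in G n) (k x)%:E)%E.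
  rewrite /G (@integration_by_substitution_increasing _ (@atan R) k (- n%:R) n%:R).
  - by apply: eq_integral => x _; rewrite /= !fctE derive1_atan.
  - by rewrite ge0_cp.
  - by move=> x y _ _; exact: lt_atan.
  - move=> x _; rewrite (_ : (@atan R)^`()%classic = (fun x => (oneDsqr x)^-1)); last by apply/funext => y; rewrite derive1_atan.
    exact: continuous_oneDsqrV.
  - apply/cvg_ex; exists ((fun x => (oneDsqr x)^-1) (- n%:R)).
    rewrite (_ : (@atan R)^`()%classic = (fun x => (oneDsqr x)^-1)); last by apply/funext => y; rewrite derive1_atan.
    by apply: cvg_at_right_filter; exact: continuous_oneDsqrV.
  - apply/cvg_ex; exists ((fun x => (oneDsqr x)^-1) n%:R).
    rewrite (_ : (@atan R)^`()%classic = (fun x => (oneDsqr x)^-1)); last by apply/funext => y; rewrite derive1_atan.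
    by apply: cvg_at_left_filter; exact: continuous_oneDsqrV.
  - split.
    + by move=> x _; exact: derivable_atan.
    + by apply: cvg_at_right_filter; exact: catan.
    + by apply: cvg_at_left_filter; exact: catan.
  - exact: continuous_subspaceT.
have UF : \bigcup_n F n = setT.
  rewrite -subTset => x _.
  exists (Num.truncn `|x|).+1 => //; rewrite /F/= in_itv/= -ler_norml ltW//.
  by rewrite truncnS_gt.
have UG : \bigcup_n G n = `](- (pi / 2)), (pi / 2)[%classic.
  apply/seteqP; split => [x [n _]|x]; rewrite /G/= !in_itv/=.
    move=> /andP[x1 x2]; rewrite (lt_le_trans _ x1) ?atan_gtNpi2//=.
    by rewrite (le_lt_trans x2)// atan_ltpi2.
  move=> xpi.
  exists (Num.truncn `|tan x|).+1 => //; rewrite /G/= in_itv/=.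
  have : `|tan x| <= (Num.truncn `|tan x|).+1%:R by rewrite ltW// truncnS_gt.
  rewrite ler_norml => /andP[t1 t2].
  set M := (_.+1%:R : R) in t1 t2 *.
  have -> : x = atan (tan x) by rewrite tanK// in_itv.
  by rewrite !le_atan.
rewrite -UG -UF.
have H1 : (\int[mu]_(x in F i) (k (atan x) * (1 + x ^+ 2)^-1)%:E @[i --> \oo] -->
   \int[mu]_(x in \bigcup_i F i) (k (atan x) * (1 + x ^+ 2)^-1)%:E)%E.
  apply: ge0_nondecreasing_set_cvg_integral => //.
  - move=> m n mn; apply/subsetPset; apply: subset_itv; rewrite bnd_simp ?lerN2 ler_nat//.
  - by move=> i; exact: measurable_itv.
  - by move=> i; apply/measurable_EFinP/measurable_funTS; exact: continuous_measurable_fun.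
  - by move=> i x _; rewrite lee_fin mulr_ge0// invr_ge0 addr_ge0// sqr_ge0.
have H2 : (\int[mu]_(x in G i) (k x)%:E @[i --> \oo] --> \int[mu]_(x in \bigcup_i G i) (k x)%:E)%E.
  apply: ge0_nondecreasing_set_cvg_integral => //.
  - move=> m n mn; apply/subsetPset; apply: subset_itv; rewrite bnd_simp le_atan ?lerN2 ?ler_nat//.
  - by move=> i; exact: measurable_itv.
  - by move=> i; apply/measurable_EFinP/measurable_funTS; exact: continuous_measurable_fun.
  - by move=> i x _; rewrite lee_fin.
by move/cvg_lim : H1 => <- //; move/cvg_lim : H2 => <- //; congr (limn _); apply/funext.
Qed.

Lemma sin_atan (x : R) : sin (atan x) = x * cos (atan x).
Proof.
have c0 : cos (atan x) != 0 by rewrite cos_atan invr_neq0// gt_eqF// sqrtr_gt0 ltr_pwDl ?sqr_ge0.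
by have := atanK x; rewrite /tan => {2}<-; rewrite divfK.
Qed.

Lemma sqr_cos_atan (x : R) : cos (atan x) ^+ 2 = (1 + x ^+ 2)^-1.
Proof. by rewrite cos_atan exprVn sqr_sqrtr// addr_ge0// sqr_ge0. Qed.

Lemma cos_atan_gt0 (x : R) : 0 < cos (atan x).
Proof. by rewrite cos_atan invr_gt0 sqrtr_gt0 ltr_pwDl ?sqr_ge0. Qed.

Local Open Scope ereal_scope.

(* The substitutions y = x t, x = r cos (atan t) and t = tan(angle), each one
   dimensional, combined with Tonelli. *)
Lemma ge0_integral_half_plane (h : measurableTypeR R * measurableTypeR R -> R) :
  measurable_fun setT h -> (forall u, 0 <= h u)%R ->
  (forall r, 0 < r -> continuous (fun t => h (r * cos t, r * sin t)))%R ->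
  \int[mu]_(x in `]0%R, +oo[) \int[mu]_y (h (x, y))%:E =
  \int[mu]_(r in `]0%R, +oo[) (r%:E * \int[mu]_(t in `](- (pi / 2))%R, (pi / 2)%R[)
     (h (r * cos t, r * sin t)%R)%:E).
Proof.
move=> mh h0 ch.
pose P : set R := `]0%R, +oo[%classic.
have mP : measurable P by exact: measurable_itv.
(* Integrand after y = x t, with Jacobian x. The indicator of x > 0 turns both integrals into
   integrals over the full line, ready for Tonelli. *)
pose J (u : measurableTypeR R * measurableTypeR R) : \bar R := ((\1_P u.1 * u.1) * h (u.1, u.1 * u.2))%:E.
have J0 u : 0 <= J u.
  rewrite lee_fin mulr_ge0// indicE; case: (boolP (u.1 \in P)) => uP; last by rewrite mul0r.
  by rewrite mul1r; move: uP; rewrite inE/P/= in_itv/= andbT => /ltW.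
have m1 : measurable_fun setT (fun u : measurableTypeR R * measurableTypeR R => \1_P u.1 * u.1)%R.
  by apply: measurable_funM => //; apply: measurableT_comp.
have mJ : measurable_fun setT J.
  apply/measurable_EFinP; apply: measurable_funM => //.
  apply: (measurableT_comp mh).
  by apply: measurable_fun_pair => //; apply: measurable_funM.
transitivity (\int[mu]_x \int[mu]_t J (x, t)).
  rewrite integral_mkcond; apply: eq_integral => x _; rewrite patchE.
  case: ifPn => xP; last first.
    by rewrite /J/= indicE (negbTE xP) !mul0r; under eq_integral do rewrite !mul0r; rewrite integral0.
  have x0 : (0 < x)%R by move: xP; rewrite inE/P/= in_itv/= andbT.
  rewrite (@ge0_integral_affine _ x 0)//; last 2 first.
  - by apply/measurable_EFinP; exact: (measurableT_comp mh).
  - by move=> y; rewrite lee_fin.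
  rewrite -ge0_integralZl//; last 3 first.
  - apply/measurable_EFinP; apply: (measurableT_comp mh); apply: measurable_fun_pair => //.
    by apply: measurable_funD => //; apply: measurable_funM.
  - by move=> y _; rewrite lee_fin.
  - by rewrite lee_fin ltW.
  by apply: eq_integral => t _; rewrite /J/= indicE xP mul1r addr0 EFinM.
rewrite fubini_tonelli//.
(* Integrand after x = r cos(atan t), for fixed t. The cosine is positive, so the cut-off x > 0
   becomes r > 0. *)
pose L (u : measurableTypeR R * measurableTypeR R) : \bar R :=
   (cos (atan u.1))%:E * J (cos (atan u.1) * u.2, u.1)%R.
have mca : measurable_fun setT (fun u : measurableTypeR R * measurableTypeR R => cos (atan u.1)).
  apply: (@measurableT_comp _ _ _ _ _ _ (fun x : R => cos (atan x)) _ fst) => //.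
  apply: continuous_measurable_fun => x; apply: continuous_comp; first exact: continuous_atan.
  exact: continuous_cos.
have mL : measurable_fun setT L.
  apply: emeasurable_funM; first exact/measurable_EFinP.
  apply: (measurableT_comp mJ); apply: measurable_fun_pair => //.
  by apply: measurable_funM.
have L0 u : 0 <= L u by rewrite mule_ge0// lee_fin ltW// cos_atan_gt0.
transitivity (\int[mu]_t \int[mu]_r L (t, r)).
  apply: eq_integral => t _.
  have mJt : measurable_fun setT (fun x => J (x, t)).
    by apply: (measurableT_comp mJ); apply: measurable_fun_pair.
  rewrite [LHS](@ge0_integral_affine _ (cos (atan t)) 0) ?cos_atan_gt0//.
  rewrite -[LHS]ge0_integralZl//; last 2 first.
  - by apply: (measurableT_comp mJt); apply: measurable_funD => //; apply: measurable_funM.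
  - by rewrite lee_fin ltW// cos_atan_gt0.
  by apply: eq_integral => r _; rewrite /L/= addr0.
rewrite fubini_tonelli// [RHS]integral_mkcond; apply: eq_integral => r _; rewrite patchE.
case: ifPn => rP; last first.
  rewrite integral0_eq// => t _; rewrite /L /J/= indicE.
  suff -> : ((cos (atan t) * r)%R \in P) = false by rewrite !mul0r mule0.
  apply/negP; rewrite inE/P/= in_itv/= andbT pmulr_rgt0 ?cos_atan_gt0// => r0.
  by move/negP : rP; apply; rewrite inE/P/= in_itv/= andbT r0.
have r0 : (0 < r)%R by move: rP; rewrite inE/P/= in_itv/= andbT.
have ckD : continuous (fun x => h (r * cos (atan x), r * sin (atan x)) * (1 + x ^+ 2)^-1)%R.
  move=> x; apply: cvgM; last exact: continuous_oneDsqrV.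
  by apply: (@continuous_comp _ _ _ (@atan R) (fun t => h (r * cos t, r * sin t)%R)); [exact: continuous_atan|exact: ch].
rewrite -ge0_integral_atan; last 2 first.
- exact: ch.
- by move=> x.
rewrite -ge0_integralZl//; last 3 first.
- by apply/measurable_EFinP; exact: continuous_measurable_fun.
- by move=> t _; rewrite lee_fin mulr_ge0// invr_ge0 addr_ge0// sqr_ge0.
- by rewrite lee_fin ltW.
(* The two Jacobians multiply to r cos(atan t)^2 = r / (1 + t^2), that is, r times the derivative of
   [atan]. *)
apply: eq_integral => t _; rewrite /L/J/= indicE.
have -> : ((cos (atan t) * r)%R \in P) = true.
  by apply/mem_set; rewrite /P/= in_itv/= andbT mulr_gt0// cos_atan_gt0.
rewrite -!EFinM -sqr_cos_atan sin_atan; congr EFin.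
rewrite (_ : (cos (atan t) * r * t = r * (t * cos (atan t)))%R); last by ring.
rewrite (mulrC (cos (atan t)) r) mul1r; ring.
Qed.

End HalfPlane.

(** * Integrals of periodic functions over one period *)

Section PeriodicIntegral.
Context {R : realType}.
Local Notation mu := (@lebesgue_measure R).
Local Open Scope ereal_scope.

Lemma ge0_integral_itv_split (k : R -> \bar R) (a b c : R) : (a <= b)%R -> (b <= c)%R ->
  measurable_fun setT k -> (forall x, 0 <= k x) ->
  \int[mu]_(x in `]a, c]) k x = \int[mu]_(x in `]a, b]) k x + \int[mu]_(x in `]b, c]) k x.
Proof.
move=> ab bc mk k0.
rewrite (@itv_bndbnd_setU _ _ _ (BRight b)) ?bnd_simp//.
rewrite ge0_integral_setU//; first exact: measurable_funTS.
apply/disj_setPS => y [/=]; rewrite 2!in_itv/= => /andP[_ yx] /andP[].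
by rewrite ltNge yx.
Qed.

Lemma ge0_integral_itv_shift (k : R -> \bar R) (a b c : R) :
  measurable_fun setT k -> (forall x, 0 <= k x) ->
  \int[mu]_(x in `](a + c)%R, (b + c)%R]) k x = \int[mu]_(x in `]a, b]) k (x + c)%R.
Proof.
move=> mk k0; rewrite integral_mkcond (@ge0_integral_affine _ 1 c)//; last 2 first.
- exact/(measurable_restrictT _ _).1/measurable_funTS.
- by move=> x; apply: erestrict_ge0.
rewrite mul1e [RHS]integral_mkcond; apply: eq_integral => x _.
rewrite !patchE mul1r.
by have -> : ((x + c)%R \in `](a + c)%R, (b + c)%R]%classic) = (x \in `]a, b]%classic);
  last by []; apply/idP/idP; rewrite !inE/= !in_itv/= ltrD2r lerD2r.
Qed.

(** For 0 <= a <= T the part beyond T is shifted back by one period; a negative a is first replaced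
    by a + T. The range of a covers the arguments given by [polar_form]. *)
Lemma ge0_integral_period (k : R -> \bar R) (T a : R) : (0 <= T)%R ->
  measurable_fun setT k -> (forall x, 0 <= k x) -> (forall x, k (x + T)%R = k x) ->
  (- T <= a <= T)%R ->
  \int[mu]_(x in `[a, (a + T)%R]) k x = \int[mu]_(x in `[0%R, T]) k x.
Proof.
move=> T0 mk k0 kT aT.
suff H b : (0 <= b <= T)%R -> \int[mu]_(x in `]b, (b + T)%R]) k x = \int[mu]_(x in `]0%R, T]) k x.
  rewrite -!integral_itv_obnd_cbnd; [|exact: measurable_funTS..].
  have [a0|a0] := leP 0%R a; first by apply: H; case/andP: aT => _ ->; rewrite a0.
  rewrite -(H (a + T)%R); last by apply/andP; split; lra.
  rewrite [RHS]ge0_integral_itv_shift//.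
  by apply: eq_integral => x _; rewrite kT.
move=> /andP[b0 bT].
rewrite (@ge0_integral_itv_split _ b T)//; last by rewrite lerDr.
rewrite -[X in `]X, (b + T)%R]](add0r T) ge0_integral_itv_shift//.
under [X in _ + X]eq_integral do rewrite kT.
by rewrite addeC -ge0_integral_itv_split.
Qed.

Lemma lebesgue_integralN (k : R -> \bar R) :
  measurable_fun setT k -> (forall x, 0 <= k x) ->
  \int[mu]_x k x = \int[mu]_x k (- x)%R.
Proof.
move=> mk k0.
have mN : measurable_fun setT (-%R : measurableTypeR R -> measurableTypeR R) by [].
transitivity (\int[pushforward mu (-%R : measurableTypeR R -> measurableTypeR R)]_x k x).
  apply: (@eq_measure_integral _ _ _ _ (measure_function_pushforward__canonical__measure_function_Measure mu mN)) => A mA _.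
  exact/esym/lebesgue_measureN.
by rewrite ge0_integral_pushforward// preimage_setT.
Qed.

(** The half-plane formula only sees angles in ]-pi/2, pi/2[; the opposite half-plane is reached by
    adding pi. *)
Lemma ge0_integral_two_halves (k : R -> R) : continuous k -> (forall x, 0 <= k x)%R ->
  (forall x, k (x + 2 * pi) = k x)%R ->
  \int[mu]_(x in `](- (pi / 2))%R, (pi / 2)%R[) (k x)%:E +
  \int[mu]_(x in `](- (pi / 2))%R, (pi / 2)%R[) (k (x + pi)%R)%:E =
  \int[mu]_(x in `[0%R, (2 * pi)%R]) (k x)%:E.
Proof.
move=> kc k0 kT.
have mk : measurable_fun setT (fun x => (k x)%:E).
  by apply/measurable_EFinP; exact: continuous_measurable_fun.
have mk' : measurable_fun setT (fun x : R => (k (x + pi)%R)%:E).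
  apply/measurable_EFinP; apply: continuous_measurable_fun => x.
  by apply: (@continuous_comp _ _ _ (fun x : R => x + pi)%R); [apply: cvgD; [exact: cvg_id|exact: cvg_cst]|exact: kc].
have k0' x : 0 <= (k x)%:E by rewrite lee_fin.
have pi0 := pi_gt0 R.
rewrite !integral_itv_bndo_bndc; [|exact: measurable_funTS..].
rewrite -(@ge0_integral_itv_shift (fun x => (k x)%:E))//.
rewrite -[RHS](@ge0_integral_period _ _ (- (pi / 2))%R)//; last 3 first.
- by rewrite mulr_ge0// ltW.
- by move=> x; rewrite kT.
- by apply/andP; split; lra.
rewrite -[RHS]integral_itv_obnd_cbnd; last exact: measurable_funTS.
have h1 : (- (pi / 2) <= pi / 2 :> R)%R by lra.
have h2 : (pi / 2 <= - (pi / 2) + 2 * pi :> R)%R by lra.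
rewrite (ge0_integral_itv_split h1 h2 mk k0').
have -> : (- (pi / 2) + pi = pi / 2 :> R)%R by lra.
by have -> : (pi / 2 + pi = - (pi / 2) + 2 * pi :> R)%R by lra.
Qed.

End PeriodicIntegral.

Section PolarCoordinates.
Context {R : realType}.
Local Notation mu := (@lebesgue_measure R).

Lemma normc_polar (r t : R) : ComplexField.Normc.normc (polar r t) = `|r|.
Proof.
rewrite normc_sqrt/= !exprMn -mulrDr cos2Dsin2 mulr1 sqrtr_sqr//.
Qed.

Lemma disc_coord_polar (r t : R) : disc_coord (r * cos t, r * sin t) <-> `|r| < 1.
Proof. by rewrite /disc_coord/unit_disc/= -(normc_polar r t). Qed.

Lemma disc_coordE (u : R * R) : disc_coord u <-> u.1 ^+ 2 + u.2 ^+ 2 < 1.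
Proof.
rewrite /disc_coord/unit_disc/preimage/= -[X in Num.sqrt _ < X](sqrtr1 R) ltr_sqrt//.
Qed.

Lemma open_disc_coord : open (@disc_coord R).
Proof.
rewrite (_ : disc_coord = [set u : R * R | u.1 ^+ 2 + u.2 ^+ 2 < 1]); last first.
  by apply/seteqP; split => u /disc_coordE.
apply: (@open_comp _ _ (fun u : R * R => u.1 ^+ 2 + u.2 ^+ 2) [set x | x < 1]); last exact: open_lt.
move=> u _; apply: cvgD.
  by apply: (@continuous_comp _ _ _ fst (fun x : R => x ^+ 2)); [exact: cvg_fst|exact: exprn_continuous].
by apply: (@continuous_comp _ _ _ snd (fun x : R => x ^+ 2)); [exact: cvg_snd|exact: exprn_continuous].
Qed.

Lemma measurable_disc_coord :
  measurable (@disc_coord R : set (measurableTypeR R * measurableTypeR R)).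
Proof. apply: open_measurable_prod; exact: open_disc_coord. Qed.

Lemma cosD2piM (x : R) : cos (x + 2 * pi) = cos x.
Proof. by rewrite mulr_natl cosD2pi. Qed.

Lemma sinD2piM (x : R) : sin (x + 2 * pi) = sin x.
Proof. by rewrite mulr_natl sinD2pi. Qed.

Lemma continuous_polar_coord (r : R) : continuous (fun t : R => (r * cos t, r * sin t)).
Proof.
move=> t; apply: (@cvg_pair _ _ _ _ (nbhs (r * cos t)) (nbhs (r * sin t)) _ _ _ (fun t => r * cos t) (fun t => r * sin t)).
  by apply: cvgMr; exact: continuous_cos.
by apply: cvgMr; exact: continuous_sin.
Qed.

End PolarCoordinates.

(** * The polar formula on the disc for nonnegative functions *)

Section PolarDisc.
Context {R : realType}.
Local Notation mu := (@lebesgue_measure R).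
Variable k : R * R -> R.
Hypothesis kc : forall u, disc_coord u -> {for u, continuous k}.

Lemma measurable_disc : measurable_fun (disc_coord : set (measurableTypeR R * measurableTypeR R)) k.
Proof. exact: open_continuous_measurable_prod open_disc_coord kc. Qed.

Let h : measurableTypeR R * measurableTypeR R -> R := k \_ disc_coord.

Let mh : measurable_fun setT h.
Proof. by apply/(measurable_restrictT _ measurable_disc_coord); exact: measurable_disc. Qed.

Let h_polar r t : h (r * cos t, r * sin t) = if `|r| < 1 then k (r * cos t, r * sin t) else 0.
Proof.
rewrite /h patchE; case: ifPn => H.
  by rewrite ifT//; apply/disc_coord_polar; exact: set_mem H.
by rewrite ifF//; apply/negbTE/negP => r1; move/negP: H; apply; apply/mem_set/disc_coord_polar.
Qed.

Lemma continuous_polar_disc (r : R) : `|r| < 1 -> continuous (fun t => k (r * cos t, r * sin t)).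
Proof.
move=> r1 t; apply: (@continuous_comp _ _ _ (fun t => (r * cos t, r * sin t)) k).
  exact: continuous_polar_coord.
exact/kc/disc_coord_polar.
Qed.

(** The cut-off [h] may jump across the unit circle, but on each circle about 0 the cut-off is
    constant. Hence the half-plane formula asks for continuity along circles only. *)
Let ch (r : R) : continuous (fun t => h (r * cos t, r * sin t)).
Proof.
have -> : (fun t => h (r * cos t, r * sin t)) = (fun t => if `|r| < 1 then k (r * cos t, r * sin t) else 0).
  by apply/funext => t; rewrite h_polar.
case: (boolP (`|r| < 1)) => r1; last by move=> t; exact: cvg_cst.
exact: continuous_polar_disc.
Qed.

Hypothesis k0 : forall u, disc_coord u -> 0 <= k u.

Let h0 u : 0 <= h u.
Proof. by rewrite /h patchE; case: ifPn => // /set_mem; exact: k0. Qed.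

Local Open Scope ereal_scope.

(** The plane is split at x = 0 and the left part reflected through the origin; the half-plane
    formula applies to [h] and to its reflection, and the two angular ranges recombine into a full
    period. *)
Lemma ge0_integral_polar_disc :
  \int[sigma]_(u in disc_coord) (k u)%:E =
  (pi^-1)%:E * \int[mu]_(r in `]0%R, 1%R[) (r%:E * \int[mu]_(t in `[0%R, (2 * pi)%R])
     (k (r * cos t, r * sin t)%R)%:E).
Proof.
rewrite /sigma ge0_integral_mscale//; last 2 first.
- exact: measurable_disc_coord.
- by apply/measurable_EFinP; exact: measurable_disc.
rewrite /=; congr (_ * _).
have mhE : measurable_fun setT (fun u => (h u)%:E) by apply/measurable_EFinP.
have h0E u : 0 <= (h u)%:E by rewrite lee_fin.
transitivity (\int[(mu \x mu)]_u (h u)%:E).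
  rewrite integral_mkcond; apply: eq_integral => u _.
  by rewrite /h !patchE; case: ifP.
rewrite fubini_tonelli1//; set H := fubini_F _ _.
have mH : measurable_fun setT H by exact: measurable_fun_fubini_tonelli_F.
have H0 x : 0 <= H x by apply: integral_ge0.
have mHN : measurable_fun setT (fun x : R => H (- x)%R) by exact: measurableT_comp.
have -> : \int[mu]_x H x = \int[mu]_(x in `]0%R, +oo[) H x + \int[mu]_(x in `]0%R, +oo[) H (- x)%R.
  have mI : measurable (`]-oo, 0%R]%classic : set R) by exact: measurable_itv.
  have := @ge0_integral_setU _ _ _ mu _ _ mI (measurableC mI) H; rewrite setUv => ->//; last first.
    by apply/disj_setPS => x [].
  rewrite addeC setCitvl; congr (_ + _).
  rewrite integral_itv_obnd_cbnd; last exact: measurable_funTS.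
  rewrite (@ge0_integration_by_substitution0 _ (fun x => H (- x)%R))//.
  by apply: eq_integral => x _; rewrite opprK.
rewrite (ge0_integral_half_plane mh)//.
have -> : \int[mu]_(x in `]0%R, +oo[) H (- x)%R =
  \int[mu]_(x in `]0%R, +oo[) \int[mu]_y (h (- x, - y)%R)%:E.
  apply: eq_integral => x _; rewrite /H/fubini_F [LHS]lebesgue_integralN//.
  by apply/measurable_EFinP; exact: (measurableT_comp mh (pair1_measurable (- x)%R)).
rewrite (@ge0_integral_half_plane _ (fun u => h (- u.1, - u.2)%R))//; last 2 first.
- by apply: (measurableT_comp mh); apply: measurable_fun_pair; exact: measurableT_comp.
- move=> r _ t /=; rewrite (_ : (fun t => _) = (fun t => h ((- r) * cos t, (- r) * sin t)%R)).
    exact: ch.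
  by apply/funext => s; rewrite !mulNr.
have mpol : measurable_fun setT (fun u : measurableTypeR R * measurableTypeR R =>
    (u.1 * cos u.2, u.1 * sin u.2)%R : measurableTypeR R * measurableTypeR R).
  apply: measurable_fun_pair; apply: measurable_funM => //.
  - by apply: measurableT_comp => //; apply: continuous_measurable_fun; exact: continuous_cos.
  - by apply: measurableT_comp => //; apply: continuous_measurable_fun; exact: continuous_sin.
have mint (l : measurableTypeR R * measurableTypeR R -> R) (A : set R) : measurable_fun setT l ->
    (forall u, 0 <= l u)%R -> measurable A ->
    measurable_fun setT (fun r : R => \int[mu]_(t in A) (l (r * cos t, r * sin t)%R)%:E).
  move=> ml l0 mA.
  rewrite (_ : (fun _ => _) = fubini_F mu
    (fun u : measurableTypeR R * measurableTypeR R =>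
      (l (u.1 * cos u.2, u.1 * sin u.2) * \1_A u.2)%:E)).
    apply: measurable_fun_fubini_tonelli_F.
    - apply/measurable_EFinP; apply: measurable_funM; first exact: (measurableT_comp ml mpol).
      by apply: measurableT_comp => //; exact: measurable_indic.
    - by move=> u; rewrite lee_fin mulr_ge0.
  apply/funext => r; rewrite integral_mkcond; apply: eq_integral => t _.
  by rewrite patchE /= indicE; case: ifP => _; rewrite ?mulr1 ?mulr0.
pose l u : R := h (- u.1, - u.2)%R.
have ml : measurable_fun setT (l : measurableTypeR R * measurableTypeR R -> R).
  by apply: (measurableT_comp mh); apply: measurable_fun_pair; exact: measurableT_comp.
have mJ : measurable (`](- (pi / 2))%R, (pi / 2)%R[%classic : set R) by exact: measurable_itv.
have mrint (l' : measurableTypeR R * measurableTypeR R -> R) (A : set R) : measurable_fun setT l' ->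
    (forall u, 0 <= l' u)%R -> measurable A ->
    measurable_fun (`]0%R, +oo[%classic : set R) (fun r : R => r%:E * \int[mu]_(t in A) (l' (r * cos t, r * sin t)%R)%:E).
  move=> ml' l'0 mA; apply: measurable_funTS; apply: emeasurable_funM; first exact/measurable_EFinP.
  exact: mint.
have rint0 (l' : measurableTypeR R * measurableTypeR R -> R) (A : set R) (r : R) :
    (forall u, 0 <= l' u)%R -> (`]0%R, +oo[%classic : set R) r ->
    0 <= r%:E * \int[mu]_(t in A) (l' (r * cos t, r * sin t)%R)%:E.
  move=> l'0; rewrite /= in_itv/= andbT => /ltW r0.
  by rewrite mule_ge0// integral_ge0// => t _; rewrite lee_fin.
rewrite -ge0_integralD//; last 4 first.
- by move=> r; exact: rint0.
- exact: mrint.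
- by move=> r r0; apply: (rint0 l) => // u; exact: h0.
- by apply: (mrint l) => // u; exact: h0.
have E (r : R) : (`]0%R, +oo[%classic : set R) r ->
   r%:E * (\int[mu]_(t in `](- (pi / 2))%R, (pi / 2)%R[) (h (r * cos t, r * sin t)%R)%:E) +
   r%:E * (\int[mu]_(t in `](- (pi / 2))%R, (pi / 2)%R[) (h (- (r * cos t), - (r * sin t))%R)%:E) =
   r%:E * \int[mu]_(t in `[0%R, (2 * pi)%R]) (h (r * cos t, r * sin t)%R)%:E.
  rewrite /= in_itv/= andbT => r0.
  rewrite -ge0_muleDr; [|by apply: integral_ge0..].
  rewrite -ge0_integral_two_halves//; last first.
    by move=> x; rewrite cosD2piM sinD2piM.
  congr (_ * (_ + _)); apply: eq_integral => t _.
  by rewrite cosDpi sinDpi !mulrN.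
under eq_integral => r /set_mem r0 do rewrite E//.
rewrite [LHS]integral_mkcond [RHS]integral_mkcond.
apply: eq_integral => r _; rewrite !patchE.
(* For r >= 1 the circle lies outside the disc and the inner integral vanishes, which shortens the
   range of r from the half-line to ]0, 1[. *)
have [r1|r1] := boolP (r \in (`]0%R, 1%R[%classic : set R)); last first.
  case: ifPn => // r0.
  rewrite integral0_eq ?mule0// => t _; rewrite h_polar ifF//.
  move: r1 r0; rewrite notin_setE inE/= !in_itv/= andbT => /negP.
  by rewrite negb_and => /orP[/negP//|r1] r0; rewrite gtr0_norm//; apply/negbTE.
have [r0 r1'] : (0 < r)%R /\ (r < 1)%R by move: r1; rewrite inE/= in_itv/= => /andP.
rewrite ifT; last by rewrite inE/= in_itv/= r0.
congr (_ * _); apply: eq_integral => t _; rewrite h_polar ifT// gtr0_norm//.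
Qed.

End PolarDisc.

(** * Mean values over circles *)

Section ParametricIntegral.
Context {R : realType}.
Local Notation mu := (@lebesgue_measure R).

Lemma continuous_itv_integrable (f : R -> R) (a b : R) : continuous f ->
  mu.-integrable `[a, b] (EFin \o f).
Proof.
move=> fc; apply: continuous_compact_integrable; first exact: segment_compact.
exact: continuous_subspaceT.
Qed.

Lemma EFin_Rintegral_itv (f : R -> R) (a b : R) : continuous f ->
  (\int[mu]_(t in `[a, b]) (f t)%:E = (\int[mu]_(t in `[a, b]) f t)%R%:E)%E.
Proof.
move=> fc; rewrite /Rintegral fineK//; apply: integrable_fin_num => //.
exact: continuous_itv_integrable.
Qed.

(** Supplies the constant that dominates the integrand in continuity and differentiation under the
    integral sign. *)
Lemma rect_bounded (F : R * R -> R) (a b c d : R) : a <= b -> c <= d ->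
  (forall u, a <= u.1 <= b -> c <= u.2 <= d -> {for u, continuous F}) ->
  exists M, forall s t, a <= s <= b -> c <= t <= d -> `|F (s, t)| <= M.
Proof.
move=> ab cd Fc.
pose A : set (R * R) := `[a, b]%classic `*` `[c, d]%classic.
have cA : compact A by apply: compact_setX; exact: segment_compact.
have A0 : A !=set0 by exists (a, c); split; rewrite /= in_itv/= lexx.
have cF : {within A, continuous (fun u => `|F u|)}.
  apply: continuous_in_subspaceT => u; rewrite inE => -[/=]; rewrite !in_itv/= => u1 u2.
  apply: (@continuous_comp _ _ _ F (fun x : R => `|x|)); first exact: Fc.
  exact: norm_continuous.
have [u _ H] := compact_EVT_max A0 cA cF.
exists `|F u| => s t sab tcd; apply: H.
by rewrite inE; split; rewrite /= in_itv.
Qed.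

Variables (F : R -> R -> R) (u v a b : R).
Hypothesis ab : a <= b.
Hypothesis Fc : forall s t, u < s < v -> {for (s, t), continuous (fun w : R * R => F w.1 w.2)}.

Lemma continuous_param_section s : u < s < v -> continuous (F s).
Proof.
move=> suv t; apply: (@continuous_comp _ _ _ (fun t => (s, t)) (fun w : R * R => F w.1 w.2)).
  apply: (@cvg_pair _ _ _ _ (nbhs s) (nbhs t) _ _ _ (fun=> s) id).
    exact: cvg_cst.
  exact: cvg_id.
exact: Fc.
Qed.

Lemma continuous_param_section1 s t : u < s < v -> {for s, continuous (F ^~ t)}.
Proof.
move=> suv; apply: (@continuous_comp _ _ _ (fun s => (s, t)) (fun w : R * R => F w.1 w.2)).
  apply: (@cvg_pair _ _ _ _ (nbhs s) (nbhs t) _ _ _ id (fun=> t)).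
    exact: cvg_id.
  exact: cvg_cst.
exact: Fc.
Qed.

Let subitv s : u < s < v -> exists u' v', [/\ u < u', u' < s, s < v' & v' < v].
Proof. by move=> /andP[us sv]; exists ((u + s) / 2), ((s + v) / 2); split; lra. Qed.

Lemma continuous_Rintegral_param s : u < s < v ->
  {for s, continuous (fun s => \int[mu]_(t in `[a, b]) F s t)}.
Proof.
move=> suv; have [u' [v' [uu us sv vv]]] := subitv suv.
have sub x : u' <= x <= v' -> u < x < v by move=> /andP[? ?]; apply/andP; split; lra.
have uv' : u' <= v' by lra.
have [M HM] : exists M, forall s t, u' <= s <= v' -> a <= t <= b -> `|F s t| <= M.
  apply: (@rect_bounded (fun w => F w.1 w.2)) => // w w1 w2.
  by case: w w1 w2 => x y /= w1 w2; apply/Fc/sub.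
have su : s \in `]u', v'[%classic by rewrite inE/= in_itv/= us.
apply: (@continuity_under_integral R _ _ mu F _ _ u' v' _ _ (fun=> M) _ _ s su).
- exact: measurable_itv.
- move=> x; rewrite /= in_itv/= => /andP[ux xv]; apply: continuous_itv_integrable.
  by apply/continuous_param_section/sub; rewrite !ltW.
- apply: aeW => y _ x; rewrite inE/= in_itv/= => /andP[ux xv].
  by apply/continuous_param_section1/sub; rewrite !ltW.
- by apply: continuous_itv_integrable => x; exact: cvg_cst.
- move=> x; rewrite /= in_itv/= => /andP[ux xv]; apply: aeW => y; rewrite /= in_itv/= => yab.
  by apply: HM => //; rewrite !ltW.
Qed.

Variable (dF : R -> R -> R).
Hypothesis dFc : forall s t, u < s < v -> {for (s, t), continuous (fun w : R * R => dF w.1 w.2)}.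
Hypothesis FD : forall s t, u < s < v -> is_derive s (1 : R) (F ^~ t) (dF s t).

Lemma is_derive_Rintegral_param s : u < s < v ->
  is_derive s (1 : R) (fun s => \int[mu]_(t in `[a, b]) F s t) (\int[mu]_(t in `[a, b]) dF s t).
Proof.
move=> suv; have [u' [v' [uu us sv vv]]] := subitv suv.
have sub x : u' <= x <= v' -> u < x < v by move=> /andP[? ?]; apply/andP; split; lra.
have uv' : u' <= v' by lra.
have [M HM] : exists M, forall s t, u' <= s <= v' -> a <= t <= b -> `|dF s t| <= M.
  apply: (@rect_bounded (fun w => dF w.1 w.2)) => // w w1 w2.
  by case: w w1 w2 => x y /= w1 w2; apply/dFc/sub.
have su : `]u', v'[%classic s by rewrite /= in_itv/= us.
have M0 : 0 <= M by apply: le_trans (HM u' a _ _); rewrite ?lexx.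
have dE x y : u' < x < v' -> (F^~ y)^`()%classic x = dF x y.
  move=> /andP[ux xv]; have xuv : u < x < v by apply: sub; rewrite !ltW.
  by rewrite derive1E; have [_ ->] := FD y xuv.
have H1 x : `]u', v'[%classic x -> mu.-integrable `[a, b] (EFin \o F x).
  rewrite /= in_itv/= => /andP[ux xv]; apply: continuous_itv_integrable.
  by apply/continuous_param_section/sub; rewrite !ltW.
have H2 x y : `]u', v'[%classic x -> `[a, b]%classic y -> derivable (F ^~ y) x 1.
  rewrite /= in_itv/= => /andP[ux xv] _.
  by have [] := @FD x y (sub _ _); rewrite ?ltW.
have H3 : mu.-integrable `[a, b] (EFin \o (fun=> M)).
  by apply: continuous_itv_integrable => x; exact: cvg_cst.
have H4 x y : `]u', v'[%classic x -> `[a, b]%classic y -> `|(F^~ y)^`()%classic x| <= M.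
  rewrite /= !in_itv/= => xuv yab; rewrite dE//; apply: HM => //.
  by case/andP: xuv => ? ?; rewrite !ltW.
have mab : measurable (`[a, b]%classic : set (measurableTypeR R)) by exact: measurable_itv.
apply: DeriveDef.
  exact: (derivable_under_integral mab su H1 H2 (fun=> M0) H3 H4).
rewrite -derive1E (differentiation_under_integral mab su H1 H2 (fun=> M0) H3 H4).
by apply: eq_Rintegral => t _; rewrite /partial1of2 dE// us.
Qed.

Hypothesis dF0 : forall s, u < s < v -> exists V : R -> R,
  (forall t, is_derive t (1 : R) V (dF s t)) /\ V a = V b.

(** By [dF0] the s-derivative of the integral is the integral of an exact t-derivative with equal
    end values, hence 0; the mean value theorem concludes. This is the substitute for Cauchy's
    theorem. *)
Lemma Rintegral_param_cst s1 s2 : u < s1 < v -> u < s2 < v ->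
  \int[mu]_(t in `[a, b]) F s1 t = \int[mu]_(t in `[a, b]) F s2 t.
Proof.
have D0 s : u < s < v -> is_derive s (1 : R) (fun s => \int[mu]_(t in `[a, b]) F s t) 0.
  move=> suv; have := is_derive_Rintegral_param suv.
  rewrite (_ : \int[mu]_(t in `[a, b]) dF s t = 0)//.
  move: ab; rewrite le_eqVlt => /predU1P[<-|ab'].
    by rewrite set_itv1 Rintegral_set1.
  have [V [dV Vab]] := dF0 suv.
  have Vc : continuous V.
    by move=> x; apply/differentiable_continuous/derivable1_diffP; exact: ex_derive.
  have dFsc : continuous (dF s).
    move=> t; apply: (@continuous_comp _ _ _ (fun t => (s, t)) (fun w : R * R => dF w.1 w.2)).
      apply: (@cvg_pair _ _ _ _ (nbhs s) (nbhs t) _ _ _ (fun=> s) id).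
        exact: cvg_cst.
      exact: cvg_id.
    exact: dFc.
  rewrite /Rintegral (@continuous_FTC2 _ (dF s) V)//.
  - by rewrite Vab -EFinB subrr.
  - exact: continuous_subspaceT.
  - split=> [x _||].
    + exact: ex_derive.
    + by apply: cvg_at_right_filter; exact: Vc.
    + by apply: cvg_at_left_filter; exact: Vc.
  - by move=> x _; rewrite derive1E derive_val.
wlog s12 : s1 s2 / s1 < s2 => [H|] su1 su2.
  have [/H|/H|->//] := ltgtP s1 s2; first exact.
  by move=> H'; apply/esym; exact: H'.
have sub x : s1 <= x <= s2 -> u < x < v.
  by case/andP: su1 su2 => ? ? /andP[? ?] /andP[? ?]; apply/andP; split; lra.
have D1 x : x \in `]s1, s2[ -> is_derive x (1 : R) (fun s => \int[mu]_(t in `[a, b]) F s t) 0.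
  by rewrite in_itv/= => /andP[? ?]; apply/D0/sub; rewrite !ltW.
have C1 : {within `[s1, s2], continuous (fun s => \int[mu]_(t in `[a, b]) F s t)}.
  apply: continuous_in_subspaceT => x; rewrite inE/= in_itv/= => xs.
  by apply/continuous_Rintegral_param/sub.
have [c _] := MVT s12 D1 C1; rewrite mul0r => /eqP; rewrite subr_eq0 => /eqP ->//.
Qed.

End ParametricIntegral.

(** * Circle integrals and the signed polar formula *)

Section CircleIntegral.
Context {R : realType}.
Local Notation mu := (@lebesgue_measure R).
Implicit Types k : R * R -> R.

Definition circ k (r : R) := \int[mu]_(t in `[0, 2 * pi]) k (r * cos t, r * sin t).

Definition cont_disc k := forall u, disc_coord u -> {for u, continuous k}.

Lemma pi2_ge0 : 0 <= 2 * pi :> R.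
Proof. by rewrite mulr_ge0// pi_ge0. Qed.

Lemma continuous_polar2 (u : R * R) : {for u, continuous (fun w : R * R => (w.1 * cos w.2, w.1 * sin w.2))}.
Proof.
have c1 : {for u, continuous (fun w : R * R => cos w.2)}.
  by apply: (@continuous_comp _ _ _ snd (@cos R)); [exact: cvg_snd|exact: continuous_cos].
have c2 : {for u, continuous (fun w : R * R => sin w.2)}.
  by apply: (@continuous_comp _ _ _ snd (@sin R)); [exact: cvg_snd|exact: continuous_sin].
have c0 : {for u, continuous (fun w : R * R => w.1)} by exact: cvg_fst.
apply: (@cvg_pair _ _ _ _ (nbhs (u.1 * cos u.2)) (nbhs (u.1 * sin u.2)) _ _ _
  (fun w : R * R => w.1 * cos w.2) (fun w : R * R => w.1 * sin w.2)).
  exact: (@cvgM _ _ _ _ _ _ _ _ c0 c1).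
exact: (@cvgM _ _ _ _ _ _ _ _ c0 c2).
Qed.

Lemma cont_disc_polar k s t : cont_disc k -> -1 < s < 1 ->
  {for (s, t), continuous (fun w : R * R => k (w.1 * cos w.2, w.1 * sin w.2))}.
Proof.
move=> kc s1; apply: (@continuous_comp _ _ _ (fun w : R * R => (w.1 * cos w.2, w.1 * sin w.2)) k).
  exact: continuous_polar2.
by apply/kc/disc_coord_polar; rewrite ltr_norml.
Qed.

Lemma continuous_circ k s : cont_disc k -> -1 < s < 1 -> {for s, continuous (circ k)}.
Proof.
move=> kc s1; apply: (@continuous_Rintegral_param R (fun s t => k (s * cos t, s * sin t)) (-1) 1) => //.
  exact: pi2_ge0.
by move=> x t x1; exact: cont_disc_polar.
Qed.

Lemma integrable_circ k (r : R) : cont_disc k -> `|r| < 1 ->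
  mu.-integrable `[0, 2 * pi] (EFin \o (fun t => k (r * cos t, r * sin t))).
Proof. by move=> kc r1; apply/continuous_itv_integrable/continuous_polar_disc. Qed.

Lemma EFin_circ k (r : R) : cont_disc k -> `|r| < 1 ->
  (\int[mu]_(t in `[0%R, (2 * pi)%R]) (k (r * cos t, r * sin t)%R)%:E = (circ k r)%:E)%E.
Proof. by move=> kc r1; rewrite EFin_Rintegral_itv//; exact: continuous_polar_disc. Qed.

Lemma circ_ge0 k (r : R) : (forall u, disc_coord u -> 0 <= k u) -> `|r| < 1 -> 0 <= circ k r.
Proof. by move=> k0 r1; apply: Rintegral_ge0 => t _; apply/k0/disc_coord_polar. Qed.

Lemma ler_circ k1 k2 (r : R) : cont_disc k1 -> cont_disc k2 -> `|r| < 1 ->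
  (forall u, disc_coord u -> k1 u <= k2 u) -> circ k1 r <= circ k2 r.
Proof.
move=> c1 c2 r1 k12; apply: le_Rintegral; first exact: measurable_itv.
- exact: integrable_circ.
- exact: integrable_circ.
- by move=> t _; apply/k12/disc_coord_polar.
Qed.

Lemma circB k1 k2 (r : R) : cont_disc k1 -> cont_disc k2 -> `|r| < 1 ->
  circ (fun u => k1 u - k2 u) r = circ k1 r - circ k2 r.
Proof.
by move=> c1 c2 r1; rewrite /circ RintegralB//; exact: integrable_circ.
Qed.

Lemma circZ k (c : R) (r : R) : cont_disc k -> `|r| < 1 ->
  circ (fun u => c * k u) r = c * circ k r.
Proof.
by move=> c1 r1; rewrite /circ RintegralZl//; exact: integrable_circ.
Qed.

Lemma measurable_r_circ k : cont_disc k ->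
  measurable_fun (`]0, 1[%classic : set R) (fun r : R => r * circ k r).
Proof.
move=> kc; apply: open_continuous_measurable_fun; first exact: interval_open.
move=> r; rewrite inE/= in_itv/= => /andP[r0 r1].
apply: cvgM; first exact: cvg_id.
by apply: continuous_circ => //; rewrite r1 andbT (lt_trans _ r0)// ltrN10.
Qed.

Lemma ge0_integral_polar_circ k : cont_disc k -> (forall u, disc_coord u -> 0 <= k u) ->
  (\int[sigma]_(u in disc_coord) (k u)%:E =
  (pi^-1)%:E * \int[mu]_(r in `]0%R, 1%R[) (r * circ k r)%:E)%E.
Proof.
move=> kc k0; rewrite ge0_integral_polar_disc//; congr (_ * _)%E.
apply: eq_integral => r; rewrite inE/= in_itv/= => /andP[r0 r1].
by rewrite EFin_circ// ?gtr0_norm// EFinM.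
Qed.

Let cont_max k1 k2 : cont_disc k1 -> cont_disc k2 -> cont_disc (fun u => Num.max (k1 u) (k2 u)).
Proof. by move=> c1 c2 u Du; apply: continuous_max; [exact: c1|exact: c2]. Qed.

Lemma cont_discN k : cont_disc k -> cont_disc (fun u => - k u).
Proof. by move=> c u Du; apply: cvgN; exact: c. Qed.

Lemma cont_disc_norm k : cont_disc k -> cont_disc (fun u => `|k u|).
Proof.
by move=> c u Du; apply: (@continuous_comp _ _ _ k (fun x : R => `|x|)); [exact: c|exact: norm_continuous].
Qed.

Lemma integrable_r_circ k : cont_disc k ->
  (\int[mu]_(r in `]0%R, 1%R[) (r * circ (fun u => `|k u|) r)%:E < +oo)%E ->
  mu.-integrable `]0, 1[ (EFin \o (fun r => r * circ k r)).
Proof.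
move=> kc kfin.
have mI : measurable (`]0, 1[%classic : set (measurableTypeR R)) by exact: measurable_itv.
apply/integrableP; split; first by apply/measurable_EFinP; exact: measurable_r_circ.
apply: le_lt_trans kfin; apply: ge0_le_integral => //.
- apply/measurable_EFinP; apply: (@measurableT_comp _ _ _ _ _ _ (fun x : R => `|x|)) => //.
  exact: measurable_r_circ.
- by apply/measurable_EFinP; apply: measurable_r_circ; exact: cont_disc_norm.
- move=> r; rewrite /= in_itv/= => /andP[r0 r1].
  rewrite lee_fin normrM gtr0_norm//; apply: ler_wpM2l; first exact: ltW.
  have H : mu.-integrable `[0, 2 * pi] (EFin \o (fun t => k (r * cos t, r * sin t))).
    by apply: integrable_circ => //; rewrite gtr0_norm.
  have mI2 : measurable (`[0, 2 * pi]%classic : set (measurableTypeR R)) by exact: measurable_itv.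
  exact: (le_normr_Rintegral mI2 H).
Qed.

(** Positive and negative parts reduce it to the nonnegative formula. Both are dominated by |k|, so
    both radial integrals are finite and their difference is meaningful. *)
Lemma Rintegral_polar k : cont_disc k ->
  (\int[mu]_(r in `]0%R, 1%R[) (r * circ (fun u => `|k u|) r)%:E < +oo)%E ->
  \int[sigma]_(u in disc_coord) k u = pi^-1 * \int[mu]_(r in `]0, 1[) (r * circ k r).
Proof.
move=> kc kfin.
pose kp u := Num.max (k u) 0; pose kn u := Num.max (- k u) 0.
have c0 : cont_disc (fun=> 0 : R) by move=> u _; exact: cvg_cst.
have cp : cont_disc kp by exact: cont_max.
have cn : cont_disc kn by apply: cont_max => //; exact: cont_discN.
have p0 u : 0 <= kp u by rewrite le_max lexx orbT.
have n0 u : 0 <= kn u by rewrite le_max lexx orbT.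
have kE u : k u = kp u - kn u.
  rewrite /kp /kn; case/orP: (le_total 0 (k u)) => ku.
    by rewrite (max_l ku) max_r ?subr0// oppr_le0.
  by rewrite (max_r ku) max_l ?opprK ?add0r// oppr_ge0.
have nE u : `|k u| = kp u + kn u.
  rewrite /kp /kn; case/orP: (le_total 0 (k u)) => ku.
    by rewrite (max_l ku) max_r ?addr0 ?ger0_norm// oppr_le0.
  by rewrite (max_r ku) max_l ?add0r ?ler0_norm// oppr_ge0.
have fin k' : cont_disc k' -> (forall u, 0 <= k' u) -> (forall u, k' u <= `|k u|) ->
   (\int[mu]_(r in `]0%R, 1%R[) (r * circ (fun u => `|k' u|) r)%:E < +oo)%E.
  move=> c' k'0 k'k; apply: le_lt_trans kfin; apply: ge0_le_integral => //.
  - move=> r; rewrite /= in_itv/= => /andP[r0 r1].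
    rewrite lee_fin; apply: mulr_ge0; first exact: ltW.
    by apply: circ_ge0; rewrite ?gtr0_norm.
  - by apply/measurable_EFinP; apply: measurable_r_circ; exact: cont_disc_norm.
  - by apply/measurable_EFinP; apply: measurable_r_circ; exact: cont_disc_norm.
  - move=> r; rewrite /= in_itv/= => /andP[r0 r1].
    rewrite lee_fin; apply: ler_wpM2l; [exact: ltW|apply: ler_circ]; [exact: cont_disc_norm|exact: cont_disc_norm|by rewrite gtr0_norm|].
    by move=> u _; rewrite (ger0_norm (k'0 u)).
have ip := integrable_r_circ cp (fin _ cp p0 (fun u => _)).
have {}ip : mu.-integrable `]0, 1[ (EFin \o (fun r => r * circ kp r)).
  by apply: ip => u; rewrite nE lerDl.
have in_ : mu.-integrable `]0, 1[ (EFin \o (fun r => r * circ kn r)).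
  by apply: integrable_r_circ => //; apply: fin => // u; rewrite nE lerDr.
have -> : \int[sigma]_(u in disc_coord) k u =
   fine (\int[sigma]_(u in disc_coord) (kp u)%:E - \int[sigma]_(u in disc_coord) (kn u)%:E)%E.
  rewrite /Rintegral integralE; congr (fine (_ - _)); apply: eq_integral => u _.
  - by rewrite funeposE/= -EFin_max.
  - by rewrite funenegE/= -EFin_max.
rewrite !ge0_integral_polar_circ//.
have mI : measurable (`]0, 1[%classic : set (measurableTypeR R)) by exact: measurable_itv.
have FA := integrable_fin_num mI ip; have FB := integrable_fin_num mI in_.
rewrite -muleBr//; last by rewrite fin_num_adde_defl// fin_numN.
rewrite fineM//; last by rewrite fin_numB FA FB.
rewrite -integralB_EFin//.
rewrite /=; congr (_ * _); rewrite /Rintegral; congr fine; apply: eq_integral => r.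
rewrite inE/= in_itv/= => /andP[r0 r1]; rewrite /= -EFinB -mulrBr -circB//; last by rewrite gtr0_norm.
congr (EFin (_ * _)); apply: eq_Rintegral => t _; by rewrite kE.
Qed.

End CircleIntegral.

(** * Derivatives along circles and the mean value property *)

Section HoloCircles.
Context {R : realType}.
Local Notation mu := (@lebesgue_measure R).
Local Notation N := (@ComplexField.Normc.normc R).
Implicit Types (f g D : R[i] -> R[i]) (c : R[i]).

(** The two coordinates are spelled out so that the chain rule and the continuity lemmas for x + iy
    apply without rewriting. *)
Definition on_circle c (s t : R) : R[i] :=
  (complex.Re c + s * cos t) +i* (complex.Im c + s * sin t).

Lemma on_circleE c s t : on_circle c s t = c + polar s t.
Proof. by case: c. Qed.

Lemma on_circle_disc c s t : N c + `|s| < 1 -> unit_disc (on_circle c s t).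
Proof.
move=> cs; change (N (on_circle c s t) < 1); rewrite on_circleE; apply: le_lt_trans cs.
by apply: (le_trans (normc_addr _ _)); rewrite normc_polar.
Qed.

Let dcos_s (a s t : R) : is_derive s (1 : R) (fun s => a + s * cos t) (cos t).
Proof. by apply: is_derive_eq; rewrite /GRing.scale/=; ring. Qed.

Let dsin_s (a s t : R) : is_derive s (1 : R) (fun s => a + s * sin t) (sin t).
Proof. by apply: is_derive_eq; rewrite /GRing.scale/=; ring. Qed.

Let dcos_t (a s t : R) : is_derive t (1 : R) (fun t => a + s * cos t) (- (s * sin t)).
Proof. by apply: is_derive_eq; rewrite /GRing.scale/=; ring. Qed.

Let dsin_t (a s t : R) : is_derive t (1 : R) (fun t => a + s * sin t) (s * cos t).
Proof. by apply: is_derive_eq; rewrite /GRing.scale/=; ring. Qed.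

Section CircleDerivatives.
Variables (f D : R[i] -> R[i]) (c : R[i]) (s t : R).
Hypotheses (fD : holo f D) (w1 : unit_disc (on_circle c s t)).
Let d1 := complex.Re (D (on_circle c s t)).
Let d2 := complex.Im (D (on_circle c s t)).

Lemma is_derive_Re_radial : is_derive s (1 : R) (fun s => complex.Re (f (on_circle c s t)))
  (d1 * cos t - d2 * sin t).
Proof. exact: (holo_derive_Re (dcos_s _ _ _) (dsin_s _ _ _) fD w1). Qed.

Lemma is_derive_Im_radial : is_derive s (1 : R) (fun s => complex.Im (f (on_circle c s t)))
  (d1 * sin t + d2 * cos t).
Proof. exact: (holo_derive_Im (dcos_s _ _ _) (dsin_s _ _ _) fD w1). Qed.

Lemma is_derive_Re_angular : is_derive t (1 : R) (fun t => complex.Re (f (on_circle c s t)))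
  (- (s * (d1 * sin t + d2 * cos t))).
Proof.
apply: is_derive_eq (holo_derive_Re (dcos_t _ _ _) (dsin_t _ _ _) fD w1) _.
rewrite -/(on_circle c s t) -/d1 -/d2; ring.
Qed.

Lemma is_derive_Im_angular : is_derive t (1 : R) (fun t => complex.Im (f (on_circle c s t)))
  (s * (d1 * cos t - d2 * sin t)).
Proof.
apply: is_derive_eq (holo_derive_Im (dcos_t _ _ _) (dsin_t _ _ _) fD w1) _.
rewrite -/(on_circle c s t) -/d1 -/d2; ring.
Qed.
End CircleDerivatives.

Lemma continuous_on_circle_Re g c (h : R * R -> R) (u : R * R) : {for u, continuous h} ->
  ncont g (on_circle c (h u) u.2) ->
  {for u, continuous (fun w : R * R => complex.Re (g (on_circle c (h w) w.2)))}.
Proof.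
move=> hc; apply: (@ncont_Re _ _ (fun w => complex.Re c + h w * cos w.2) (fun w => complex.Im c + h w * sin w.2)).
- apply: cvgD; first exact: cvg_cst.
  apply: cvgM => //.
  by apply: (@continuous_comp _ _ _ snd (@cos R)); [exact: cvg_snd|exact: continuous_cos].
- apply: cvgD; first exact: cvg_cst.
  apply: cvgM => //.
  by apply: (@continuous_comp _ _ _ snd (@sin R)); [exact: cvg_snd|exact: continuous_sin].
Qed.

Lemma continuous_on_circle_Im g c (h : R * R -> R) (u : R * R) : {for u, continuous h} ->
  ncont g (on_circle c (h u) u.2) ->
  {for u, continuous (fun w : R * R => complex.Im (g (on_circle c (h w) w.2)))}.
Proof.
move=> hc; apply: (@ncont_Im _ _ (fun w => complex.Re c + h w * cos w.2) (fun w => complex.Im c + h w * sin w.2)).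
- apply: cvgD; first exact: cvg_cst.
  apply: cvgM => //.
  by apply: (@continuous_comp _ _ _ snd (@cos R)); [exact: cvg_snd|exact: continuous_cos].
- apply: cvgD; first exact: cvg_cst.
  apply: cvgM => //.
  by apply: (@continuous_comp _ _ _ snd (@sin R)); [exact: cvg_snd|exact: continuous_sin].
Qed.

Lemma on_circle0 c t : on_circle c 0 t = c.
Proof. by rewrite /on_circle !mul0r !addr0; case: c. Qed.

Lemma on_circle2pi c s : on_circle c s 0 = on_circle c s (2 * pi).
Proof. by rewrite /on_circle mulr_natl cos2pi sin2pi cos0 sin0. Qed.

Lemma continuous_cos2 (u : R * R) : {for u, continuous (fun w : R * R => cos w.2)}.
Proof. by apply: (@continuous_comp _ _ _ snd (@cos R)); [exact: cvg_snd|exact: continuous_cos]. Qed.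

Lemma continuous_sin2 (u : R * R) : {for u, continuous (fun w : R * R => sin w.2)}.
Proof. by apply: (@continuous_comp _ _ _ snd (@sin R)); [exact: cvg_snd|exact: continuous_sin]. Qed.

(** By the polar Cauchy-Riemann equations the radial derivative of Re f is 1/s times the angular
    derivative of Im f, so the integral is constant in the radius. The radius ranges over a
    symmetric interval so that 0, where the value is known, is interior. *)
Lemma mean_value_Re f D c (d : R) : holo f D -> 0 <= d -> N c + d < 1 ->
  \int[mu]_(t in `[0, 2 * pi]) complex.Re (f (on_circle c d t)) = 2 * pi * complex.Re (f c).
Proof.
move=> fD d0 cd; pose e := 1 - N c.
have inD s t : - e < s < e -> unit_disc (on_circle c s t).
  by rewrite -ltr_norml => se; apply: on_circle_disc; rewrite addrC -ltrBrDr.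
have de : - e < d < e by rewrite /e; apply/andP; split; lra.
have ze : - e < 0 < e by rewrite /e; apply/andP; split; lra.
have c1 (u : R * R) : {for u, continuous (fun w : R * R => w.1)} by exact: cvg_fst.
rewrite (@Rintegral_param_cst R (fun s t => complex.Re (f (on_circle c s t))) (- e) e 0 (2 * pi)
   pi2_ge0 _ (fun s t => complex.Re (D (on_circle c s t)) * cos t -
     complex.Im (D (on_circle c s t)) * sin t) _ _ _ _ 0 de ze).
- under eq_Rintegral do rewrite on_circle0.
  rewrite Rintegral_cst//= lebesgue_measure_itv/= lte_fin.
  case: ifPn => [_|]; first by rewrite oppr0 addr0 mulrC.
  by rewrite -leNgt => pi0; have := pi_gt0 R; lra.
- move=> s t se; apply: (@continuous_on_circle_Re f c fst); first exact: c1.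
  by apply: holo_ncont fD _; exact: inD.
- move=> s t se.
  have cD := holo_ncont_deriv fD (inD s t se).
  apply: cvgB; apply: cvgM.
  + by apply: (@continuous_on_circle_Re D c fst) => //; exact: c1.
  + exact: continuous_cos2.
  + by apply: (@continuous_on_circle_Im D c fst) => //; exact: c1.
  + exact: continuous_sin2.
- by move=> s t se; apply: is_derive_Re_radial => //; exact: inD.
(* At s = 0 the primitive Im f / s is undefined; there the derivative is evaluated at the fixed
   point c and integrates explicitly. *)
- move=> s se; have [->|s0] := eqVneq s 0.
    exists (fun t => complex.Re (D c) * sin t + complex.Im (D c) * cos t); split.
      by move=> t; rewrite on_circle0; apply: is_derive_eq; rewrite /GRing.scale/=; ring.
    by rewrite [RHS]/= mulr_natl cos2pi sin2pi cos0 sin0.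
  exists (fun t => s^-1 * complex.Im (f (on_circle c s t))); split; last by rewrite on_circle2pi.
  move=> t; have H := is_derive_Im_angular fD (inD s t se).
  by apply: is_derive_eq; rewrite /GRing.scale/=; field.
Qed.

End HoloCircles.

(** * Invariance of the pairing on circles *)

Section Pairing.
Context {R : realType}.
Local Notation mu := (@lebesgue_measure R).
Local Notation N := (@ComplexField.Normc.normc R).
Implicit Types (f g D E : R[i] -> R[i]).

Definition pair_integrand f g (s r t : R) : R :=
  complex.Re (f (on_circle 0 s t)) * complex.Re (g (on_circle 0 r t)) +
  complex.Im (f (on_circle 0 s t)) * complex.Im (g (on_circle 0 r t)).

(* The s-derivative of f(s e^it) conj(g((x/s) e^it)) is a t-derivative of a
   periodic function, hence integrates to 0. *)
Lemma pairing_invariant f D g E (s1 r1 s2 r2 : R) : holo f D -> holo g E ->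
  0 < s1 < 1 -> 0 < r1 < 1 -> 0 < s2 < 1 -> 0 < r2 < 1 -> s1 * r1 = s2 * r2 ->
  \int[mu]_(t in `[0, 2 * pi]) pair_integrand f g s1 r1 t =
  \int[mu]_(t in `[0, 2 * pi]) pair_integrand f g s2 r2 t.
Proof.
move=> fD gE /andP[s10 s11] /andP[r10 r11] /andP[s20 s21] /andP[r20 r21] sr.
(* The product of the radii is frozen at x; the interval ]x, 1[ for s is exactly where both s and
   x/s lie in ]0, 1[. *)
pose x := s1 * r1.
have x0 : 0 < x by exact: mulr_gt0.
have s1x : x < s1 < 1 by rewrite s11 andbT gtr_pMr.
have s2x : x < s2 < 1 by rewrite s21 andbT /x sr gtr_pMr.
have N0 : N (0 : R[i]) = 0 by exact: ComplexField.Normc.normc0.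
have inD s t : x < s < 1 -> unit_disc (on_circle 0 s t).
  by move=> /andP[xs s1']; apply: on_circle_disc; rewrite N0 add0r gtr0_norm//; lra.
have inE' s t : x < s < 1 -> unit_disc (on_circle 0 (x / s) t).
  move=> /andP[xs s1']; apply: on_circle_disc; rewrite N0 add0r gtr0_norm.
    by rewrite ltr_pdivrMr ?mul1r//; lra.
  by rewrite divr_gt0//; lra.
pose h (w : R * R) := x / w.1.
have hc (w : R * R) : x < w.1 < 1 -> {for w, continuous h}.
  move=> /andP[w1 _]; apply: cvgM; first exact: cvg_cst.
  by apply: cvgV; [rewrite gt_eqF//; lra|exact: cvg_fst].
have c1 (u : R * R) : {for u, continuous (fun w : R * R => w.1)} by exact: cvg_fst.
pose F s t := pair_integrand f g s (x / s) t.
suff : \int[mu]_(t in `[0, 2 * pi]) F s1 t = \int[mu]_(t in `[0, 2 * pi]) F s2 t.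
  rewrite /F; have -> : x / s1 = r1 by rewrite /x mulrAC divff ?mul1r ?gt_eqF.
  by have -> : x / s2 = r2 by rewrite /x sr mulrAC divff ?mul1r ?gt_eqF.
pose d1 (s t : R) := complex.Re (D (on_circle 0 s t)).
pose d2 (s t : R) := complex.Im (D (on_circle 0 s t)).
pose e1 (s t : R) := complex.Re (E (on_circle 0 (x / s) t)).
pose e2 (s t : R) := complex.Im (E (on_circle 0 (x / s) t)).
pose f1 (s t : R) := complex.Re (f (on_circle 0 s t)).
pose f2 (s t : R) := complex.Im (f (on_circle 0 s t)).
pose g1 (s t : R) := complex.Re (g (on_circle 0 (x / s) t)).
pose g2 (s t : R) := complex.Im (g (on_circle 0 (x / s) t)).
pose dF (s t : R) := (d1 s t * cos t - d2 s t * sin t) * g1 s t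
  + f1 s t * (- (x / s ^+ 2) * (e1 s t * cos t - e2 s t * sin t))
  + (d1 s t * sin t + d2 s t * cos t) * g2 s t
  + f2 s t * (- (x / s ^+ 2) * (e1 s t * sin t + e2 s t * cos t)).
have ncD s t : x < s < 1 -> ncont D (on_circle 0 s t) by move=> ?; apply: holo_ncont_deriv fD _; exact: inD.
have ncE s t : x < s < 1 -> ncont E (on_circle 0 (x / s) t) by move=> ?; apply: holo_ncont_deriv gE _; exact: inE'.
have ncf s t : x < s < 1 -> ncont f (on_circle 0 s t) by move=> ?; apply: holo_ncont fD _; exact: inD.
have ncg s t : x < s < 1 -> ncont g (on_circle 0 (x / s) t) by move=> ?; apply: holo_ncont gE _; exact: inE'.
have cd1 s t : x < s < 1 -> {for (s, t), continuous (fun w : R * R => d1 w.1 w.2)}.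
  by move=> sx; apply: (@continuous_on_circle_Re _ D 0 fst); [exact: c1|exact: ncD].
have cd2 s t : x < s < 1 -> {for (s, t), continuous (fun w : R * R => d2 w.1 w.2)}.
  by move=> sx; apply: (@continuous_on_circle_Im _ D 0 fst); [exact: c1|exact: ncD].
have cf1 s t : x < s < 1 -> {for (s, t), continuous (fun w : R * R => f1 w.1 w.2)}.
  by move=> sx; apply: (@continuous_on_circle_Re _ f 0 fst); [exact: c1|exact: ncf].
have cf2 s t : x < s < 1 -> {for (s, t), continuous (fun w : R * R => f2 w.1 w.2)}.
  by move=> sx; apply: (@continuous_on_circle_Im _ f 0 fst); [exact: c1|exact: ncf].
have ce1 s t : x < s < 1 -> {for (s, t), continuous (fun w : R * R => e1 w.1 w.2)}.
  by move=> sx; apply: (@continuous_on_circle_Re _ E 0 h); [exact: hc|exact: ncE].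
have ce2 s t : x < s < 1 -> {for (s, t), continuous (fun w : R * R => e2 w.1 w.2)}.
  by move=> sx; apply: (@continuous_on_circle_Im _ E 0 h); [exact: hc|exact: ncE].
have cg1 s t : x < s < 1 -> {for (s, t), continuous (fun w : R * R => g1 w.1 w.2)}.
  by move=> sx; apply: (@continuous_on_circle_Re _ g 0 h); [exact: hc|exact: ncg].
have cg2 s t : x < s < 1 -> {for (s, t), continuous (fun w : R * R => g2 w.1 w.2)}.
  by move=> sx; apply: (@continuous_on_circle_Im _ g 0 h); [exact: hc|exact: ncg].
have cx s t : x < s < 1 -> {for (s, t), continuous (fun w : R * R => - (x / w.1 ^+ 2))}.
  move=> /andP[xs _]; apply: cvgN; apply: cvgM; first exact: cvg_cst.
  apply: cvgV; first by rewrite expf_neq0// gt_eqF//=; lra.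
  by apply: (@continuous_comp _ _ _ fst (fun x : R => x ^+ 2)); [exact: c1|exact: exprn_continuous].
have cc (u : R * R) := @continuous_cos2 R u.
have cs (u : R * R) := @continuous_sin2 R u.
have dx s : x < s < 1 -> is_derive s (1:R) (fun s => x / s) (- (x / s ^+ 2)).
  move=> /andP[xs _]; have s0 : s != 0 by rewrite gt_eqF//; lra.
  have Dv := @is_deriveV _ id s _ _ s0 (is_derive_id s 1).
  by apply: is_derive_eq; rewrite /GRing.scale/=; field.
have chain s (u : R -> R) du : x < s < 1 -> is_derive (x / s) (1:R) u du ->
   is_derive s (1:R) (fun s => u (x / s)) (- (x / s ^+ 2) * du).
  move=> sx Du; have Dx := dx _ sx.
  by rewrite mulrC; apply: (@is_derive1_comp _ u (fun s => x / s)).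
apply: (@Rintegral_param_cst R F x 1 0 (2 * pi) pi2_ge0 _ dF _ _ _ s1 s2 s1x s2x).
- move=> s t sx; apply: cvgD; apply: cvgM; [exact: cf1|exact: cg1|exact: cf2|exact: cg2].
- move=> s t sx; have := cd1 s t sx; have := cd2 s t sx; have := ce1 s t sx; have := ce2 s t sx.
  have := cf1 s t sx; have := cf2 s t sx; have := cg1 s t sx; have := cg2 s t sx.
  have := cx s t sx; have := cc (s, t); have := cs (s, t).
  move=> Hs Hc Hx Hg2 Hg1 Hf2 Hf1 He2 He1 Hd2 Hd1.
  apply: cvgD; [apply: cvgD; [apply: cvgD|]|]; apply: cvgM => //.
  + by apply: cvgB; apply: cvgM.
  + by apply: cvgM => //; apply: cvgB; apply: cvgM.
  + by apply: cvgD; apply: cvgM.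
  + by apply: cvgM => //; apply: cvgD; apply: cvgM.
- move=> s t sx.
  have A1 := is_derive_Re_radial fD (inD s t sx); have A2 := is_derive_Im_radial fD (inD s t sx).
  have B1 := chain _ _ _ sx (is_derive_Re_radial gE (inE' s t sx)).
  have B2 := chain _ _ _ sx (is_derive_Im_radial gE (inE' s t sx)).
  apply: is_derive_eq; rewrite /GRing.scale/= /dF /d1 /d2 /e1 /e2 /f1 /f2 /g1 /g2; ring.
(* The primitive is Im(f conj g)/s. Indeed d/ds acts on f as (1/(is)) d/dt and on g(x/s .) as its
   negative; conjugating the latter restores the sign, so the s-derivative of f conj g is (1/(is))
   d/dt of f conj g. *)
- move=> s sx; exists (fun t => s^-1 * (f2 s t * g1 s t - f1 s t * g2 s t)); split; last first.
    by rewrite /f1 /f2 /g1 /g2 -!on_circle2pi.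
  move=> t.
  have s0 : s != 0 by case/andP: sx => xs _; rewrite gt_eqF//; lra.
  have A1 := is_derive_Re_angular fD (inD s t sx); have A2 := is_derive_Im_angular fD (inD s t sx).
  have B1 := is_derive_Re_angular gE (inE' s t sx); have B2 := is_derive_Im_angular gE (inE' s t sx).
  apply: is_derive_eq; rewrite /GRing.scale/= /dF /d1 /d2 /e1 /e2 /f1 /f2 /g1 /g2; field.
  exact: s0.
Qed.

End Pairing.

(** * Real powers, arguments and elementary integrals *)

Section PowersAndIntegrals.
Context {R : realType}.
Local Notation mu := (@lebesgue_measure R).
Local Notation N := (@ComplexField.Normc.normc R).

Lemma continuous_powR_comp (T : topologicalType) (h : T -> R) (t0 : T) (p : R) : 0 < p ->
  (forall t, 0 <= h t) -> {for t0, continuous h} -> {for t0, continuous (fun t => h t `^ p)}.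
Proof.
move=> p0 h0 hc.
have [h00|h00] := eqVneq (h t0) 0.
  apply/cvgrPdist_lt => e e0.
  have e1 : 0 < e `^ p^-1 by exact: powR_gt0.
  move/cvgrPdist_lt : hc => /(_ _ e1); apply: filterS => t.
  rewrite h00 powR0 ?gt_eqF// !sub0r !normrN ger0_norm// ger0_norm ?powR_ge0// => he.
  have -> : e = (e `^ p^-1) `^ p by rewrite -powRrM mulVf ?gt_eqF// powRr1// ltW.
  by apply: gt0_ltr_powR => //; rewrite nnegrE ?powR_ge0.
have ht0 : 0 < h t0 by rewrite lt_neqAle eq_sym h00 h0.
have E : \forall t \near t0, expR (p * ln (h t)) = h t `^ p.
  have : \forall t \near t0, 0 < h t by apply: (cvgr_gt (h t0) hc).
  by apply: filterS => t ht; rewrite /powR gt_eqF.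
have E0 : h t0 `^ p = expR (p * ln (h t0)) by rewrite /powR (negbTE h00).
change ((fun t => h t `^ p) @ t0 --> h t0 `^ p); rewrite E0.
apply: cvg_trans; first exact: near_eq_cvg E.
apply: (@continuous_comp _ _ _ (fun t => p * ln (h t)) expR); last exact: continuous_expR.
apply: cvgM; first exact: cvg_cst.
by apply: (@continuous_comp _ _ _ h (@ln R)); [exact: hc|exact: continuous_ln].
Qed.

(** The tangent line of the p-th power at y, from Young's inequality for x and y^(p-1). It plays the
    role of Jensen's inequality in [powN_submean]. *)
Lemma powR_tangent (x y p : R) : 1 < p -> 0 <= x -> 0 <= y ->
  p * y `^ (p - 1) * x <= x `^ p + (p - 1) * y `^ p.
Proof.
move=> p1 x0 y0; have p0 : 0 < p by lra.
have p10 : 0 < p - 1 by lra.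
have q0 : 0 < p / (p - 1) by rewrite divr_gt0.
have H := @conjugate_powR R x (y `^ (p - 1)) p (p / (p - 1)) x0 (powR_ge0 _ _) p0 q0.
have pq : p^-1 + (p / (p - 1))^-1 = 1.
  rewrite invf_div -{1}(mul1r p^-1) -mulrDl addrC subrK divff ?gt_eqF//.
move: (H pq); rewrite -powRrM.
have -> : (p - 1) * (p / (p - 1)) = p by rewrite mulrCA divff ?mulr1 ?gt_eqF.
rewrite invf_div => {}H.
have := ler_wpM2l (ltW p0) H.
rewrite mulrDr (mulrCA p (x `^ p)) divff ?gt_eqF// mulr1.
have -> : p * (y `^ p * ((p - 1) / p)) = (p - 1) * y `^ p by field; rewrite gt_eqF.
by have -> : p * y `^ (p - 1) * x = p * (x * y `^ (p - 1)) by ring.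
Qed.

Lemma polar_form (z : R[i]) : exists2 a : R, - pi <= a <= pi & z = polar (N z) a.
Proof.
have pi0 := pi_gt0 R.
have [z0|z0] := eqVneq (N z) 0.
  exists 0; first by apply/andP; split; lra.
  by rewrite z0 /polar !mul0r; exact: ComplexField.Normc.eq0_normc.
have Nz : 0 < N z by rewrite lt_neqAle eq_sym z0 normc_ge0.
pose a := complex.Re z / N z.
have a1 : -1 <= a <= 1.
  rewrite -ler_norml /a normrM normfV (gtr0_norm Nz) ler_pdivrMr// mul1r; exact: ler_Re_normc.
have acos_a : 0 <= acos a <= pi by rewrite acos_ge0// acos_lepi.
have ca : N z * cos (acos a) = complex.Re z by rewrite acosK ?in_itv// mulrCA divff ?mulr1 ?gt_eqF.
have sa : N z * sin (acos a) = `|complex.Im z|.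
  rewrite sin_acos//.
  have -> : 1 - a ^+ 2 = (complex.Im z / N z) ^+ 2.
    rewrite /a !exprMn exprVn sqr_normc_ReIm; have := sqr_normc_ReIm z => H.
    have H0 : complex.Re z ^+ 2 + complex.Im z ^+ 2 != 0 by rewrite -H expf_neq0.
    by field.
  by rewrite sqrtr_sqr normrM normfV (gtr0_norm Nz) mulrCA divff ?mulr1// gt_eqF.
have [iz|iz] := leP 0 (complex.Im z).
  exists (acos a); first by apply/andP; split; lra.
  by rewrite /polar ca sa ger0_norm//; case: (z).
exists (- acos a); first by apply/andP; split; lra.
by rewrite /polar cosN sinN mulrN ca sa ltr0_norm// opprK; case: (z).
Qed.

Lemma fubini_tonelli_itv (G : R * R -> R) (a b : R) : continuous G -> (forall u, 0 <= G u) ->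
  (\int[mu]_(x in `[a, b]) \int[mu]_(y in `[a, b]) (G (x, y))%:E =
   \int[mu]_(y in `[a, b]) \int[mu]_(x in `[a, b]) (G (x, y))%:E)%E.
Proof.
move=> Gc G0; pose A : set (measurableTypeR R) := `[a, b]%classic.
have mA : measurable A by exact: measurable_itv.
pose H (u : measurableTypeR R * measurableTypeR R) : \bar R := (G u * (\1_A u.1 * \1_A u.2))%:E.
have mG : measurable_fun setT (G : measurableTypeR R * measurableTypeR R -> R).
  by apply: (@open_continuous_measurable_prod _ setT) => [|u _]; [exact: openT|exact: Gc].
have mH : measurable_fun setT H.
  apply/measurable_EFinP; apply: measurable_funM => //.
  by apply: measurable_funM; apply: measurableT_comp => //; exact: measurable_indic.
have H0 u : (0 <= H u)%E by rewrite lee_fin !mulr_ge0.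
have I0 (k : R -> \bar R) x : (if x \in A then k x else 0)%E = (k x * (\1_A x)%:E)%E.
  by rewrite indicE; case: ifP; rewrite ?mule1 ?mule0.
rewrite [LHS]integral_mkcond [RHS]integral_mkcond.
transitivity (\int[mu]_x \int[mu]_y H (x, y))%E.
  apply: eq_integral => x _; rewrite patchE -/A.
  case: ifPn => xA; last first.
    by rewrite integral0_eq// => y _; rewrite /H/= indicE (negbTE xA) mul0r mulr0.
  rewrite integral_mkcond; apply: eq_integral => y _; rewrite patchE -/A /H/= !indicE xA mul1r.
  by case: ifP; rewrite ?mulr1 ?mulr0.
rewrite fubini_tonelli//; apply: eq_integral => y _; rewrite patchE -/A.
case: ifPn => yA; last first.
  by rewrite integral0_eq// => x _; rewrite /H/= !indicE (negbTE yA) !mulr0.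
rewrite [RHS]integral_mkcond; apply: eq_integral => x _; rewrite patchE -/A /H/= !indicE yA mulr1.
by case: ifP; rewrite ?mulr1 ?mulr0.
Qed.

Lemma Rintegral_cos : \int[mu]_(t in `[0, 2 * pi]) cos t = 0.
Proof.
have cs : continuous (@sin R) by move=> x; exact: continuous_sin.
rewrite /Rintegral (@continuous_FTC2 _ (@cos R) (@sin R)).
- by rewrite sin0 mulr_natl sin2pi subee.
- by rewrite mulr_gt0// pi_gt0.
- by apply: continuous_subspaceT => x; exact: continuous_cos.
- split=> [x _||]; first exact: ex_derive.
    by apply: cvg_at_right_filter; exact: cs.
  by apply: cvg_at_left_filter; exact: cs.
- by move=> x _; rewrite derive1E derive_val.
Qed.

Lemma Rintegral_cst2pi (c : R) : \int[mu]_(t in `[0, 2 * pi]) c = 2 * pi * c.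
Proof.
rewrite Rintegral_cst//= lebesgue_measure_itv/= lte_fin.
case: ifPn => [_|]; first by rewrite oppr0 addr0 mulrC.
by rewrite -leNgt => pi0; have := pi_gt0 R; lra.
Qed.

End PowersAndIntegrals.

(** * Subharmonicity of |f|^p and monotonicity of its circle means *)

Section CircleMeans.
Context {R : realType}.
Local Notation mu := (@lebesgue_measure R).
Local Notation N := (@ComplexField.Normc.normc R).
Variables (f D : R[i] -> R[i]) (p : R).
Hypotheses (fD : holo f D) (p1 : 1 < p).

Lemma holo_scale (a : R[i]) : holo (fun z => a * f z) (fun z => a * D z).
Proof.
move=> c Dc; have [m [C [m0 C0 H]]] := fD Dc.
exists m, (N a * C); split => //; first by rewrite mulr_ge0// normc_ge0.
move=> z w zm wm.
have -> : a * f w - a * f z - (w - z) * (a * D z) = a * (f w - f z - (w - z) * D z) by ring.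
by rewrite ComplexField.Normc.normcM -mulrA; apply: ler_wpM2l; [exact: normc_ge0|exact: H].
Qed.

Let p0 : 0 < p. Proof. exact: lt_trans ltr01 p1. Qed.

Definition powN (z : R[i]) : R := N (f z) `^ p.

Lemma powN_ge0 z : 0 <= powN z. Proof. exact: powR_ge0. Qed.

Lemma continuous_powN (T : topologicalType) (x y : T -> R) t0 :
  {for t0, continuous x} -> {for t0, continuous y} -> unit_disc (x t0 +i* y t0) ->
  {for t0, continuous (fun t => powN (x t +i* y t))}.
Proof.
move=> xc yc Dt; apply: continuous_powR_comp => //; first by move=> t; exact: normc_ge0.
by apply: ncont_normc => //; exact: holo_ncont fD Dt.
Qed.

Lemma cont_disc_powN : cont_disc (fun u : R * R => powN (to_complex u)).
Proof.
by move=> u Du; apply: (@continuous_powN _ fst snd u _ _ Du); [exact: cvg_fst|exact: cvg_snd].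
Qed.

Lemma continuous_powN_on_circle c s : N c + `|s| < 1 -> continuous (fun t => powN (on_circle c s t)).
Proof.
move=> cs t; apply: (@continuous_powN _ (fun t => complex.Re c + s * cos t) (fun t => complex.Im c + s * sin t)).
- by apply: cvgD; [exact: cvg_cst|apply: cvgMr; exact: continuous_cos].
- by apply: cvgD; [exact: cvg_cst|apply: cvgMr; exact: continuous_sin].
- exact: on_circle_disc.
Qed.

Lemma continuous_normc_on_circle c s : N c + `|s| < 1 -> continuous (fun t => N (f (on_circle c s t))).
Proof.
move=> cs t; apply: (@ncont_normc _ _ (fun t => complex.Re c + s * cos t) (fun t => complex.Im c + s * sin t)).
- by apply: cvgD; [exact: cvg_cst|apply: cvgMr; exact: continuous_cos].
- by apply: cvgD; [exact: cvg_cst|apply: cvgMr; exact: continuous_sin].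
- by apply: holo_ncont fD _; exact: on_circle_disc.
Qed.

(** The function conj(f c) f has real part |f c|^2 at c, so its mean value property gives the
    sub-mean inequality for |f|. The tangent of the p-th power at |f c| then transfers it to
    |f|^p. *)
Lemma powN_submean c (d : R) : 0 <= d -> N c + d < 1 ->
  2 * pi * powN c <= \int[mu]_(t in `[0, 2 * pi]) powN (on_circle c d t).
Proof.
move=> d0 cd.
have cd' : N c + `|d| < 1 by rewrite ger0_norm.
have pi2 : 0 <= 2 * pi :> R by exact: pi2_ge0.
have mI : measurable (`[0, 2 * pi]%classic : set (measurableTypeR R)) by exact: measurable_itv.
pose y := N (f c).
have y0 : 0 <= y by exact: normc_ge0.
have iN : mu.-integrable `[0, 2 * pi] (EFin \o (fun t => N (f (on_circle c d t)))).
  by apply: continuous_itv_integrable; exact: continuous_normc_on_circle.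
have iP : mu.-integrable `[0, 2 * pi] (EFin \o (fun t => powN (on_circle c d t))).
  by apply: continuous_itv_integrable; exact: continuous_powN_on_circle.
have icst (b : R) : mu.-integrable `[0, 2 * pi] (EFin \o (fun=> b)).
  by apply: continuous_itv_integrable => ?; exact: cvg_cst.
have [y00|yn0] := eqVneq y 0.
  rewrite /powN -/y y00 powR0 ?gt_eqF// mulr0; apply: Rintegral_ge0 => t _; exact: powN_ge0.
have yp : 0 < y by rewrite lt_neqAle eq_sym yn0.
have H1 : 2 * pi * y <= \int[mu]_(t in `[0, 2 * pi]) N (f (on_circle c d t)).
  have fD' := holo_scale (conjc (f c)).
  have := mean_value_Re fD' d0 cd.
  have -> : complex.Re (conjc (f c) * f c) = y * y.
    by rewrite -expr2 /y sqr_normc_ReIm; case: (f c) => a b /=; ring.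
  move=> E; rewrite -(ler_pM2l yp).
  have -> : y * (2 * pi * y) = 2 * pi * (y * y) by ring.
  rewrite -E -RintegralZl//; apply: le_Rintegral => //.
  - apply: continuous_itv_integrable => t.
    apply: (@ncont_Re _ _ (fun t => complex.Re c + d * cos t) (fun t => complex.Im c + d * sin t) t (fun z => conjc (f c) * f z)).
    + by apply: cvgD; [exact: cvg_cst|apply: cvgMr; exact: continuous_cos].
    + by apply: cvgD; [exact: cvg_cst|apply: cvgMr; exact: continuous_sin].
    + by apply: holo_ncont fD' _; exact: on_circle_disc.
  - apply: continuous_itv_integrable => t; apply: cvgMr; exact: continuous_normc_on_circle.
  - move=> t _; apply: (le_trans (ler_norm _)); apply: (le_trans (ler_Re_normc _)).
    rewrite ComplexField.Normc.normcM /y.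
    by have -> : N (conjc (f c)) = N (f c) by rewrite !normc_sqrt; case: (f c) => a b /=; rewrite sqrrN.
have py : 0 < p * y `^ (p - 1) by rewrite mulr_gt0// powR_gt0.
have H2 : p * y `^ (p - 1) * \int[mu]_(t in `[0, 2 * pi]) N (f (on_circle c d t)) <=
  \int[mu]_(t in `[0, 2 * pi]) powN (on_circle c d t) + 2 * pi * ((p - 1) * y `^ p).
  rewrite -RintegralZl// -Rintegral_cst2pi -RintegralD//; apply: le_Rintegral => //.
  - by apply: continuous_itv_integrable => t; apply: cvgMr; exact: continuous_normc_on_circle.
  - by apply: continuous_itv_integrable => t; apply: cvgD; [exact: continuous_powN_on_circle|exact: cvg_cst].
  - by move=> t _; apply: powR_tangent => //; exact: normc_ge0.
have H3 := ler_wpM2l (ltW py) H1.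
have yy : y `^ (p - 1) * y = y `^ p.
  by rewrite -{2}(powRr1 y0) -powRD ?subrK//; apply/implyP => _; rewrite gt_eqF.
have := le_trans H3 H2.
have -> : p * y `^ (p - 1) * (2 * pi * y) = 2 * pi * (p * (y `^ (p - 1) * y)) by ring.
rewrite yy /powN -/y; lra.
Qed.

(** The m of the overview, without the factor 1/(2 pi). *)
Definition cmean (r : R) := circ (fun u : R * R => powN (to_complex u)) r.

Lemma on_circle_origin (s t : R) : on_circle 0 s t = to_complex (s * cos t, s * sin t) :> R[i].
Proof. by rewrite /on_circle /to_complex/= !add0r. Qed.

Lemma cmeanE r : cmean r = \int[mu]_(t in `[0, 2 * pi]) powN (on_circle 0 r t).
Proof. by apply: eq_Rintegral => t _; rewrite on_circle_origin. Qed.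

Lemma continuous_cmean r : -1 < r < 1 -> {for r, continuous cmean}.
Proof. by move=> r1; apply: continuous_circ => //; exact: cont_disc_powN. Qed.

Lemma cmean_ge0 r : 0 <= cmean r.
Proof. by rewrite cmeanE; apply: Rintegral_ge0 => t _; exact: powN_ge0. Qed.

Lemma polarM (r s a t : R) : polar r a * polar s t = polar (r * s) (a + t).
Proof. by rewrite /polar cosD sinD; apply/eqP; rewrite eq_complex/=; apply/andP; split; apply/eqP; ring. Qed.

Lemma on_circle0E (s t : R) : on_circle 0 s t = polar s t.
Proof. by rewrite on_circleE add0r. Qed.

(** Expresses [cmean] at |z| as an integral over the rotations of the point z itself, so that z may
    run along a circle not centred at 0. *)
Lemma cmean_rotate (z : R[i]) : N z < 1 ->
  (\int[mu]_(t in `[0%R, (2 * pi)%R]) (powN (polar 1 t * z))%:E = (cmean (N z))%:E)%E.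
Proof.
move=> z1; have [a a_pi za] := polar_form z.
have z1' : N (0 : R[i]) + `|N z| < 1 by rewrite ComplexField.Normc.normc0 add0r ger0_norm// normc_ge0.
have cN := continuous_powN_on_circle z1'.
have mN : measurable_fun setT (fun x => (powN (on_circle 0 (N z) x))%:E).
  by apply/measurable_EFinP; exact: continuous_measurable_fun.
have N0 x : (0 <= (powN (on_circle 0 (N z) x))%:E)%E by rewrite lee_fin powN_ge0.
have pi0 := pi_gt0 R.
have HT x : (powN (on_circle 0 (N z) (x + 2 * pi)%R))%:E = (powN (on_circle 0 (N z) x))%:E.
  by rewrite /on_circle cosD2piM sinD2piM.
have Ha : - (2 * pi) <= a <= 2 * pi by case/andP: a_pi => ? ?; apply/andP; split; lra.
rewrite cmeanE -(EFin_Rintegral_itv _ _ cN) -(ge0_integral_period pi2_ge0 mN N0 HT Ha).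
have mN' : measurable_fun setT (fun t => (powN (polar 1 t * z))%:E).
  have -> : (fun t => (powN (polar 1 t * z))%:E) = (fun t : R => (powN (on_circle 0 (N z) (t + a)))%:E).
    by apply/funext => t; rewrite {1}za polarM mul1r on_circle0E.
  have cNa : continuous (fun t : R => powN (on_circle 0 (N z) (t + a))).
    move=> t; apply: (@continuous_comp _ _ _ (fun t : R => t + a) (fun t => powN (on_circle 0 (N z) t))); last exact: cN.
    by apply: cvgD; [exact: cvg_id|exact: cvg_cst].
  by apply/measurable_EFinP; exact: continuous_measurable_fun.
rewrite -[LHS]integral_itv_obnd_cbnd; last by apply: measurable_funTS; exact: mN'.
rewrite -[RHS]integral_itv_obnd_cbnd; last by apply: measurable_funTS; exact: mN.
have S := ge0_integral_itv_shift 0 (2 * pi) a mN N0; rewrite add0r (addrC _ a) in S.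
rewrite S; apply: eq_integral => t _.
by rewrite {1}za polarM mul1r on_circle0E.
Qed.

(* |f|^p is subharmonic, and so is its average over rotations
   [z |-> cmean (N z)]. *)
Lemma cmean_submean (x d : R) : 0 <= x -> 0 < d -> x + d < 1 ->
  2 * pi * cmean x <= \int[mu]_(t in `[0, 2 * pi]) cmean (N (on_circle x%:C d t)).
Proof.
move=> x0 d0 xd.
have inD t : N (on_circle x%:C d t) < 1.
  by apply: on_circle_disc; rewrite normc_real !ger0_norm// ltW.
have ccm : continuous (fun t => cmean (N (on_circle x%:C d t))).
  move=> t; apply: (@continuous_comp _ _ _ (fun t => N (on_circle x%:C d t)) cmean).
    apply: (@ncont_normc _ _ (fun t => x + d * cos t) (fun t => 0 + d * sin t) t id).
    - by apply: cvgD; [exact: cvg_cst|apply: cvgMr; exact: continuous_cos].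
    - by apply: cvgD; [exact: cvg_cst|apply: cvgMr; exact: continuous_sin].
    - by move=> e e0; exists e.
  by apply: continuous_cmean; rewrite inD andbT (lt_le_trans (ltrN10 R))// normc_ge0.
pose G (u : R * R) := powN (polar 1 u.1 * on_circle x%:C d u.2).
have Gc : continuous G.
  move=> u.
  have c1 : {for u, continuous (fun w : R * R => cos w.1)}.
    by apply: (@continuous_comp _ _ _ fst (@cos R)); [exact: cvg_fst|exact: continuous_cos].
  have s1 : {for u, continuous (fun w : R * R => sin w.1)}.
    by apply: (@continuous_comp _ _ _ fst (@sin R)); [exact: cvg_fst|exact: continuous_sin].
  have c2 := @continuous_cos2 R u; have s2 := @continuous_sin2 R u.
  have X2 : {for u, continuous (fun w : R * R => x + d * cos w.2)}.
    by apply: cvgD; [exact: cvg_cst|apply: cvgMr].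
  have Y2 : {for u, continuous (fun w : R * R => 0 + d * sin w.2)}.
    by apply: cvgD; [exact: cvg_cst|apply: cvgMr].
  rewrite (_ : G = fun w => powN (((1 * cos w.1) * (x + d * cos w.2) - (1 * sin w.1) * (0 + d * sin w.2))
     +i* ((1 * cos w.1) * (0 + d * sin w.2) + (1 * sin w.1) * (x + d * cos w.2))))//.
  apply: (@continuous_powN _ (fun w : R * R => (1 * cos w.1) * (x + d * cos w.2) - (1 * sin w.1) * (0 + d * sin w.2))
    (fun w : R * R => (1 * cos w.1) * (0 + d * sin w.2) + (1 * sin w.1) * (x + d * cos w.2))).
  - by apply: cvgB; apply: cvgM => //; apply: cvgMr.
  - by apply: cvgD; apply: cvgM => //; apply: cvgMr.
  - change (N (polar 1 u.1 * on_circle x%:C d u.2) < 1).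
    by rewrite ComplexField.Normc.normcM normc_polar normr1 mul1r.
have G0 u : 0 <= G u by exact: powN_ge0.
rewrite -lee_fin -(EFin_Rintegral_itv _ _ ccm).
under [leRHS]eq_integral do rewrite -cmean_rotate//.
(* With the rotation angle outermost, the claim follows from [powN_submean] at each rotated
   centre. *)
have := fubini_tonelli_itv 0 (2 * pi) Gc G0; rewrite /G/= => <-.
have xx : N (0 : R[i]) + `|x| < 1 by rewrite ComplexField.Normc.normc0 add0r ger0_norm//; lra.
have cx0 := continuous_powN_on_circle xx.
have cx1 : continuous (fun t => 2 * pi * powN (on_circle 0 x t)).
  by move=> t; apply: cvgMr; exact: cx0.
rewrite cmeanE -RintegralZl//; last exact: (continuous_itv_integrable _ _ cx0).
rewrite -(EFin_Rintegral_itv _ _ cx1).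
have mI : measurable (`[0, 2 * pi]%classic : set (measurableTypeR R)) by exact: measurable_itv.
apply: ge0_le_integral => //.
- by move=> t _; rewrite lee_fin mulr_ge0 ?pi2_ge0// powN_ge0.
- by apply/measurable_EFinP/measurable_funTS; exact: continuous_measurable_fun.
- apply: measurable_funTS.
  pose A : set (measurableTypeR R) := `[0, 2 * pi]%classic.
  rewrite (_ : (fun _ => _) = fubini_F mu
    (fun u : measurableTypeR R * measurableTypeR R => (G u * \1_A u.2)%:E)).
    apply: measurable_fun_fubini_tonelli_F.
    - apply/measurable_EFinP; apply: measurable_funM.
        by apply: (@open_continuous_measurable_prod _ setT) => [|u _]; [exact: openT|exact: Gc].
      by apply: measurableT_comp => //; exact: measurable_indic.
    - by move=> u; rewrite lee_fin mulr_ge0.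
  apply/funext => r; rewrite integral_mkcond; apply: eq_integral => t _.
  by rewrite patchE /= indicE; case: ifP => _; rewrite ?mulr1 ?mulr0.
move=> a; rewrite /= in_itv/= => /andP[a0 a2].
have cx : N (on_circle 0 x a) + d < 1 by rewrite on_circle0E normc_polar ger0_norm.
apply: (@le_trans _ _ (\int[mu]_(t in `[0, 2 * pi]) powN (on_circle (on_circle 0 x a) d t))%:E).
  by rewrite lee_fin powN_submean// ltW.
have cx' : N (on_circle 0 x a) + `|d| < 1 by rewrite (gtr0_norm d0).
have cN := continuous_powN_on_circle cx'.
have mN : measurable_fun setT (fun t => (powN (on_circle (on_circle 0 x a) d t))%:E).
  by apply/measurable_EFinP; exact: continuous_measurable_fun.
(* Rotating the circle about x by a yields the circle about the rotated centre, with its parameter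
   advanced by a; periodicity absorbs that shift. *)
have GE t : powN (on_circle (on_circle 0 x a) d (t + a)) = powN (polar 1 a * on_circle x%:C d t).
  by rewrite !on_circleE add0r mulrDr polarM mul1r (addrC a t) -[x%:C](_ : polar x 0 = _) ?polarM ?mul1r ?addr0// /polar cos0 sin0 mulr1 mulr0.
have P0 t : (0 <= (powN (on_circle (on_circle 0 x a) d t))%:E)%E by rewrite lee_fin powN_ge0.
have HT t : (powN (on_circle (on_circle 0 x a) d (t + 2 * pi)%R))%:E = (powN (on_circle (on_circle 0 x a) d t))%:E.
  by rewrite /on_circle cosD2piM sinD2piM.
have Ha : - (2 * pi) <= a <= 2 * pi by rewrite a2 andbT (le_trans _ a0)// oppr_le0 pi2_ge0.
rewrite -(EFin_Rintegral_itv _ _ cN) -(ge0_integral_period pi2_ge0 mN P0 HT Ha).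
rewrite -[leLHS]integral_itv_obnd_cbnd; last by apply: measurable_funTS; exact: mN.
have S := ge0_integral_itv_shift 0 (2 * pi) a mN P0; rewrite add0r (addrC _ a) in S.
rewrite S.
rewrite integral_itv_obnd_cbnd; last first.
  have cNa : continuous (fun t : R => powN (on_circle (on_circle 0 x a) d (t + a))).
    move=> t; apply: (@continuous_comp _ _ _ (fun t : R => t + a) (fun t => powN (on_circle (on_circle 0 x a) d t))); last exact: cN.
    by apply: cvgD; [exact: cvg_id|exact: cvg_cst].
  by apply/measurable_EFinP/measurable_funTS; exact: continuous_measurable_fun.
rewrite le_eqVlt; apply/orP; left; apply/eqP; apply: eq_integral => t _; by rewrite GE.
Qed.

(* Maximum principle for cmean (N z) + e |z|^2, which is strictly subharmonic. *)
Lemma cmean_nondecreasing (r s : R) : 0 <= r -> r <= s -> s < 1 -> cmean r <= cmean s.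
Proof.
move=> r0 rs s1; have s0 : 0 <= s by exact: le_trans rs.
suff H (e : R) : 0 < e -> cmean r + e * r ^+ 2 <= cmean s + e * s ^+ 2.
  apply/ler_addgt0Pr => e e0.
  have s21 : s ^+ 2 <= 1 by rewrite expr_le1// ltW.
  have := ler_wpM2l (ltW e0) s21; have := mulr_ge0 (ltW e0) (sqr_ge0 r); have := H _ e0.
  by rewrite mulr1; move: (cmean r) (cmean s) (e * r ^+ 2) (e * s ^+ 2) => A B X Y; lra.
move=> e0.
pose w x := cmean x + e * x ^+ 2.
have wc : {within `[0, s], continuous w}.
  apply: continuous_in_subspaceT => x; rewrite inE/= in_itv/= => /andP[x0 xs].
  apply: cvgD; first by apply: continuous_cmean; apply/andP; split; lra.
  by apply: cvgMr; exact: exprn_continuous.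
have [x0] := EVT_max s0 wc; rewrite in_itv/= => /andP[x00 x0s] wmax.
have w_r : w r <= w x0 by apply: wmax; rewrite in_itv/= r0.
move: x0s; rewrite le_eqVlt => /predU1P[x0s|x0s]; first by rewrite -x0s.
exfalso.
(* The largest radius for which the circle about x0 stays in |z| <= s, where w is at most w x0. *)
pose d := s - x0.
have d0 : 0 < d by rewrite subr_gt0.
have xd : x0 + d < 1 by rewrite /d; lra.
have := cmean_submean x00 d0 xd.
have inD t : N (on_circle x0%:C d t) <= s.
  rewrite on_circleE; apply: (le_trans (normc_addr _ _)).
  rewrite normc_real normc_polar (ger0_norm x00) (gtr0_norm d0) /d; lra.
have ccm : continuous (fun t => cmean (N (on_circle x0%:C d t))).
  move=> t; apply: (@continuous_comp _ _ _ (fun t => N (on_circle x0%:C d t)) cmean).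
    apply: (@ncont_normc _ _ (fun t => x0 + d * cos t) (fun t => 0 + d * sin t) t id).
    - by apply: cvgD; [exact: cvg_cst|apply: cvgMr; exact: continuous_cos].
    - by apply: cvgD; [exact: cvg_cst|apply: cvgMr; exact: continuous_sin].
    - by move=> e' e'0; exists e'.
  apply: continuous_cmean; apply/andP; split; first exact: lt_le_trans (ltrN10 R) (normc_ge0 _).
  exact: le_lt_trans (inD t) s1.
(* On the circle |z|^2 = x0^2 + 2 x0 d cos t + d^2. The cosine integrates to 0, and the remaining e
   d^2 > 0 contradicts the sub-mean inequality. *)
pose c := w x0 - e * (x0 ^+ 2 + d ^+ 2).
have bnd t : cmean (N (on_circle x0%:C d t)) <= c + - (2 * e * x0 * d) * cos t.
  have : w (N (on_circle x0%:C d t)) <= w x0.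
    apply: wmax; rewrite in_itv; apply/andP; split; [exact: normc_ge0|exact: inD].
  rewrite {1}/w sqr_normc_ReIm [complex.Re _]/= [complex.Im _]/= add0r /c.
  move: (cmean _) (w x0) => A B H.
  have E : (x0 + d * cos t) ^+ 2 + (d * sin t) ^+ 2 =
     x0 ^+ 2 + 2 * x0 * d * cos t + d ^+ 2 * (cos t ^+ 2 + sin t ^+ 2) by ring.
  by move: H; rewrite E cos2Dsin2; lra.
have ccos : continuous (fun t => - (2 * e * x0 * d) * cos t).
  by move=> t; apply: cvgMr; exact: continuous_cos.
have : \int[mu]_(t in `[0, 2 * pi]) cmean (N (on_circle x0%:C d t)) <=
       \int[mu]_(t in `[0, 2 * pi]) (c + - (2 * e * x0 * d) * cos t).
  apply: le_Rintegral => //.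
  - exact: continuous_itv_integrable.
  - by apply: continuous_itv_integrable => t; apply: cvgD; [exact: cvg_cst|exact: ccos].
rewrite RintegralD//; last 2 first.
- by apply: continuous_itv_integrable => ?; exact: cvg_cst.
- exact: continuous_itv_integrable.
rewrite RintegralZl//; last first.
  by apply: continuous_itv_integrable => ?; exact: continuous_cos.
rewrite Rintegral_cos mulr0 addr0 Rintegral_cst2pi => H1 H2.
have := le_trans H2 H1; rewrite ler_pM2l ?mulr_gt0 ?pi_gt0// /c /w.
have : 0 < e * d ^+ 2 by rewrite mulr_gt0// exprn_gt0.
by rewrite mulrDr; move: (cmean x0) (e * d ^+ 2) (e * x0 ^+ 2) => A X Y; lra.
Qed.

End CircleMeans.

(** * From extremality to a bound on the circle means *)

Section MeanBound.
Context {R : realType}.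
Local Notation mu := (@lebesgue_measure R).

(** Young's inequality for x^t and 1 with exponents 1/t and 1/(1-t). *)
Lemma powR_concave_tangent (x t : R) : 0 <= x -> 0 <= t < 1 -> x `^ t <= 1 + t * (x - 1).
Proof.
move=> x0 /andP[t0 t1].
move: t0; rewrite le_eqVlt => /predU1P[<-|t0]; first by rewrite powRr0; lra.
have t1' : 0 < 1 - t by lra.
have H := @conjugate_powR R (x `^ t) 1 t^-1 (1 - t)^-1 (powR_ge0 _ _) ler01.
rewrite !invr_gt0 !invrK in H; have := H t0 t1' _.
rewrite -powRrM divff ?gt_eqF// powRr1// powR1 mulr1 mul1r.
have -> : t + (1 - t) = 1 by lra.
by move=> /(_ erefl); lra.
Qed.

(** The exponent 2/p - 1 has either sign. If t < 0 this is the concave tangent at 1/x > 1; if t >=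
    0, X + 1/X >= 2 with X = x^t reduces 1 - X to 1/X - 1. *)
Lemma dist1_powR (x t : R) : 0 < x -> x < 1 -> `|t| < 1 -> `|1 - x `^ t| <= `|t| * (1 - x) / x.
Proof.
move=> x0 x1 t1.
have xV0 : 0 <= x^-1 by rewrite invr_ge0 ltW.
have E : `|t| * (1 - x) / x = `|t| * (x^-1 - 1) by field; rewrite gt_eqF.
have H : x^-1 `^ `|t| <= 1 + `|t| * (x^-1 - 1).
  by apply: powR_concave_tangent; rewrite ?normr_ge0.
have V1 : 1 <= x^-1 `^ `|t|.
  have x1' : 1 <= x^-1 by rewrite invf_ge1// ltW.
  by rewrite -(powRr0 x^-1) ler_powR.
rewrite E; have [t0|t0] := leP 0 t.
  rewrite (ger0_norm t0) in H V1 *.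
  have XV : x^-1 `^ t = (x `^ t)^-1 by rewrite -powR_inv1 ?ltW// -powRrM mulN1r powRN.
  have X0 : 0 < x `^ t by exact: powR_gt0.
  rewrite XV in H V1.
  have X1 : x `^ t <= 1 by rewrite -invf_ge1.
  rewrite ger0_norm ?subr_ge0//.
  have : 1 - x `^ t <= (x `^ t)^-1 - 1.
    move: (x `^ t) X0 X1 => X X0 X1.
    have : 0 <= (1 - X) ^+ 2 / X by rewrite divr_ge0 ?sqr_ge0// ltW.
    have -> : (1 - X) ^+ 2 / X = X^-1 - 2 + X by field; rewrite gt_eqF.
    lra.
  lra.
have XV : x^-1 `^ `|t| = x `^ t.
  by rewrite -powR_inv1 ?ltW// -powRrM mulN1r ltr0_norm// opprK.
rewrite XV in H V1.
by rewrite ler0_norm ?subr_le0//; lra.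
Qed.

Lemma Rintegral_id (a b : R) : a <= b -> \int[mu]_(r in `[a, b]) r = (b ^+ 2 - a ^+ 2) / 2.
Proof.
rewrite le_eqVlt => /predU1P[->|ab]; first by rewrite set_itv1 Rintegral_set1 subrr mul0r.
have c2 : continuous (fun x : R => x ^+ 2 / 2).
  by move=> x; apply: cvgMl; exact: exprn_continuous.
rewrite /Rintegral (@continuous_FTC2 _ id (fun x => x ^+ 2 / 2))//.
- by rewrite -EFinB/=; field.
- by apply: continuous_subspaceT => x; exact: cvg_id.
- split=> [x _||].
  + exact: ex_derive.
  + by apply: cvg_at_right_filter; exact: c2.
  + by apply: cvg_at_left_filter; exact: c2.
- move=> x _; rewrite derive1E; have H : is_derive x (1 : R) (fun x : R => x ^+ 2 / 2) x.
    by apply: is_derive_eq; rewrite /GRing.scale/=; field.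
  by rewrite derive_val.
Qed.

Lemma integrable_id_itv (a b : R) : mu.-integrable `[a, b] (EFin \o (fun r : R => r)).
Proof.
apply: continuous_compact_integrable; first exact: segment_compact.
by apply: continuous_subspaceT => x; exact: cvg_id.
Qed.

Lemma Rintegral_id_oo (b : R) : 0 <= b -> \int[mu]_(r in `]0, b[) r = b ^+ 2 / 2.
Proof.
move=> b0; rewrite Rintegral_itv_bndo_bndc ?Rintegral_itv_obnd_cbnd ?Rintegral_id//.
- by rewrite expr0n/= subr0.
- by apply: integrableS (integrable_id_itv 0 b) => //; exact: subset_itv_oc_cc.
- by apply: integrableS (integrable_id_itv 0 b) => //; exact: subset_itv_oo_cc.
Qed.

Lemma Rintegral_id_co (a b : R) : a <= b -> \int[mu]_(r in `[a, b[) r = (b ^+ 2 - a ^+ 2) / 2.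
Proof.
move=> ab; rewrite Rintegral_itv_bndo_bndc ?Rintegral_id//.
by apply: integrableS (integrable_id_itv a b) => //; exact: subset_itv_co_cc.
Qed.

Lemma integrable_id_co (a b : R) : mu.-integrable `[a, b[ (EFin \o (fun r : R => r)).
Proof. by apply: integrableS (integrable_id_itv a b) => //; exact: subset_itv_co_cc. Qed.

Lemma integrable_id_oo (a b : R) : mu.-integrable `]a, b[ (EFin \o (fun r : R => r)).
Proof. by apply: integrableS (integrable_id_itv a b) => //; exact: subset_itv_oo_cc. Qed.

Lemma integrableZ_itv (i : interval R) (B : R) (h : R -> R) :
  mu.-integrable [set` i] (EFin \o h) -> mu.-integrable [set` i] (EFin \o (fun r => B * h r)).
Proof.
move=> hi; have mI : measurable ([set` i] : set (measurableTypeR R)) by exact: measurable_itv.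
by have := integrableZl mI B hi; apply: eq_integrable => // r _; rewrite /= EFinM.
Qed.

Lemma Rintegral_split (h : R -> R) (c : R) : 0 < c -> c < 1 ->
  mu.-integrable `]0, 1[ (EFin \o h) ->
  \int[mu]_(r in `]0, 1[) h r = \int[mu]_(r in `]0, c[) h r + \int[mu]_(r in `[c, 1[) h r.
Proof.
move=> c0 c1 hi.
rewrite (@itv_bndbnd_setU _ _ _ (BLeft c)) ?bnd_simp ?ltW//.
rewrite Rintegral_setU//.
  by rewrite -itv_bndbnd_setU ?bnd_simp ?ltW.
apply/disj_setPS => y [/=]; rewrite !in_itv/= => /andP[_ yx] /andP[].
by rewrite leNgt yx.
Qed.

(** The argument now concerns two real functions: [m] stands for the circle means of |f*|^p and [b]
    for the circle pairings of f* with g. [bm] is Holder's inequality, with any positive A bounding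
    the p-mean, and [ext] is what testing dilations gives. *)
Variables (p G Phi : R) (m b : R -> R).
Hypotheses (p1 : 1 < p) (G0 : 0 < G) (Phi0 : 0 < Phi).
Hypothesis m0 : forall r, 0 <= m r.
Hypothesis m_nd : forall r s, 0 <= r -> r <= s -> s < 1 -> m r <= m s.
Hypothesis mi : mu.-integrable `]0, 1[ (EFin \o (fun r => r * m r)).
Hypothesis bi : mu.-integrable `]0, 1[ (EFin \o (fun r => r * b r)).
Hypothesis bm : forall r A, 0 < r -> r < 1 -> 0 < A -> m r <= 2 * pi * A `^ p ->
  `|b r| <= 2 * pi * A * G.
Hypothesis ext : forall rho k, 0 < rho -> rho < 1 -> 0 < k -> k ^+ 2 = rho ->
  Phi / p * (\int[mu]_(r in `]0, 1[) (r * m r) - \int[mu]_(r in `]0, rho[) (r * m r)) <=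
  \int[mu]_(r in `]0, 1[) (r * b r) - rho `^ (2 / p - 1) * \int[mu]_(r in `]0, k[) (r * b r).

Let p0 : 0 < p. Proof. exact: lt_trans ltr01 p1. Qed.
Let a := 2 / p - 1.
Let pi2 : 0 < 2 * pi :> R. Proof. by rewrite mulr_gt0// pi_gt0. Qed.

Let a1 : `|a| < 1.
Proof.
have : 0 < 2 / p by rewrite divr_gt0.
have : 2 / p < 2 by rewrite ltr_pdivrMr// ltr_pMr.
by rewrite /a ltr_norml => ? ?; apply/andP; split; lra.
Qed.

Let mi_co c : 0 < c -> mu.-integrable `[c, 1[ (EFin \o (fun r => r * m r)).
Proof. by move=> c0; apply: integrableS mi => //; apply: subset_itvr; rewrite bnd_simp. Qed.

Let bi_co c : 0 < c -> mu.-integrable `[c, 1[ (EFin \o (fun r => r * b r)).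
Proof. by move=> c0; apply: integrableS bi => //; apply: subset_itvr; rewrite bnd_simp. Qed.

Let bi_oo c : c <= 1 -> mu.-integrable `]0, c[ (EFin \o (fun r => r * b r)).
Proof. by move=> c0; apply: integrableS bi => //; apply: subset_itvl; rewrite bnd_simp. Qed.

(** With S the integral of r b over ]0, k[ and T the one over [k, 1[, the right side of [ext] is T +
    (1 - rho^a) S. T lives on a thin annulus and the factor of S is O(1 - rho), so both sides are of
    order 1 - rho. *)
Let ext' rho k : 0 < rho -> rho < 1 -> 0 < k -> k ^+ 2 = rho ->
  Phi / p * (\int[mu]_(r in `[rho, 1[) (r * m r)) <=
  `|\int[mu]_(r in `[k, 1[) (r * b r)| +
  `|a| * (1 - rho) / rho * `|\int[mu]_(r in `]0, k[) (r * b r)|.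
Proof.
move=> r0 r1 k0 kr; have k1 : k < 1 by rewrite -(@expr_lt1 _ 2)// ?kr// ltW.
have := ext r0 r1 k0 kr.
rewrite (Rintegral_split r0 r1 mi) (Rintegral_split k0 k1 bi) -/a.
rewrite addrAC subrr add0r => H; apply: (le_trans H).
set S := \int[mu]_(r in `]0, k[) (r * b r); set T := \int[mu]_(r in `[k, 1[) (r * b r).
have -> : S + T - rho `^ a * S = T + (1 - rho `^ a) * S by ring.
apply: (le_trans (ler_norm _)); apply: (le_trans (ler_normD _ _)).
by rewrite lerD2l normrM; apply: ler_wpM2r => //; exact: dist1_powR.
Qed.

Let normT c k h : 0 < c -> c < 1 -> mu.-integrable `[c, 1[ (EFin \o (fun r => r * k r)) ->
   (forall r, c <= r -> r < 1 -> `|k r| <= h r) ->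
   mu.-integrable `[c, 1[ (EFin \o (fun r => r * h r)) ->
   `|\int[mu]_(r in `[c, 1[) (r * k r)| <= \int[mu]_(r in `[c, 1[) (r * h r).
Proof.
move=> c0 c1 ik kh ih; apply: (le_trans (le_normr_Rintegral _ ik)) => //.
apply: le_Rintegral => //; first exact: integrable_norm ik.
move=> r; rewrite /= in_itv/= => /andP[cr r1]; rewrite normrM gtr0_norm; last exact: lt_le_trans cr.
by apply: ler_wpM2l; [exact: le_trans (ltW c0) cr|exact: kh].
Qed.

Let normS c k (B : R) : 0 < c -> c < 1 -> mu.-integrable `]0, c[ (EFin \o (fun r => r * k r)) ->
   (forall r, 0 < r -> r < c -> `|k r| <= B) ->
   `|\int[mu]_(r in `]0, c[) (r * k r)| <= B * (c ^+ 2 / 2).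
Proof.
move=> c0 c1 ik kh; apply: (le_trans (le_normr_Rintegral _ ik)) => //.
rewrite -(Rintegral_id_oo (ltW c0)) -RintegralZl//; last exact: integrable_id_oo.
apply: le_Rintegral => //; first exact: integrable_norm ik.
  exact: (integrableZ_itv B (integrable_id_oo 0 c)).
move=> r; rewrite /= in_itv/= => /andP[cr r1]; rewrite normrM gtr0_norm// mulrC.
by apply: ler_wpM2r; [exact: ltW|exact: kh].
Qed.

Let mlow c : 0 < c -> c < 1 -> m c * ((1 - c ^+ 2) / 2) <= \int[mu]_(r in `[c, 1[) (r * m r).
Proof.
move=> c0 c1; rewrite -[X in (X - _)](expr1n R 2) -(Rintegral_id_co (ltW c1)) -RintegralZl//; last exact: integrable_id_co.
apply: le_Rintegral => //; last first.
- move=> r; rewrite /= in_itv/= => /andP[cr r1]; rewrite mulrC.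
  by apply: ler_wpM2l; [exact: le_trans (ltW c0) cr|apply: m_nd => //; exact: ltW].
- exact: mi_co.
- exact: (integrableZ_itv (m c) (integrable_id_co c 1)).
Qed.

Let sqr_root (rho : R) : 0 < rho -> rho < 1 -> exists k : R, [/\ 0 < k, k < 1, k ^+ 2 = rho & rho <= k].
Proof.
move=> r0 r1; exists (Num.sqrt rho).
have k0 : 0 < Num.sqrt rho by rewrite sqrtr_gt0.
have kr : Num.sqrt rho ^+ 2 = rho by rewrite sqr_sqrtr// ltW.
have k1 : Num.sqrt rho < 1 by rewrite -(@expr_lt1 _ 2)// ?kr// ltW.
by split => //; rewrite -{1}kr expr2 ger_pMl// ltW.
Qed.

(* [ext'] with rho -> 1, using [|b| <= 2 pi A G] and [m rho >= m r]. *)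
Lemma mean_improve A : 0 < A -> (forall r, 0 < r -> r < 1 -> m r <= 2 * pi * A `^ p) ->
  forall r, 0 < r -> r < 1 -> m r <= 2 * pi * A * (Num.max (p - 1) 1 * G / Phi).
Proof.
move=> A0 mA r r0 r1.
have b_le s : 0 < s -> s < 1 -> `|b s| <= 2 * pi * A * G by move=> s0 s1; apply: bm => //; exact: mA.
(* As k^2 = rho, both terms on the right carry the factor (1 - rho)/2. On the left the mass of [rho,
   1[ is (1 - rho)(1 + rho)/2, and dividing leaves 1 + rho. *)
have key rho : r <= rho -> rho < 1 -> Phi / p * m r * (1 + rho) <= 2 * pi * A * G * (1 + `|a|).
  move=> rr rho1; have rho0 : 0 < rho by exact: lt_le_trans rr.
  have [k [k0 k1 kr rk]] := sqr_root rho0 rho1.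
  have E := ext' rho0 rho1 k0 kr.
  have T : `|\int[mu]_(r in `[k, 1[) (r * b r)| <= 2 * pi * A * G * ((1 - k ^+ 2) / 2).
    rewrite -[X in (X - _)](expr1n R 2) -(Rintegral_id_co (ltW k1)) -RintegralZl//; last exact: integrable_id_co.
    have I : mu.-integrable `[k, 1[ (EFin \o (fun r => r * (2 * pi * A * G))).
      rewrite (_ : (fun r => r * _) = (fun r => 2 * pi * A * G * r)); last by apply/funext => s; rewrite mulrC.
      exact: integrableZ_itv (integrable_id_co k 1).
    apply: le_trans (normT k0 k1 (bi_co k0) _ I) _.
      by move=> s ks s1; apply: b_le => //; exact: lt_le_trans ks.
    by rewrite le_eqVlt; apply/orP; left; apply/eqP; apply: eq_Rintegral => s _; rewrite mulrC.
  have S : `|\int[mu]_(r in `]0, k[) (r * b r)| <= 2 * pi * A * G * (k ^+ 2 / 2).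
    apply: normS => //; first by apply: bi_oo; exact: ltW.
    by move=> s s0 sk; apply: b_le => //; exact: lt_trans k1.
  have L := mlow rho0 rho1.
  have mm : m r <= m rho by apply: m_nd => //; exact: ltW.
  have Php : 0 < Phi / p by rewrite divr_gt0.
  have aa : 0 <= `|a| * (1 - rho) / rho.
    by rewrite divr_ge0 ?mulr_ge0//; [rewrite subr_ge0 ltW|exact: ltW].
  have S' := ler_wpM2l aa S.
  rewrite kr in T S'.
  have E2 : `|a| * (1 - rho) / rho * (2 * pi * A * G * (rho / 2)) = 2 * pi * A * G * `|a| * (1 - rho) / 2.
    by field; rewrite gt_eqF.
  rewrite E2 in S'.
  have L' : m r * ((1 - rho ^+ 2) / 2) <= \int[mu]_(r in `[rho, 1[) (r * m r).
    apply: le_trans L; apply: ler_wpM2r => //.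
    have r2 : rho ^+ 2 <= 1 by rewrite expr_le1 ?ltW.
    by rewrite divr_ge0// subr_ge0.
  have L'' := ler_wpM2l (ltW Php) L'.
  have r10 : 0 < (1 - rho) / 2 by rewrite divr_gt0// subr_gt0.
  rewrite -(ler_pM2l r10).
  have -> : (1 - rho) / 2 * (Phi / p * m r * (1 + rho)) = Phi / p * (m r * ((1 - rho ^+ 2) / 2)).
    by field; rewrite gt_eqF.
  apply: (le_trans L''); apply: (le_trans E); apply: (le_trans (lerD T S')).
  by rewrite le_eqVlt; apply/orP; left; apply/eqP; field.
have key1 : Phi / p * m r * 2 <= 2 * pi * A * G * (1 + `|a|).
  set X := Phi / p * m r in key *; set Y := 2 * pi * A * G * (1 + `|a|) in key *.
  have X0 : 0 <= X by rewrite mulr_ge0 ?m0 ?divr_ge0 ?(ltW Phi0) ?(ltW p0).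
  apply/ler_addgt0Pr => e e0.
  (* An explicit form of rho -> 1: replacing 1 + rho by 2 costs at most X e/(X + 1) <= e. *)
  pose rho := Num.max r (1 - e / (X + 1)).
  have X1 : 0 < X + 1 by rewrite ltr_wpDl.
  have rho1 : rho < 1 by rewrite gt_max r1 ltrBlDr ltrDl divr_gt0.
  have rhor : r <= rho by rewrite le_max lexx.
  have := key rho rhor rho1.
  have : 1 - e / (X + 1) <= rho by rewrite le_max lexx orbT.
  have : X * (e / (X + 1)) <= e.
    by rewrite mulrCA ger_pMr// ler_pdivrMr// mul1r lerDl.
  move: (e / (X + 1)) (rho) => d rh H1 H2 H3.
  have := ler_wpM2l X0 H2; nra.
(* the origin of the constant max(p-1,1) *)
have aE : Num.max (p - 1) 1 = p / 2 * (1 + `|a|).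
  have [p2|p2] := leP 2 p.
    rewrite max_l; last by lra.
    have : 2 / p <= 1 by rewrite ler_pdivrMr// mul1r.
    by rewrite /a => a0; rewrite ler0_norm; [field; rewrite gt_eqF|lra].
  rewrite max_r; last by lra.
  have : 1 <= 2 / p by rewrite ler_pdivlMr// mul1r ltW.
  by rewrite /a => a0; rewrite ger0_norm; [field; rewrite gt_eqF|lra].
rewrite aE.
have Php : 0 < Phi / p * 2 by rewrite mulr_gt0// divr_gt0.
rewrite -(ler_pM2l Php).
have -> : Phi / p * 2 * (2 * pi * A * (p / 2 * (1 + `|a|) * G / Phi)) = 2 * pi * A * G * (1 + `|a|).
  by field; rewrite !gt_eqF.
by rewrite mulrAC.
Qed.

Let root_pos x : 0 <= x -> ((x / (2 * pi)) `^ p^-1) `^ p = x / (2 * pi).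
Proof.
by move=> x0; rewrite -powRrM mulVf ?gt_eqF// powRr1// divr_ge0// ltW.
Qed.

Let le_root r s : 0 < r -> r <= s -> s < 1 -> (m r / (2 * pi)) `^ p^-1 <= (m s / (2 * pi)) `^ p^-1.
Proof.
move=> r0 rs s1; apply: ge0_ler_powR; rewrite ?nnegrE ?divr_ge0 ?invr_ge0 ?(ltW p0) ?(ltW pi2)//.
by rewrite ler_pM2r ?invr_gt0//; apply: m_nd => //; exact: ltW.
Qed.

Let powR_pred x : 0 < x -> x `^ (p - 1) * x = x `^ p.
Proof.
move=> x0; rewrite -{2}(powRr1 (ltW x0)) -powRD ?subrK//.
by apply/implyP => _; rewrite gt_eqF.
Qed.

Let p10 : 0 < p - 1. Proof. by rewrite subr_gt0. Qed.

Let powR_pred_le x K : 0 < x -> 0 <= K -> x `^ (p - 1) <= K -> x `^ p <= K `^ (p / (p - 1)).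
Proof.
move=> x0 K0 xK.
have -> : x `^ p = (x `^ (p - 1)) `^ (p / (p - 1)).
  by rewrite -powRrM mulrCA divff ?mulr1// gt_eqF.
by apply: ge0_ler_powR; rewrite ?nnegrE ?divr_ge0 ?powR_ge0 ?(ltW p0) ?(ltW p10).
Qed.

(* A priori bound: with [root = (m / 2pi)^(1/p)], monotonicity turns
   [root t] into [root t ^ p / root r ^ (p-1)] for [r <= t], so that [b] is dominated
   by a multiple of [m] and [int m] cancels in [ext']. *)
Lemma mean_bounded r : 0 < r -> r < 1 -> m r <= 2 * pi * (2 * p * G / Phi) `^ (p / (p - 1)).
Proof.
move=> r0 r1; pose root s := (m s / (2 * pi)) `^ p^-1.
have root_p s : root s `^ p = m s / (2 * pi) by exact: root_pos.
have [k [k0 k1 kr rk]] := sqr_root r0 r1.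
have B0 : 0 <= 2 * p * G / Phi by rewrite divr_ge0 ?mulr_ge0 ?(ltW p0) ?(ltW G0) ?(ltW Phi0).
have [mr0|mr0] := eqVneq (m r) 0.
  by rewrite mr0 mulr_ge0 ?(ltW pi2)// powR_ge0.
have mrp : 0 < m r by rewrite lt_neqAle eq_sym mr0 m0.
have y0 : 0 < root r by rewrite powR_gt0// divr_gt0.
pose z := root r `^ (p - 1).
have z0 : 0 < z by exact: powR_gt0.
suff zB : z <= 2 * p * G / Phi.
  have := powR_pred_le y0 B0 zB; rewrite root_p ler_pdivrMr// mulrC//.
(* Used with t = s on [k, 1[, where it bounds b pointwise by m, and with t = k on ]0, k[, where it
   is a constant bound. *)
have b_le s t : r <= t -> 0 < s -> s <= t -> t < 1 -> `|b s| <= G / z * m t.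
  move=> rt s0 st t1.
  have yt : root r <= root t by exact: le_root.
  have t0 : 0 < root t by exact: lt_le_trans yt.
  have mst : m s <= m t by apply: m_nd => //; exact: ltW.
  have mt : m s <= 2 * pi * root t `^ p by rewrite root_p mulrCA divff ?mulr1// gt_eqF.
  apply: (le_trans (bm s0 (le_lt_trans st t1) t0 mt)).
  have zt : z * root t <= m t / (2 * pi).
    rewrite -root_p -(powR_pred t0); apply: ler_wpM2r; first exact: ltW.
    by apply: ge0_ler_powR; rewrite ?nnegrE ?(ltW p10) ?(ltW y0) ?(ltW t0).
  rewrite -(ler_pM2l z0).
  have -> : z * (G / z * m t) = 2 * pi * G * (m t / (2 * pi)).
    have zn : z != 0 by rewrite gt_eqF.
    have pn : pi != 0 :> R by rewrite gt_eqF// pi_gt0.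
    have gen (P x : R) : P != 0 -> z * (G / z * x) = 2 * P * G * (x / (2 * P)).
      by move=> Pn; field; rewrite zn Pn.
    exact: gen.
  have -> : z * (2 * pi * root t * G) = 2 * pi * G * (z * root t) by ring.
  by apply: ler_wpM2l => //; rewrite mulr_ge0 ?(ltW pi2) ?(ltW G0).
have E := ext' r0 r1 k0 kr.
set Ir := \int[mu]_(r in `[r, 1[) (r * m r) in E.
pose Ik := \int[mu]_(r in `[k, 1[) (r * m r).
have T : `|\int[mu]_(r in `[k, 1[) (r * b r)| <= G / z * Ik.
  rewrite -RintegralZl//; last exact: mi_co.
  have EQ : (fun s => G / z * (s * m s)) = (fun s => s * (G / z * m s)) by apply/funext => s; ring.
  rewrite EQ; apply: normT => //; first exact: bi_co.
    by move=> s ks s1; apply: b_le => //; [exact: le_trans ks|exact: lt_le_trans ks].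
  by rewrite -EQ; apply: integrableZ_itv; exact: mi_co.
have S : `|\int[mu]_(r in `]0, k[) (r * b r)| <= G / z * m k * (k ^+ 2 / 2).
  apply: normS => //; first by apply: bi_oo; exact: ltW.
  by move=> s s0 sk; apply: b_le => //; exact: ltW.
have Lk : m k * ((1 - k ^+ 2) / 2) <= Ik by exact: mlow.
have Lr : m r * ((1 - r ^+ 2) / 2) <= Ir by exact: mlow.
have IkIr : Ik <= Ir.
  have US : `[r, 1[%classic = `[r, k[%classic `|` `[k, 1[%classic :> set R.
    by rewrite -itv_bndbnd_setU ?bnd_simp// ltW.
  rewrite /Ir US Rintegral_setU//.
  - rewrite lerDr; apply: Rintegral_ge0 => s; rewrite /= in_itv/= => /andP[rs _].
    by rewrite mulr_ge0// (le_trans (ltW r0)).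
  - by rewrite -US; exact: mi_co.
  - apply/disj_setPS => y [/=]; rewrite !in_itv/= => /andP[_ yx] /andP[].
    by rewrite leNgt yx.
have Gz : 0 <= G / z by rewrite divr_ge0 ?ltW.
(* The weight (1 - r)/r times the mass k^2/2 = r/2 of ]0, k[ equals the mass (1 - k^2)/2 of [k, 1[,
   so this term is controlled by [Ik] as well. *)
have S' : `|a| * (1 - r) / r * `|\int[mu]_(r in `]0, k[) (r * b r)| <= G / z * Ik.
  apply: le_trans (ler_wpM2l Gz Lk).
  rewrite kr in S *.
  have q0 : 0 <= (1 - r) / r by rewrite divr_ge0 ?subr_ge0 ?ltW.
  have := ler_wpM2l q0 S.
  have -> : (1 - r) / r * (G / z * m k * (r / 2)) = G / z * (m k * ((1 - r) / 2)).
    by field; rewrite !gt_eqF.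
  apply: le_trans; rewrite -[X in X * _](mulrA `|a|) -(mulrA `|a|).
  by apply: ler_piMl; [rewrite mulr_ge0|exact: ltW].
have Ir0 : 0 < Ir.
  apply: lt_le_trans Lr; rewrite mulr_gt0// divr_gt0// subr_gt0.
  by rewrite expr_lt1// ltW.
(* [Ir] is finite and positive, so it cancels and leaves Phi/p <= 2G/z. *)
have F : Phi / p * Ir <= 2 * (G / z) * Ir.
  apply: (le_trans E); apply: (le_trans (lerD T S')).
  have := ler_wpM2l Gz IkIr; lra.
move: F; rewrite ler_pM2r// => F.
rewrite ler_pdivlMr//.
have zp : 0 <= z * p by rewrite mulr_ge0 ?ltW.
have := ler_wpM2l zp F.
have -> : z * p * (Phi / p) = z * Phi by field; rewrite gt_eqF.
have -> // : z * p * (2 * (G / z)) = 2 * p * G by field; rewrite gt_eqF.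
Qed.

(** [mean_bounded] makes the supremum S of (m / 2pi)^(1/p) finite; [mean_improve] with A = S gives
    S^p <= S K, and S can be divided out. *)
Lemma mean_bound r : 0 < r -> r < 1 ->
  m r <= 2 * pi * (Num.max (p - 1) 1 * G / Phi) `^ (p / (p - 1)).
Proof.
move=> r0 r1; pose root s := (m s / (2 * pi)) `^ p^-1.
set K := Num.max (p - 1) 1 * G / Phi.
have K0 : 0 < K by rewrite /K divr_gt0// mulr_gt0// lt_max ltr01 orbT.
have root_p s : root s `^ p = m s / (2 * pi) by exact: root_pos.
pose E := [set root s | s in `]0, 1[].
pose B := 2 * p * G / Phi.
have ubE : ubound E ((B `^ (p / (p - 1))) `^ p^-1).
  apply/ubP => x [s /=]; rewrite in_itv/= => /andP[s0 s1] <-.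
  apply: ge0_ler_powR; rewrite ?nnegrE ?divr_ge0 ?powR_ge0 ?invr_ge0 ?(ltW p0) ?(ltW pi2)//.
  by rewrite ler_pdivrMr// mulrC mean_bounded.
have supE : has_sup E.
  by split; [exists (root r), r => //=; rewrite in_itv/= r0|exists ((B `^ (p / (p - 1))) `^ p^-1)].
have leS s : 0 < s -> s < 1 -> root s <= sup E.
  by move=> s0 s1; apply: (ub_le_sup supE.2); exists s => //=; rewrite in_itv/= s0.
(* [mean_improve] requires A > 0; if S = 0 then [m r] vanishes. *)
have [S0|S0] := leP (sup E) 0.
  have rr0 : root r = 0.
    by apply/eqP; rewrite eq_le powR_ge0 andbT (le_trans _ S0)// leS.
  have := root_p r; rewrite rr0 powR0 ?gt_eqF// => /esym/eqP.
  rewrite mulf_eq0 invr_eq0 [2 * pi == 0]gt_eqF// orbF => /eqP ->.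
  by rewrite mulr_ge0 ?(ltW pi2)// powR_ge0.
have mS s : 0 < s -> s < 1 -> m s <= 2 * pi * sup E `^ p.
  move=> s0 s1; rewrite -ler_pdivrMl// mulrC -root_p.
  by apply: ge0_ler_powR; rewrite ?nnegrE ?powR_ge0 ?(ltW p0) ?(ltW S0)// leS.
have SK : sup E `^ p <= sup E * K.
  have : sup E <= (sup E * K) `^ p^-1.
    apply: ge_sup; first exact: supE.1.
    apply/ubP => x [s /=]; rewrite in_itv/= => /andP[s0 s1] <-.
    apply: ge0_ler_powR; rewrite ?nnegrE ?divr_ge0 ?invr_ge0 ?(ltW p0) ?(ltW pi2)//.
      by rewrite mulr_ge0 ?ltW.
    by rewrite ler_pdivrMr// mulrC mulrA; apply: (mean_improve S0).
  move=> H; have SK0 : 0 <= sup E * K by rewrite mulr_ge0 ?ltW.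
  have -> : sup E * K = ((sup E * K) `^ p^-1) `^ p.
    by rewrite -powRrM mulVf ?gt_eqF// powRr1.
  by apply: ge0_ler_powR; rewrite ?nnegrE ?powR_ge0 ?(ltW p0) ?(ltW S0).
apply: (le_trans (mS _ r0 r1)); apply: ler_wpM2l; first exact: ltW.
apply: powR_pred_le => //; first exact: ltW.
by rewrite -(ler_pM2r S0) powR_pred// mulrC.
Qed.

End MeanBound.

(** * Hardy and Bergman norms as radial integrals *)

Section HolderOnCircles.
Context {R : realType}.
Local Notation mu := (@lebesgue_measure R).
Local Notation N := (@ComplexField.Normc.normc R).
Implicit Types (f g D E : R[i] -> R[i]).

Definition re_pair f g (u : R * R) : R :=
  complex.Re (f (to_complex u) * conjc (g (to_complex u))).

Lemma re_pairE f g u : re_pair f g u =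
  complex.Re (f (to_complex u)) * complex.Re (g (to_complex u)) +
  complex.Im (f (to_complex u)) * complex.Im (g (to_complex u)).
Proof. by rewrite /re_pair; case: (f _) => a b; case: (g _) => c d /=; ring. Qed.

Lemma cont_disc_re_pair f g D E : holo f D -> holo g E -> cont_disc (re_pair f g).
Proof.
move=> fD gE u Du.
have c1 : {for u, continuous (fun w : R * R => w.1)} by exact: cvg_fst.
have c2 : {for u, continuous (fun w : R * R => w.2)} by exact: cvg_snd.
have ncf := holo_ncont fD Du; have ncg := holo_ncont gE Du.
have Rf := ncont_Re c1 c2 ncf; have If := ncont_Im c1 c2 ncf.
have Rg := ncont_Re c1 c2 ncg; have Ig := ncont_Im c1 c2 ncg.
have -> : re_pair f g = fun w => complex.Re (f (w.1 +i* w.2)) * complex.Re (g (w.1 +i* w.2)) +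
  complex.Im (f (w.1 +i* w.2)) * complex.Im (g (w.1 +i* w.2)).
  by apply/funext => w; rewrite re_pairE.
by apply: cvgD; apply: cvgM.
Qed.

Lemma norm_re_pair_le f g u : `|re_pair f g u| <= N (f (to_complex u)) * N (g (to_complex u)).
Proof.
apply: (le_trans (ler_Re_normc _)); rewrite ComplexField.Normc.normcM.
by have -> : N (conjc (g (to_complex u))) = N (g (to_complex u))
  by rewrite !normc_sqrt; case: (g _) => a b /=; rewrite sqrrN.
Qed.

(** Holder's inequality by integrating Young's inequality for |f|/A and |g|/G. Since A and G are
    only upper bounds for the means, no mean has to be nonzero. *)
Lemma circ_norm_re_pair f g D E (p q A G r : R) : holo f D -> holo g E ->
  1 < p -> 1 < q -> p^-1 + q^-1 = 1 -> 0 < A -> 0 < G -> `|r| < 1 ->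
  cmean f p r <= 2 * pi * A `^ p -> cmean g q r <= 2 * pi * G `^ q ->
  circ (fun u => `|re_pair f g u|) r <= 2 * pi * A * G.
Proof.
move=> fD gE p1 q1 pq A0 G0 r1 fA gG.
have p0 : 0 < p by exact: lt_trans ltr01 p1.
have q0 : 0 < q by exact: lt_trans ltr01 q1.
have cp := cont_disc_powN fD p1; have cq := cont_disc_powN gE q1.
have ck := cont_disc_norm (cont_disc_re_pair fD gE).
(* Weights of Young's inequality after multiplication by A G; against the bounds on the means they
   contribute 2 pi A G / p and 2 pi A G / q. *)
pose cf := A * G / (p * A `^ p); pose cg := A * G / (q * G `^ q).
have Ap : 0 < A `^ p by exact: powR_gt0.
have Gq : 0 < G `^ q by exact: powR_gt0.
have cf0 : 0 < cf by rewrite divr_gt0 ?mulr_gt0.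
have cg0 : 0 < cg by rewrite divr_gt0 ?mulr_gt0.
have young u : `|re_pair f g u| <= cf * powN f p (to_complex u) + cg * powN g q (to_complex u).
  apply: (le_trans (norm_re_pair_le f g u)).
  set x := N _; set y := N _.
  have x0 : 0 <= x by exact: normc_ge0.
  have y0 : 0 <= y by exact: normc_ge0.
  have H := conjugate_powR (divr_ge0 x0 (ltW A0)) (divr_ge0 y0 (ltW G0)) p0 q0 pq.
  have AG : 0 < A * G by exact: mulr_gt0.
  have := ler_wpM2l (ltW AG) H.
  have -> : A * G * (x / A * (y / G)) = x * y by field; rewrite !gt_eqF.
  have pw s (a b : R) : 0 <= a -> 0 < b -> (a / b) `^ s = a `^ s / b `^ s.
    move=> a0 b0; rewrite powRM ?invr_ge0 ?(ltW b0)//; congr (_ * _).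
    by rewrite -powR_inv1 ?(ltW b0)// -powRrM mulN1r powRN.
  rewrite !pw//.
  have -> : A * G * (x `^ p / A `^ p / p + y `^ q / G `^ q / q) =
    cf * x `^ p + cg * y `^ q.
    by rewrite /cf /cg; field; rewrite !gt_eqF.
  by [].
have csum : cont_disc (fun u => cf * powN f p (to_complex u) + cg * powN g q (to_complex u)).
  by move=> u Du; apply: cvgD; apply: cvgMr; [exact: cp|exact: cq].
apply: (le_trans (ler_circ ck csum r1 (fun u _ => young u))).
have -> : circ (fun u => cf * powN f p (to_complex u) + cg * powN g q (to_complex u)) r =
   cf * cmean f p r + cg * cmean g q r.
  have c1 : cont_disc (fun u => cf * powN f p (to_complex u)) by move=> u Du; apply: cvgMr; exact: cp.
  have c2 : cont_disc (fun u => cg * powN g q (to_complex u)) by move=> u Du; apply: cvgMr; exact: cq.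
  have i1 := integrable_circ c1 r1; have i2 := integrable_circ c2 r1.
  rewrite /cmean -(circZ cf cp r1) -(circZ cg cq r1) /circ.
  by rewrite -(RintegralD _ i1 i2).
apply: (le_trans (lerD (ler_wpM2l (ltW cf0) fA) (ler_wpM2l (ltW cg0) gG))).
rewrite le_eqVlt; apply/orP; left; apply/eqP.
have -> : 2 * pi * A * G = (p^-1 + q^-1) * (2 * pi * A * G) by rewrite pq mul1r.
rewrite /cf /cg; move: (2 * pi) => P; field.
by rewrite !gt_eqF.
Qed.

Lemma circle_mean_cmean f D (s r : R) : holo f D -> 1 < s -> 0 < r -> r < 1 ->
  circle_mean s r f = (cmean f s r / (2 * pi))%:E.
Proof.
move=> fD s1 r0 r1; rewrite /circle_mean EFinM.
have r1' : `|r| < 1 by rewrite gtr0_norm.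
by rewrite /cmean -(EFin_circ (cont_disc_powN fD s1) r1') muleC.
Qed.

Lemma bergman_integral f D (s : R) : holo f D -> 1 < s ->
  (\int[sigma]_(u in disc_coord) ((N (f (to_complex u))) `^ s)%:E =
   (pi^-1)%:E * \int[mu]_(r in `]0%R, 1%R[) (r * cmean f s r)%:E)%E.
Proof.
move=> fD s1; apply: (ge0_integral_polar_circ (cont_disc_powN fD s1)) => u _.
exact: powN_ge0.
Qed.

Lemma Rintegral_scale (h : R -> R) (c : R) : 0 < c ->
  (forall r, 0 <= r <= c -> {for r, continuous h}) ->
  \int[mu]_(r in `]0, 1[) h (c * r) = c^-1 * \int[mu]_(r in `]0, c[) h r.
Proof.
move=> c0 hc.
have oc (k : R -> R) b : {within `[0, b], continuous k} ->
    \int[mu]_(r in `]0, b[) k r = \int[mu]_(r in `[0, b]) k r.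
  move=> kc; have i : mu.-integrable `[0, b] (EFin \o k).
    by apply: continuous_compact_integrable => //; exact: segment_compact.
  rewrite Rintegral_itv_bndo_bndc ?Rintegral_itv_obnd_cbnd//; first last.
    by apply: integrableS i => //; exact: subset_itv_oo_cc.
  by apply: integrableS i => //; exact: subset_itv_oc_cc.
have hw : {within `[0, c], continuous h}.
  by apply: continuous_in_subspaceT => r; rewrite inE/= in_itv/=; exact: hc.
have hcc r : 0 <= r <= 1 -> {for r, continuous (fun r => h (c * r))}.
  move=> /andP[r0 r1]; apply: (@continuous_comp _ _ _ (fun r => c * r) h).
    by apply: cvgMr; exact: cvg_id.
  by apply: hc; rewrite mulr_ge0 ?(ltW c0)//= ler_piMr// ltW.
have hcw : {within `[0, 1], continuous (fun r => h (c * r))}.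
  by apply: continuous_in_subspaceT => r; rewrite inE/= in_itv/=; exact: hcc.
rewrite (oc _ 1)// (oc h c)//.
have D x : is_derive x (1 : R) (fun r : R => c * r) c.
  by apply: is_derive_eq; rewrite /GRing.scale/=; ring.
have dl : (fun r : R => c * r)^`()%classic = cst c.
  by apply/funext => x; rewrite derive1E; have Dx := D x; rewrite derive_val.
have cl : continuous (fun r : R => c * r) by move=> x; apply: cvgMr; exact: cvg_id.
have := @integration_by_substitution_increasing R (fun r => c * r) h 0 1 ler01.
rewrite mulr0 mulr1 dl /Rintegral => -> //; first last.
- split.
  + by move=> x _; exact: ex_derive.
  + by apply: cvg_at_right_filter; exact: cl.
  + by apply: cvg_at_left_filter; exact: cl.
- exact: is_cvg_cst.
- exact: is_cvg_cst.
- by move=> x _; exact: cvg_cst.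
- by move=> x y _ _; rewrite ltr_pM2l.
rewrite -[RHS]/(c^-1 * \int[mu]_(r in `[0, 1]) (h (c * r) * c)) RintegralZr//.
  by rewrite mulrCA mulVf ?mulr1// gt_eqF.
by apply: continuous_compact_integrable => //; exact: segment_compact.
Qed.

End HolderOnCircles.

(** * Hardy norms through circle means, and their positivity *)

Section HardyBergman.
Context {R : realType}.
Local Notation mu := (@lebesgue_measure R).
Local Notation N := (@ComplexField.Normc.normc R).
Implicit Types (f g D E : R[i] -> R[i]).

Lemma hardy_cmean_le f D (s r : R) : holo f D -> 1 < s ->
  (hardy_norm s f < +oo)%E -> 0 < r -> r < 1 ->
  0 <= fine (hardy_norm s f) /\ cmean f s r <= 2 * pi * fine (hardy_norm s f) `^ s.
Proof.
move=> fD s1 hfin r0 r1; have s0 : 0 < s by exact: lt_trans s1.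
have P0 : 0 < 2 * pi :> R by rewrite mulr_gt0// pi_gt0.
pose M := cmean f s r / (2 * pi).
have M0 : 0 <= M by rewrite divr_ge0 ?cmean_ge0 ?(ltW P0).
have MH : ((M `^ s^-1)%:E <= hardy_norm s f)%E.
  rewrite -poweR_EFin -(circle_mean_cmean fD s1 r0 r1).
  by apply: ereal_sup_ubound; exists r => //=; rewrite in_itv/= r0.
have Hfin : hardy_norm s f \is a fin_num.
  by rewrite fin_numElt hfin andbT (lt_le_trans _ MH)// ltNyr.
have H : M `^ s^-1 <= fine (hardy_norm s f) by rewrite -lee_fin fineK.
have G0 : 0 <= fine (hardy_norm s f) by apply: le_trans H; exact: powR_ge0.
split=> //.
have -> : cmean f s r = 2 * pi * M by rewrite /M mulrCA mulfV ?mulr1 ?gt_eqF.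
apply: ler_wpM2l; first exact: ltW.
have -> : M = (M `^ s^-1) `^ s by rewrite -powRrM mulVf ?powRr1// gt_eqF.
by apply: ge0_ler_powR; rewrite ?nnegrE ?powR_ge0 ?(ltW s0).
Qed.

Lemma hardy_norm_le f D (s B : R) : holo f D -> 1 < s ->
  (forall r, 0 < r -> r < 1 -> cmean f s r <= 2 * pi * B) ->
  (hardy_norm s f <= (B `^ s^-1)%:E)%E.
Proof.
move=> fD s1 H; have s0 : 0 < s by exact: lt_trans s1.
have P0 : 0 < 2 * pi :> R by rewrite mulr_gt0// pi_gt0.
apply: ge_ereal_sup => _ [r /= + <-]; rewrite in_itv/= => /andP[r0 r1].
rewrite (circle_mean_cmean fD s1 r0 r1) poweR_EFin lee_fin.
have M0 : 0 <= cmean f s r / (2 * pi) by rewrite divr_ge0 ?cmean_ge0 ?(ltW P0).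
have MB : cmean f s r / (2 * pi) <= B by rewrite ler_pdivrMr// mulrC H.
by apply: ge0_ler_powR; rewrite ?nnegrE ?invr_ge0 ?(ltW s0) ?(le_trans M0).
Qed.

Lemma continuous_Rintegral_gt0 (h : R -> R) (a b c : R) : continuous h ->
  (forall t, 0 <= h t) -> a < c -> c < b -> 0 < h c ->
  0 < \int[mu]_(t in `[a, b]) h t.
Proof.
move=> hc h0 ac cb hc0.
have hc2 : h c / 2 < h c by rewrite ltr_pdivrMr// ltr_pMr// ltr1n.
have : \forall t \near c, h c / 2 < h t by exact: (cvgr_gt _ (hc c)).
move=> /nbhs_ballP[e /= e0 He].
pose d := Num.min (e / 2) (Num.min (c - a) (b - c)).
have d0 : 0 < d by rewrite !lt_min divr_gt0//= !subr_gt0 ac.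
have de : d < e by apply: (@le_lt_trans _ _ (e / 2)); rewrite ?ge_min ?lexx// ltr_pdivrMr// ltr_pMr// ltr1n.
have dac : d <= c - a by rewrite !ge_min lexx orbT.
have dbc : d <= b - c by rewrite !ge_min lexx !orbT.
have sub : `[c, c + d]%classic `<=` `[a, b]%classic.
  by apply: subset_itvScc; rewrite bnd_simp ?(ltW ac)// -lerBrDl.
have mI : measurable (`[c, c + d]%classic : set (measurableTypeR R)) by exact: measurable_itv.
have mJ : measurable (`[a, b]%classic : set (measurableTypeR R)) by exact: measurable_itv.
rewrite -lte_fin -EFin_Rintegral_itv//.
apply: (@lt_le_trans _ _ (\int[mu]_(t in `[c, (c + d)%R]) (h c / 2)%:E)%E).
  rewrite integral_cst//= lebesgue_measure_itv/= lte_fin ltrDl d0 -EFinD lte_fin addrAC subrr add0r.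
  by rewrite mulr_gt0// divr_gt0.
apply: (@le_trans _ _ (\int[mu]_(t in `[c, (c + d)%R]) (h t)%:E)%E).
  apply: ge0_le_integral => //.
  - by move=> t ?; rewrite lee_fin divr_ge0// ltW.
  - by apply/measurable_EFinP; apply: measurable_funTS; exact: continuous_measurable_fun.
  - move=> t; rewrite /= in_itv/= => /andP[ct tc]; rewrite lee_fin ltW//; apply: He.
    rewrite /ball/= distrC ger0_norm ?subr_ge0//; apply: le_lt_trans de.
    by rewrite lerBlDl.
apply: ge0_subset_integral => //.
- by apply/measurable_EFinP; apply: measurable_funTS; exact: continuous_measurable_fun.
- by move=> t _; rewrite lee_fin.
Qed.

(** For z != 0 the circle through z works, by continuity of |f|^s near z. For z = 0 that circle
    degenerates, and the sub-mean inequality at radius 1/2 is used. *)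
Lemma cmean_gt0 f D (s : R) (z : R[i]) : holo f D -> 1 < s ->
  unit_disc z -> f z != 0 -> exists r, [/\ 0 < r, r < 1 & 0 < cmean f s r].
Proof.
move=> fD s1 zD fz.
have P0 : 0 < 2 * pi :> R by rewrite mulr_gt0// pi_gt0.
have fzs : 0 < powN f s z.
  rewrite /powN powR_gt0// lt_neqAle normc_ge0 andbT eq_sym.
  by apply: contra_neq fz => /ComplexField.Normc.eq0_normc.
have [z0|z0] := eqVneq z 0.
  exists 2^-1; split; [by rewrite invr_gt0|by rewrite invf_lt1// ltr1n|].
  have c1 : N (0 : R[i]) + 2^-1 < 1 by rewrite ComplexField.Normc.normc0 add0r invf_lt1// ltr1n.
  have h0 : (0:R) <= 2^-1 by rewrite invr_ge0.
  rewrite cmeanE; apply: lt_le_trans (powN_submean fD s1 h0 c1).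
  by rewrite mulr_gt0// -z0.
exists (N z); split => //.
  rewrite lt_neqAle normc_ge0 andbT eq_sym.
  by apply: contra_neq z0 => /ComplexField.Normc.eq0_normc.
(* Starting the rotation at -z puts the point z at angle pi, in the interior of [0, 2 pi]. *)
have zN : N (- z) = N z by rewrite normcNE.
have zN1 : N (- z) < 1 by rewrite zN.
rewrite -zN -lte_fin -(cmean_rotate fD s1 zN1).
have hcont : continuous (fun t => powN f s (polar 1 t * - z)).
  have cc : continuous (@cos R) by exact: continuous_cos.
  have cs : continuous (@sin R) by exact: continuous_sin.
  have E w t : polar 1 t * w = (cos t * complex.Re w - sin t * complex.Im w)
      +i* (cos t * complex.Im w + sin t * complex.Re w).
    by case: w => x y; rewrite /polar !mul1r.
  have -> : (fun t => powN f s (polar 1 t * - z)) =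
    (fun t => powN f s ((cos t * complex.Re (- z) - sin t * complex.Im (- z))
      +i* (cos t * complex.Im (- z) + sin t * complex.Re (- z)))) by apply/funext => t; rewrite E.
  move=> t; apply: (@continuous_powN _ _ _ _ fD s1 _ (fun t => cos t * complex.Re (- z) - sin t * complex.Im (- z))
    (fun t => cos t * complex.Im (- z) + sin t * complex.Re (- z))).
  - by apply: cvgB; apply: cvgMl; [exact: cc|exact: cs].
  - by apply: cvgD; apply: cvgMl; [exact: cc|exact: cs].
  - have : N (polar 1 t * - z) < 1 by rewrite ComplexField.Normc.normcM zN normc_polar normr1 mul1r.
    by rewrite E.
rewrite EFin_Rintegral_itv// lte_fin; apply: (@continuous_Rintegral_gt0 _ 0 (2 * pi) pi) => //.
- by move=> t; exact: powN_ge0.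
- exact: pi_gt0.
- by rewrite ltr_pMl ?pi_gt0// ltr1n.
- by rewrite /polar cospi sinpi mulr0 mul1r -[_ +i* _]/((-1)%:C) rmorphN1 mulN1r opprK.
Qed.

End HardyBergman.

(** * Bergman norms and the pairing as radial integrals *)

Section BergmanMeans.
Context {R : realType}.
Local Notation mu := (@lebesgue_measure R).
Local Notation N := (@ComplexField.Normc.normc R).
Implicit Types (f g D E : R[i] -> R[i]).

Lemma measurable_r_cmean f D (s : R) : holo f D -> 1 < s ->
  measurable_fun (`]0, 1[%classic : set R) (fun r : R => r * cmean f s r).
Proof. by move=> fD s1; exact: measurable_r_circ (cont_disc_powN fD s1). Qed.

Lemma r_cmean_ge0 f (s r : R) : `]0, 1[%classic r -> 0 <= r * cmean f s r.
Proof.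
by rewrite /= in_itv/= => /andP[r0 _]; apply: mulr_ge0; [exact: ltW|exact: cmean_ge0].
Qed.

Lemma bergman_normE f D (s : R) : holo f D -> 1 < s ->
  mu.-integrable `]0, 1[ (EFin \o (fun r => r * cmean f s r)) ->
  bergman_norm s f = ((pi^-1 * \int[mu]_(r in `]0, 1[) (r * cmean f s r)) `^ s^-1)%:E.
Proof.
move=> fD s1 fi; rewrite /bergman_norm (bergman_integral fD s1) -poweR_EFin EFinM.
by rewrite /Rintegral fineK//; apply: integrable_fin_num => //; exact: measurable_itv.
Qed.

Lemma bergman_integrable f D (s : R) : holo f D -> 1 < s ->
  (bergman_norm s f < +oo)%E ->
  mu.-integrable `]0, 1[ (EFin \o (fun r => r * cmean f s r)).
Proof.
move=> fD s1; rewrite /bergman_norm (bergman_integral fD s1) => fin.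
have I0 : (0 <= \int[mu]_(r in `]0%R, 1%R[) (r * cmean f s r)%:E)%E.
  by apply: integral_ge0 => r r01; rewrite lee_fin; exact: r_cmean_ge0.
apply/integrableP; split; first by apply/measurable_EFinP; exact: measurable_r_cmean fD s1.
apply: (@le_lt_trans _ _ (\int[mu]_(r in `]0%R, 1%R[) (r * cmean f s r)%:E)%E).
  rewrite le_eqVlt; apply/orP; left; apply/eqP; apply: eq_integral => r; rewrite inE => r01 /=.
  by rewrite ger0_norm//; exact: r_cmean_ge0.
move: fin I0; case: (\int[mu]_(r in _) _)%E => [x _ _| |]; rewrite ?ltry//.
rewrite gt0_muley ?lte_fin ?invr_gt0 ?pi_gt0// poweRyr ?ltxx// invr_eq0 gt_eqF//.
exact: lt_trans s1.
Qed.

Lemma hardy_bergman_integrable f D (s G : R) : holo f D -> 1 < s ->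
  (forall r, 0 < r -> r < 1 -> cmean f s r <= G) ->
  mu.-integrable `]0, 1[ (EFin \o (fun r => r * cmean f s r)).
Proof.
move=> fD s1 fG.
have mI : measurable (`]0, 1[%classic : set (measurableTypeR R)) by exact: measurable_itv.
apply: (@le_integrable _ _ _ mu _ mI _ (cst G%:E)).
- by apply/measurable_EFinP; exact: measurable_r_cmean fD s1.
- move=> r; rewrite /= in_itv/= => /andP[r0 r1]; rewrite lee_fin.
  have m0 := cmean_ge0 f s r; have mG := fG _ r0 r1.
  rewrite !ger0_norm ?(le_trans m0 mG) ?mulr_ge0 ?(ltW r0)//.
  by apply: le_trans mG; apply: ler_piMl => //; exact: ltW.
- apply/integrableP; split=> //.
  by rewrite (integral_cst _ mI)/= lebesgue_measure_itv/= lte_fin ltr01 -EFinD -EFinM ltry.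
Qed.

(** Monotonicity of the means propagates positivity at r0 to the whole of ]r0, 1[. *)
Lemma Rintegral_r_cmean_gt0 f D (s r0 : R) : holo f D -> 1 < s ->
  mu.-integrable `]0, 1[ (EFin \o (fun r => r * cmean f s r)) ->
  0 < r0 -> r0 < 1 -> 0 < cmean f s r0 ->
  0 < \int[mu]_(r in `]0, 1[) (r * cmean f s r).
Proof.
move=> fD s1 fi r00 r01 m0.
have mI : measurable (`]0, 1[%classic : set (measurableTypeR R)) by exact: measurable_itv.
have mJ : measurable (`]r0, 1[%classic : set (measurableTypeR R)) by exact: measurable_itv.
have mf := measurable_r_cmean fD s1.
have sub : (`]r0, 1[%classic : set R) `<=` `]0, 1[%classic.
  by move=> r /=; rewrite !in_itv/= => /andP[rr0 ->]; rewrite (lt_trans r00 rr0).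
have fin : (\int[mu]_(r in `]0%R, 1%R[) (r * cmean f s r)%:E)%E \is a fin_num.
  by apply: integrable_fin_num => //; exact: mI.
rewrite -lte_fin /Rintegral fineK//.
apply: (@lt_le_trans _ _ (\int[mu]_(r in `]r0, 1%R[) (r0 * cmean f s r0)%:E)%E).
  rewrite (integral_cst _ mJ)/= lebesgue_measure_itv/= lte_fin r01 -EFinD -EFinM lte_fin.
  by rewrite !mulr_gt0// subr_gt0.
apply: (@le_trans _ _ (\int[mu]_(r in `]r0, 1%R[) (r * cmean f s r)%:E)%E).
  apply: ge0_le_integral; first exact: mJ.
  - by move=> r _; rewrite lee_fin; exact: mulr_ge0 (ltW r00) (ltW m0).
  - exact: measurable_cst.
  - by apply/measurable_EFinP; apply: measurable_funS mf.
  - move=> r; rewrite /= in_itv/= => /andP[rr0 r1]; rewrite lee_fin.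
    apply: ler_pM; [exact: ltW|exact: ltW|exact: ltW|].
    by apply: (cmean_nondecreasing fD s1) => //; exact: ltW.
apply: ge0_subset_integral => //; first exact/measurable_EFinP.
by move=> r r1; rewrite lee_fin; exact: r_cmean_ge0.
Qed.

(** Holder with A = B^(1/p) and B the normalised mean plus 1: since B >= 1, A <= B. The bound is
    then linear in the mean, hence integrable in r whenever f is in A^p. *)
Lemma circ_re_pair_le f g D E (p q G r : R) : holo f D -> holo g E ->
  1 < p -> 1 < q -> p^-1 + q^-1 = 1 -> 0 < G -> `|r| < 1 ->
  cmean g q r <= 2 * pi * G `^ q ->
  circ (fun u => `|re_pair f g u|) r <= G * (cmean f p r + 2 * pi).
Proof.
move=> fD gE p1 q1 pq G0 r1 gG.
have P0 : 0 < 2 * pi :> R by rewrite mulr_gt0// pi_gt0.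
have p0 : 0 < p by exact: lt_trans p1.
have m0 := cmean_ge0 f p r.
pose B := cmean f p r / (2 * pi) + 1.
have B1 : 1 <= B by rewrite lerDr divr_ge0// ltW.
have B0 : 0 < B by exact: lt_le_trans B1.
pose A := B `^ p^-1.
have Ap : A `^ p = B by rewrite /A -powRrM mulVf ?powRr1 ?(ltW B0)// gt_eqF.
have AB : A <= B.
  rewrite -[leRHS](powRr1 (ltW B0)); apply: ler_powR => //.
  by rewrite invf_le1// ltW.
have BE : 2 * pi * B = cmean f p r + 2 * pi.
  by rewrite /B mulrDr mulr1 mulrCA mulfV ?mulr1// gt_eqF.
have fA : cmean f p r <= 2 * pi * A `^ p by rewrite Ap BE lerDl ltW.
apply: (le_trans (circ_norm_re_pair fD gE p1 q1 pq (powR_gt0 _ B0) G0 r1 fA gG)).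
rewrite -BE [G * _]mulrC; apply: ler_wpM2r; first exact: ltW.
by apply: ler_wpM2l => //; exact: ltW.
Qed.

Lemma Re_psi f g : complex.Re (psi g f) = \int[sigma]_(u in disc_coord) re_pair f g u.
Proof. by []. Qed.

Lemma Re_psi_circ f g D E (p q G : R) : holo f D -> holo g E ->
  1 < p -> 1 < q -> p^-1 + q^-1 = 1 -> 0 < G ->
  (forall r, 0 < r -> r < 1 -> cmean g q r <= 2 * pi * G `^ q) ->
  mu.-integrable `]0, 1[ (EFin \o (fun r => r * cmean f p r)) ->
  mu.-integrable `]0, 1[ (EFin \o (fun r => r * circ (re_pair f g) r)) /\
  complex.Re (psi g f) = pi^-1 * \int[mu]_(r in `]0, 1[) (r * circ (re_pair f g) r).
Proof.
move=> fD gE p1 q1 pq G0 gG fi.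
have mI : measurable (`]0, 1[%classic : set (measurableTypeR R)) by exact: measurable_itv.
have ck := cont_disc_re_pair fD gE.
have P0 : 0 < 2 * pi :> R by rewrite mulr_gt0// pi_gt0.
have i1 : mu.-integrable `]0, 1[ (cst (2 * pi * G)%:E).
  by apply/integrableP; split=> //; rewrite (integral_cst _ mI)/= lebesgue_measure_itv/= lte_fin ltr01 -EFinD -EFinM ltry.
have i2 := @integrableZl _ _ _ mu _ mI G _ fi.
have i3 := integrableD mI i2 i1.
have fin : (\int[mu]_(r in `]0%R, 1%R[) (r * circ (fun u => `|re_pair f g u|) r)%:E < +oo)%E.
  apply: le_lt_trans (integrable_lty mI i3).
  apply: ge0_le_integral => //.
  - move=> r; rewrite /= in_itv/= => /andP[r0 r1]; rewrite lee_fin mulr_ge0 ?(ltW r0)//.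
    by apply: circ_ge0 => //; rewrite gtr0_norm.
  - by apply/measurable_EFinP; apply: measurable_r_circ; exact: cont_disc_norm.
  - exact: measurable_int i3.
  - move=> r; rewrite /= in_itv/= => /andP[r0 r1]; rewrite -EFinM -EFinD lee_fin.
    have r1' : `|r| < 1 by rewrite gtr0_norm.
    have H := circ_re_pair_le fD gE p1 q1 pq G0 r1' (gG _ r0 r1).
    apply: (le_trans (ler_wpM2l (ltW r0) H)).
    have : 0 <= 2 * pi * G by rewrite mulr_ge0// ltW.
    by move: (cmean f p r) (2 * pi) H => m P _; nra.
split; first exact: integrable_r_circ ck fin.
by rewrite Re_psi (Rintegral_polar ck fin).
Qed.

End BergmanMeans.

(** * Dilations and their pairing with g *)

Section Dilation.
Context {R : realType}.
Local Notation mu := (@lebesgue_measure R).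
Local Notation N := (@ComplexField.Normc.normc R).
Implicit Types (f g D E : R[i] -> R[i]).

Definition dilation f (a c : R) (z : R[i]) : R[i] := a%:C * f (c%:C * z).

Lemma dilation_analytic f (a c : R) : 0 < c -> c <= 1 -> analytic_on unit_disc f ->
  analytic_on unit_disc (dilation f a c).
Proof.
move=> c0 c1 fa z zD.
have cN (w : R[i]) : N (c%:C * w) = c * N w.
  by rewrite ComplexField.Normc.normcM normc_real gtr0_norm.
have czD : unit_disc (c%:C * z).
  by rewrite /unit_disc/= cN; apply: le_lt_trans zD; apply: ler_piMl => //; exact: normc_ge0.
have [u [r [r0 ur]]] := fa _ czD.
exists (fun n => a%:C * (c%:C ^+ n * u n)), r; split => // w wz.
have H : N (c%:C * w - c%:C * z) < r.
  by rewrite -mulrBr cN; apply: le_lt_trans wz; apply: ler_piMl => //; exact: normc_ge0.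
have -> : series (fun n => a%:C * (c%:C ^+ n * u n) * (w - z) ^+ n : R[i]^o) =
  (fun n => (a%:C : R[i]) *: (series (fun n => u n * (c%:C * w - c%:C * z) ^+ n : R[i]^o) n : R[i]^o)).
  apply/funext => n; rewrite /series/= scaler_sumr; apply: eq_bigr => i _.
  by rewrite -mulrBr exprMn /GRing.scale/=; ring.
by apply: cvgZr; exact: ur.
Qed.

Lemma dilation_circle f (a c r t : R) :
  dilation f a c (to_complex (r * cos t, r * sin t)) =
  a%:C * f (to_complex (c * r * cos t, c * r * sin t)).
Proof.
by rewrite /dilation /to_complex/=; congr (_ * f _); apply/eqP; rewrite eq_complex/= !mul0r subr0 addr0 !mulrA !eqxx.
Qed.

Lemma cmean_dilation f D (p a c r : R) : holo f D -> 1 < p -> 0 < a ->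
  `|c * r| < 1 -> cmean (dilation f a c) p r = a `^ p * cmean f p (c * r).
Proof.
move=> fD p1 a0 cr; rewrite /cmean -(circZ (a `^ p) (cont_disc_powN fD p1) cr).
apply: eq_Rintegral => t _; rewrite /powN dilation_circle ComplexField.Normc.normcM.
by rewrite powRM ?normc_ge0// normc_real gtr0_norm.
Qed.

(** The radii c r of f and r of g have product (k r)^2, so [pairing_invariant] moves both functions
    to the common radius k r. *)
Lemma circ_re_pair_dilation f g D E (a c k r : R) : holo f D -> holo g E ->
  0 < k -> k < 1 -> k ^+ 2 = c -> 0 < r -> r < 1 ->
  circ (re_pair (dilation f a c) g) r = a * circ (re_pair f g) (k * r).
Proof.
move=> fD gE k0 k1 kc r0 r1.
have c0 : 0 < c by rewrite -kc exprn_gt0.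
have c1 : c < 1 by rewrite -kc expr_lt1// ltW.
have kr0 : 0 < k * r by exact: mulr_gt0.
have kr1 : k * r < 1 by rewrite mulr_ilt1// ltW.
have cr0 : 0 < c * r by exact: mulr_gt0.
have cr1 : c * r < 1 by rewrite mulr_ilt1// ltW.
have kr1' : `|k * r| < 1 by rewrite gtr0_norm.
have -> : circ (re_pair f g) (k * r) = \int[mu]_(t in `[0, 2 * pi]) pair_integrand f g (k * r) (k * r) t.
  by apply: eq_Rintegral => t _; rewrite re_pairE /pair_integrand !on_circle_origin.
rewrite -(@pairing_invariant _ f D g E (c * r) r) ?cr0 ?r0 ?kr0//; last by rewrite -kc; ring.
rewrite /circ -RintegralZl//; last first.
  apply: continuous_itv_integrable => t.
  have cx (s : R) : {for t, continuous (fun t => complex.Re (0 : R[i]) + s * cos t)}.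
    by apply: cvgD; [exact: cvg_cst|apply: cvgMr; exact: continuous_cos].
  have cy (s : R) : {for t, continuous (fun t => complex.Im (0 : R[i]) + s * sin t)}.
    by apply: cvgD; [exact: cvg_cst|apply: cvgMr; exact: continuous_sin].
  have inD (s : R) : 0 < s -> s < 1 -> unit_disc (on_circle 0 s t).
    by move=> s0 s1; apply: on_circle_disc; rewrite ComplexField.Normc.normc0 add0r gtr0_norm.
  have nf := holo_ncont fD (inD _ cr0 cr1); have ng := holo_ncont gE (inD _ r0 r1).
  by apply: cvgD; apply: cvgM; [exact: (ncont_Re (cx (c * r)) (cy (c * r)) nf)|
    exact: (ncont_Re (cx r) (cy r) ng)|exact: (ncont_Im (cx (c * r)) (cy (c * r)) nf)|
    exact: (ncont_Im (cx r) (cy r) ng)].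
apply: eq_Rintegral => t _; rewrite re_pairE dilation_circle /pair_integrand !on_circle_origin.
by case: (f _) => x y /=; rewrite !mul0r subr0 addr0; ring.
Qed.

End Dilation.

(** * Extremality tested on dilations *)

Section Extremal.
Context {R : realType}.
Local Notation mu := (@lebesgue_measure R).
Local Notation N := (@ComplexField.Normc.normc R).
Lemma powR_pred (x y : R) : 0 < x -> x `^ (y - 1) = x `^ y / x.
Proof.
by move=> x0; rewrite powRD ?powR_inv1 ?(ltW x0)//; apply/implyP => _; rewrite gt_eqF.
Qed.

Lemma powRNM (x y : R) : 0 < x -> x `^ (- y) * x `^ y = 1.
Proof.
by move=> x0; rewrite -powRD ?addNr ?powRr0//; apply/implyP => _; rewrite gt_eqF.
Qed.

Variables (p q G Phi : R) (f D g E : R[i] -> R[i]).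
Hypotheses (fa : analytic_on unit_disc f) (fD : holo f D) (gE : holo g E).
Hypotheses (p1 : 1 < p) (q1 : 1 < q) (pq : p^-1 + q^-1 = 1) (G0 : 0 < G) (Phi0 : 0 < Phi).
Hypothesis gG : forall r, 0 < r -> r < 1 -> cmean g q r <= 2 * pi * G `^ q.
Hypothesis fi : mu.-integrable `]0, 1[ (EFin \o (fun r => r * cmean f p r)).
Hypothesis f1 : \int[mu]_(r in `]0, 1[) (r * cmean f p r) = pi.
Hypothesis fPhi : complex.Re (psi g f) = Phi.
Hypothesis PhiP : forall h, bergman p h -> (bergman_norm p h <= 1)%E -> complex.Re (psi g h) <= Phi.

(* The competitor is the dilation [a f(c z)], with [a] making its norm slightly
   less than 1; the exponent 1/p is removed by concavity. *)
Lemma extremal_dilation (c k : R) : 0 < c -> c < 1 -> 0 < k -> k ^+ 2 = c ->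
  Phi / p * (\int[mu]_(r in `]0, 1[) (r * cmean f p r) - \int[mu]_(r in `]0, c[) (r * cmean f p r))
  <= \int[mu]_(r in `]0, 1[) (r * circ (re_pair f g) r)
     - c `^ (2 / p - 1) * \int[mu]_(r in `]0, k[) (r * circ (re_pair f g) r).
Proof.
move=> c0 c1 k0 kc.
have k1 : k < 1.
  rewrite ltNge; apply/negP => k1; move: c1; rewrite -kc ltNge => /negP; apply.
  by rewrite exprn_ege1.
have p0 : 0 < p by exact: lt_trans p1.
have pi0 : 0 < pi :> R by exact: pi_gt0.
pose Jc := \int[mu]_(r in `]0, c[) (r * cmean f p r).
pose Bk := \int[mu]_(r in `]0, k[) (r * circ (re_pair f g) r).
have ck := cont_disc_re_pair fD gE.
have Jc0 : 0 <= Jc.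
  apply: Rintegral_ge0 => r; rewrite /= in_itv/= => /andP[r0 _].
  by apply: mulr_ge0; [exact: ltW|exact: cmean_ge0].
have scm : \int[mu]_(r in `]0, 1[) (c * r * cmean f p (c * r)) = c^-1 * Jc.
  apply: (@Rintegral_scale _ (fun r => r * cmean f p r)) => // r /andP[r0 rc].
  apply: cvgM; first exact: cvg_id.
  apply: (continuous_cmean fD p1); rewrite (le_lt_trans rc c1) andbT.
  by rewrite (lt_le_trans _ r0)// ltrN10.
have scb : \int[mu]_(r in `]0, 1[) (k * r * circ (re_pair f g) (k * r)) = k^-1 * Bk.
  apply: (@Rintegral_scale _ (fun r => r * circ (re_pair f g) r)) => // r /andP[r0 rk].
  apply: cvgM; first exact: cvg_id.
  apply: (continuous_circ ck); rewrite (le_lt_trans rk k1) andbT.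
  by rewrite (lt_le_trans _ r0)// ltrN10.
have fB := (Re_psi_circ fD gE p1 q1 pq G0 gG fi).2.
have fBE : \int[mu]_(r in `]0, 1[) (r * circ (re_pair f g) r) = pi * Phi.
  by rewrite -fPhi fB mulrA mulfV ?mul1r// gt_eqF.
rewrite f1 fBE -/Jc -/Bk.
(* Here pi^-1 [Jc] is the area integral of |f|^p over |z| < c, and e > 0 will keep the base of a
   negative power positive. The result is affine in e, so e can be sent to 0. *)
suff H e : 0 < e -> c `^ (2 / p - 1) * Bk <= pi * Phi * (1 + p^-1 * (pi^-1 * Jc + e - 1)).
  rewrite lerBrDr addrC -lerBrDr; apply/ler_addgt0Pr => e e0.
  have e0' : 0 < e * p / (pi * Phi) by rewrite divr_gt0 ?mulr_gt0.
  apply: (le_trans (H _ e0')).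
  rewrite le_eqVlt; apply/orP; left; apply/eqP.
  by move: (pi : R) pi0 => P P0; field; rewrite !gt_eqF.
have [J JE] : exists J, J = pi^-1 * Jc := ex_intro _ _ erefl.
have JcE : Jc = pi * J by rewrite JE mulrA mulfV ?mul1r// gt_eqF.
have J0 : 0 <= J by rewrite JE mulr_ge0// invr_ge0 ltW.
move=> e0; rewrite -JE; clearbody Jc Bk.
have Je : 0 < J + e by rewrite ltr_wpDl.
(* Chosen so that the p-th power of the norm, a^p J / c^2, equals J/(J + e) <= 1. *)
have [a aJ] : exists a, a = c `^ (2 / p) * (J + e) `^ (- p^-1) := ex_intro _ _ erefl.
have a0 : 0 < a by rewrite aJ mulr_gt0// powR_gt0.
have ap : a `^ p = c ^+ 2 / (J + e).
  rewrite aJ powRM ?powR_ge0// -!powRrM mulfVK ?gt_eqF// mulNr mulVf ?gt_eqF//.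
  by rewrite powR_inv1 ?(ltW Je)// powR_mulrn// ltW.
pose h := dilation f a c.
have ha : analytic_on unit_disc h by apply: dilation_analytic => //; exact: ltW.
have [Dh hD] := analytic_C11 ha.
have cr r : 0 < r -> r < 1 -> 0 < c * r /\ c * r < c.
  by move=> r0 r1; rewrite mulr_gt0// gtr_pMr.
have hm r : 0 < r -> r < 1 -> cmean h p r = a `^ p * cmean f p (c * r).
  move=> r0 r1; have [cr0 crc] := cr _ r0 r1.
  by apply: (cmean_dilation fD p1 a0); rewrite gtr0_norm// (lt_trans crc).
(* The dilation only sees f on |z| < c, so its means are bounded by those of f at radius c. *)
have hi : mu.-integrable `]0, 1[ (EFin \o (fun r => r * cmean h p r)).
  apply: (@hardy_bergman_integrable _ _ _ _ (a `^ p * cmean f p c) hD p1) => r r0 r1.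
  have [cr0 crc] := cr _ r0 r1.
  rewrite (hm _ r0 r1); apply: ler_wpM2l; first exact: powR_ge0.
  by apply: (cmean_nondecreasing fD p1) => //; exact: ltW.
have hI : \int[mu]_(r in `]0, 1[) (r * cmean h p r) = pi * (J / (J + e)).
  set I := LHS.
  have : c^-1 * Jc = c / a `^ p * I.
    rewrite -scm -RintegralZl//; apply: eq_Rintegral => r; rewrite inE/= in_itv/= => /andP[r0 r1].
    rewrite (hm _ r0 r1); have := powR_gt0 p a0; move: (a `^ p) (cmean f p _) => A M A0; field.
    by rewrite gt_eqF.
  rewrite ap; move: I => I.
  rewrite JcE.
  move=> H; have -> : I = c / (J + e) * (c / (c ^+ 2 / (J + e)) * I) by field; rewrite !gt_eqF.
  rewrite -H; move: (pi : R) => P; field.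
  by rewrite !gt_eqF.
have hB : (bergman_norm p h <= 1)%E.
  rewrite (bergman_normE hD p1 hi) hI mulrA mulVf ?gt_eqF// mul1r lee_fin.
  have -> : 1 = 1 `^ p^-1 :> R by rewrite powR1.
  apply: ge0_ler_powR; rewrite ?nnegrE ?invr_ge0 ?(ltW p0)//.
    by rewrite divr_ge0// ltW.
  by rewrite ler_pdivrMr// mul1r lerDl ltW.
have hberg : bergman p h by split => //; apply: le_lt_trans hB _; rewrite ltry.
have [hbi hbE] := Re_psi_circ hD gE p1 q1 pq G0 gG hi.
set I := \int[mu]_(r in `]0, 1[) (r * circ (re_pair h g) r) in hbE.
have hb : k^-1 * Bk = k / a * I.
  rewrite -scb -RintegralZl//; apply: eq_Rintegral => r; rewrite inE/= in_itv/= => /andP[r0 r1].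
  rewrite (circ_re_pair_dilation _ fD gE k0 k1 kc r0 r1).
  by move: (circ _ _) => M; field; rewrite gt_eqF.
have piE : pi * complex.Re (psi g h) = I by rewrite hbE (mulVKf (lt0r_neq0 pi0)).
have BkE : Bk = k * (k / a * I) by rewrite -hb (mulVKf (lt0r_neq0 k0)).
have aE : c `^ (2 / p - 1) = a * (J + e) `^ p^-1 / c.
  have <- : c `^ (2 / p) = a * (J + e) `^ p^-1 by rewrite aJ -mulrA (powRNM _ Je) mulr1.
  exact: powR_pred.
(* The pairing of [h] is a k^-2 [Bk] / pi with k^2 = c, and a/c = c^(2/p-1) (J + e)^(-1/p);
   extremality bounds it by [Phi]. *)
have H2 : c `^ (2 / p - 1) * Bk <= pi * Phi * (J + e) `^ p^-1.
  have -> : c `^ (2 / p - 1) * Bk = (J + e) `^ p^-1 * (pi * complex.Re (psi g h)).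
    rewrite aE piE BkE -kc; move: (I) ((J + e) `^ p^-1) (a) (lt0r_neq0 a0) => X S y y0; field.
    by rewrite y0 gt_eqF.
  rewrite [leRHS]mulrC; apply: ler_wpM2l; first exact: powR_ge0.
  by apply: ler_wpM2l; [exact: ltW|exact: PhiP].
apply: (le_trans H2); apply: ler_wpM2l; first exact: mulr_ge0 (ltW pi0) (ltW Phi0).
apply: powR_concave_tangent; first exact: ltW.
by rewrite invr_ge0 (ltW p0)/= invf_lt1.
Qed.

End Extremal.

Local Close Scope complex_scope.

Theorem theorem4p2 (R : realType) (p q Cp : R)
    (g fstar : R[i] -> R[i]) (phi : (R[i] -> R[i]) -> R[i])
    (hp : 1 < p)
    (hpq : p^-1 + q^-1 = 1)
    (hCp : forall h : R[i] -> R[i], bergman q h ->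
       (bergman_norm q h <= Cp%:E * dual_norm p (psi h))%E)
    (hg : hardy q g)
    (hg0 : exists2 z, unit_disc z & g z != 0)
    (hphi : forall f : R[i] -> R[i], bergman p f -> phi f = psi g f)
    (hfstar : extremal p phi fstar) :
  hardy p fstar /\
  (hardy_norm p fstar <=
     ((Num.max (p - 1) 1 *
        (Cp * fine (hardy_norm q g) / fine (bergman_norm q g))) `^ (q / p))%:E)%E.
Proof.
have p0 : 0 < p by exact: lt_trans hp.
have pV : p^-1 < 1 by rewrite invf_lt1.
have qE : q^-1 = 1 - p^-1 by rewrite -hpq addrC addKr.
have q0 : 0 < q by rewrite -invr_gt0 qE subr_gt0.
have q1 : 1 < q by rewrite -invf_lt1// qE gtrBl invr_gt0.
have pm0 : p - 1 != 0 by rewrite subr_eq0 gt_eqF.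
have qp : q / p = p / (p - 1) * p^-1.
  rewrite -[q]invrK qE; field.
  by rewrite pm0 gt_eqF.
have P0 : 0 < 2 * pi :> R by rewrite mulr_gt0// pi_gt0.
have [ga gfin] := hg; have [E gE] := analytic_C11 ga; have [z zD gz] := hg0.
have [[fa ffin] fn _ fdual] := hfstar; have [D fD] := analytic_C11 fa.
set G := fine (hardy_norm q g).
have gG r : 0 < r -> r < 1 -> cmean g q r <= 2 * pi * G `^ q.
  by move=> r0 r1; exact: (hardy_cmean_le gE q1 gfin r0 r1).2.
have [r0 [r00 r01 gr0]] := cmean_gt0 gE q1 zD gz.
(* A nonzero value of g forces some circle mean to be positive, which the Hardy norm dominates. *)
have G0 : 0 < G.
  rewrite lt_neqAle (hardy_cmean_le gE q1 gfin r00 r01).1 andbT eq_sym.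
  apply/eqP => G0; have := lt_le_trans gr0 (gG _ r00 r01).
  by rewrite G0 powR0 ?gt_eqF// mulr0 ltxx.
have gi := hardy_bergman_integrable gE q1 gG.
have gI := Rintegral_r_cmean_gt0 gE q1 gi r00 r01 gr0.
have gB := bergman_normE gE q1 gi.
set B := (X in X%:E) in gB.
have B0 : 0 < B by rewrite powR_gt0// mulr_gt0// invr_gt0 pi_gt0.
have gberg : bergman q g by split => //; rewrite gB ltry.
have fberg : bergman p fstar by [].
pose Phi := complex.Re (psi g fstar).
(* [phi] and [psi g] agree on A^p, the only functions entering the dual norm, so the value attained
   at [fstar] is also the norm of [psi g]. *)
have dualE : dual_norm p (psi g) = Phi%:E.
  rewrite /Phi -hphi// fdual; congr (ereal_sup _); apply/seteqP; split => _ [h [hb h1] <-];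
    by exists h => //; rewrite hphi.
have dual_le h : bergman p h -> (bergman_norm p h <= 1)%E ->
    ComplexField.Normc.normc (psi g h) <= Phi.
  by move=> hb h1; rewrite -lee_fin -dualE; apply: ereal_sup_ubound; exists h.
have PhiP h : bergman p h -> (bergman_norm p h <= 1)%E -> complex.Re (psi g h) <= Phi.
  move=> hb h1; apply: le_trans (dual_le h hb h1).
  by apply: le_trans (ler_Re_normc _); exact: ler_norm.
have PhiGe0 : 0 <= Phi.
  by apply: le_trans (dual_le fstar fberg _); [exact: normc_ge0|rewrite fn].
(* The only use of the duality constant. As B > 0, it also forces [Phi] and [Cp] to be positive. *)
have BPhi : B <= Cp * Phi by have := hCp g gberg; rewrite gB dualE -EFinM lee_fin.
have Phi0 : 0 < Phi.
  rewrite lt_neqAle PhiGe0 andbT; apply/eqP => E0; move: BPhi.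
  by rewrite -E0 mulr0 leNgt B0.
have Cp0 : 0 < Cp by rewrite -(pmulr_lgt0 _ Phi0); exact: lt_le_trans BPhi.
have fi := bergman_integrable fD hp ffin.
(* Unit norm in polar form; the value pi comes from the normalisation of [sigma]. *)
have f1 : \int[lebesgue_measure]_(r in `]0, 1[) (r * cmean fstar p r) = pi.
  move: fn; rewrite (bergman_normE fD hp fi) => -[].
  set I := Rintegral _ _ _ => H.
  have I0 : 0 <= I by apply: Rintegral_ge0 => r; exact: r_cmean_ge0.
  have J0 : 0 <= pi^-1 * I by rewrite mulr_ge0// invr_ge0 pi_ge0.
  have : (pi^-1 * I) `^ p^-1 `^ p = 1 by rewrite H powR1.
  rewrite -powRrM mulVf ?gt_eqF// powRr1// => /(congr1 (fun x => pi * x)).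
  by rewrite mulVKf ?mulr1// gt_eqF// pi_gt0.
have ck := cont_disc_re_pair fD gE.
have bm r A : 0 < r -> r < 1 -> 0 < A -> cmean fstar p r <= 2 * pi * A `^ p ->
    `|circ (re_pair fstar g) r| <= 2 * pi * A * G.
  move=> rp rl A0 mA; have r1 : `|r| < 1 by rewrite gtr0_norm.
  apply: le_trans (circ_norm_re_pair fD gE hp q1 hpq A0 G0 r1 mA (gG _ rp rl)).
  have mI : measurable (`[0, 2 * pi]%classic : set (measurableTypeR R)) by exact: measurable_itv.
  exact: (le_normr_Rintegral mI (integrable_circ ck r1)).
have bi := (Re_psi_circ fD gE hp q1 hpq G0 gG fi).1.
have bound := mean_bound hp G0 Phi0 (cmean_ge0 fstar p)
  (cmean_nondecreasing fD hp) fi bi bm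
  (extremal_dilation fa fD gE hp q1 hpq G0 Phi0 gG fi f1 erefl PhiP).
have H := hardy_norm_le fD hp bound.
split; first by split => //; apply: le_lt_trans H _; rewrite ltry.
apply: (le_trans H); rewrite lee_fin -powRrM -qp gB.
have M0 : 0 < Num.max (p - 1) 1 by rewrite lt_max ltr01 orbT.
apply: ge0_ler_powR; rewrite ?nnegrE ?divr_ge0 ?(ltW q0) ?(ltW p0)//.
- by rewrite mulr_ge0 ?(ltW M0)// ltW.
- by rewrite mulr_ge0 ?(ltW M0)// divr_ge0 ?mulr_ge0 ?(ltW Cp0) ?(ltW G0) ?(ltW B0).
(* What remains is G / Phi <= Cp G / B, a rearrangement of [BPhi]. *)
rewrite -mulrA; apply: ler_wpM2l; first exact: ltW.
by rewrite ler_pdivrMr// mulrAC ler_pdivlMr// mulrAC [G * _]mulrC; apply: ler_wpM2r => //; exact: ltW.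
Qed.
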